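(* With the simplicial complexes $\mathcal{T}$, $T_1,T_2,T_3$ and $T_{j,n}$ ($1\le j\le 3$, $n\ge 0$) defined in the context, the following hold. (i) $T_{j,n}$ is a subdivision of $T_j$ for $1\le j\le 3$ and $n\ge 0$. (ii) $T_{i,k}\cong T_{j,\ell}$ and $T_{i,m}\cong T_{j,n}$ for $1\le i,j\le 3$, $0\le k,\ell\le 6$ and $m,n\ge 7$. (iii) $\partial T_{j,n}=\mathcal{T}$ for $1\le j\le 3$ and $n\ge 0$. (iv) $T_i\cap T_{j,n}=\mathcal{T}=T_{i,m}\cap T_{j,n}$ for $1\le i\ne j\le 3$ and $m,n\ge 0$. (v) $T_{j,m}\cap T_{j,n}=\mathcal{T}=T_j\cap T_{j,\ell}$ for $1\le j\le 3$, $m\ne n$ with $m,n\ge 0$, and $\ell\ge 7$. (vi) $T_i\cup T_{j,n}$ and $T_{i,m}\cup T_{j,n}$ triangulate $S^3$ for $1\le i\ne j\le 3$ and $m,n\ge 0$. (vii) $T_{j,m}\cup T_{j,n}$ and $T_j\cup T_{j,\ell}$ triangulate $S^2\times S^1$ for $1\le j\le 3$, $m\ne n$ with $m,n\ge 0$, and $\ell\ge 7$.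
   Context: All simplicial complexes are finite abstract complexes. A pure complex is identified with the set of its facets (maximal faces); unions and intersections of complexes are taken as sets of all faces. A string such as $0123$ denotes the simplex $\{0,1,2,3\}$. $X\cong Y$ means that $X$ and $Y$ are isomorphic simplicial complexes. $X$ triangulates a space $M$ if the geometric carrier $|X|$ is homeomorphic to $M$. For a pure $d$-dimensional complex in which each $(d-1)$-face is in at most two facets, $\partial X$ is the pure $(d-1)$-dimensional complex whose facets are the $(d-1)$-faces lying in exactly one facet. A subdivision of a simplicial complex $X$ is a simplicial complex $X'$ together with a homeomorphism from $|X'|$ onto $|X|$ which is facewise linear. On the vertex set $\mathbb{Z}_7=\{0,\dots,6\}$ let $\mathcal{T}=\{013,124,235,346,045,156,026,023,134,245,356,046,015,126\}$ (a 7-vertex torus), and $T_1=\{0123,1234,2345,3456,0456,0156,0126\}$, $T_2=\{0246,1246,1346,1356,0135,0235,0245\}$, $T_3=\{0145,1245,1256,2356,0236,0346,0134\}$ (three triangulated solid tori, each with boundary $\mathcal{T}$). Let $u_{j,n},v_{j,n},w_{j,n}$ ($1\le j\le 3$, $n\ge 0$) be pairwise distinct new vertices not in $\mathbb{Z}_7$. Writing $u=u_{1,0}$, $v=v_{1,0}$, $w=w_{1,0}$, let $T_{1,0}$ be the complex with facets $u012,u013,u023,u124,u134,u235,u245$; $v346,v356,v045,v046,v015,v156,v012,v026,v126$; $uv34,uv35,uv45$. (It is obtained from $T_1=B_1\cup B_2$, $B_1=\{0123,1234,2345\}$, $B_2=\{3456,0456,0156,0126\}$, by replacing $B_1$ by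 the cone $u\ast\partial B_1$, $B_2$ by the cone $v\ast\partial B_2$, and then performing the bistellar move $345\mapsto uv$, i.e. replacing the facets $u345,v345$ by $uv34,uv35,uv45$.) Let $T'_{1,0}$ be obtained from $T_{1,0}$ by starring the new vertex $w$ in the face $012$, i.e. by replacing the facets $u012,v012$ with $uw01,uw02,uw12,vw01,vw02,vw12$. For $1\le j\le 3$ and $n\ge 0$, $T_{j,n}$ is the image of $T_{1,0}$ if $0\le n\le 6$, and of $T'_{1,0}$ if $n\ge 7$, under the relabelling of vertices $x\mapsto 2^{j-1}x+n \pmod 7$ for $x\in\mathbb{Z}_7$, $u_{1,0}\mapsto u_{j,n}$, $v_{1,0}\mapsto v_{j,n}$, $w_{1,0}\mapsto w_{j,n}$.
   Formalization: In (i), ''subdivision'' asks only for a homeomorphism between the carriers of some geometric realizations that is linear on each face of T_{j,n}, not mapping it into one face of T_j; with the standard carrier (i) fails, as u is joined to six vertices 0,…,5. *)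

(* Defs.v *)
From HB Require Import structures.
From mathcomp Require Import all_boot all_order all_algebra finmap.
From mathcomp Require Import all_classical all_reals all_analysis.
Import Order.TTheory GRing.Theory Num.Theory.
Import numFieldNormedType.Exports.

Set Implicit Arguments.
Unset Strict Implicit.
Unset Printing Implicit Defensive.

Local Open Scope classical_set_scope.
Local Open Scope fset_scope.
Local Open Scope ring_scope.

(* The empty set may be, and in a non-void complex is, a face; it contributes
   nothing to the geometric carrier. *)
Record complex (V : choiceType) := Complex {
  faces :> {fset {fset V}};
  _ : [forall s : faces, fpowerset (val s) `<=` faces] }.

HB.instance Definition _ (V : choiceType) := [isSub for @faces V].
HB.instance Definition _ (V : choiceType) := [Choice of complex V by <:].

Section Complexes.
Variable V : choiceType.
Implicit Types X Y : complex V.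

Lemma complexP X (s t : {fset V}) : s \in faces X -> t `<=` s -> t \in faces X.
Proof.
case: X => K /= /forallP cK sK ts; have /fsubsetP := cK [` sK]; apply.
by rewrite fpowersetE.
Qed.

Fact complex_subproof (K : {fset {fset V}}) :
  (forall s t : {fset V}, s \in K -> t `<=` s -> t \in K) ->
  [forall s : K, fpowerset (val s) `<=` K].
Proof.
move=> cK; apply/forallP => s; apply/fsubsetP => t.
by rewrite fpowersetE; apply: cK; exact: valP.
Qed.

Fact union_subproof X Y (s t : {fset V}) :
  s \in faces X `|` faces Y -> t `<=` s -> t \in faces X `|` faces Y.
Proof.
by rewrite !in_fsetU => /orP[] sK ts; rewrite (complexP sK ts) ?orbT.
Qed.

Definition complexU X Y : complex V :=
  Complex (complex_subproof (@union_subproof X Y)).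

Fact inter_subproof X Y (s t : {fset V}) :
  s \in faces X `&` faces Y -> t `<=` s -> t \in faces X `&` faces Y.
Proof.
by rewrite !in_fsetI => /andP[sX sY] ts; rewrite (complexP sX ts) (complexP sY).
Qed.

Definition complexI X Y : complex V :=
  Complex (complex_subproof (@inter_subproof X Y)).

Fact generated_subproof (F : seq {fset V}) (s t : {fset V}) :
  s \in \bigcup_(f <- F) fpowerset f -> t `<=` s ->
  t \in \bigcup_(f <- F) fpowerset f.
Proof.
move=> /bigfcupP[f fF]; rewrite fpowersetE => sf ts.
by apply/bigfcupP; exists f; rewrite // fpowersetE (fsubset_trans ts).
Qed.

(* The complex consisting of the members of F and all their subsets. *)
Definition generated (F : seq {fset V}) : complex V :=
  Complex (complex_subproof (@generated_subproof F)).

Definition of_facets (F : seq (seq V)) : complex V :=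
  generated [seq [fset v in f] | f <- F].

Definition facets X : {fset {fset V}} :=
  [fset f in faces X | [forall s : faces X, (f `<=` val s) ==> (f == val s)]].

Definition pure (d : nat) X := forall f, f \in facets X -> #|` f| = d.+1.

Definition degree X (s : {fset V}) : nat :=
  #|` [fset f in facets X | s `<=` f]|.

(* B is the boundary of X; the first two conditions say that it is defined. *)
Definition is_boundary (d : nat) X B : Prop :=
  [/\ pure d X,
      (forall s, s \in faces X -> #|` s| = d -> (degree X s <= 2)%N)
    & B = generated
            [fset s in faces X | (#|` s| == d) && (degree X s == 1%N)] ].

Definition isomorphic (W : choiceType) X (Y : complex W) : Prop :=
  exists f : V -> W,
    {in [pred v | [fset v] \in faces X] &, injective f} /\
    [fset f @` (s : {fset V}) | s in faces X] = faces Y.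

End Complexes.

Notation "X |+| Y" := (complexU X Y) (at level 52, left associativity).
Notation "X |*| Y" := (complexI X Y) (at level 48, left associativity).
Notation "X ~= Y" := (isomorphic X Y) (at level 70, no associativity).

Section Geometry.
Variable R : realType.

Definition hull (V : choiceType) N (p : V -> 'rV[R]_N) (s : {fset V}) :
    set 'rV[R]_N :=
  [set x | exists a : V -> R, [/\ forall v, v \in s -> 0 <= a v,
     \sum_(v <- s) a v = 1 & x = \sum_(v <- s) a v *: p v] ].

Definition affinely_independent (V : choiceType) N (p : V -> 'rV[R]_N)
    (s : {fset V}) : Prop :=
  forall a : V -> R, \sum_(v <- s) a v = 0 -> \sum_(v <- s) a v *: p v = 0 ->
    forall v, v \in s -> a v = 0.

(* The vertex placement p makes X a geometric simplicial complex in R^N. *)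
Definition realization (V : choiceType) (X : complex V) N
    (p : V -> 'rV[R]_N) : Prop :=
  (forall s, s \in faces X -> affinely_independent p s) /\
  (forall s t, s \in faces X -> t \in faces X ->
     hull p s `&` hull p t = hull p (s `&` t)%fset)%classic.

Definition carrier (V : choiceType) (X : complex V) N (p : V -> 'rV[R]_N) :
    set 'rV[R]_N :=
  (\bigcup_(s in [set s | s \in faces X]) hull p s)%classic.

Definition homeomorphism (S T : topologicalType) (A : set S) (B : set T)
    (f : S -> T) : Prop :=
  [/\ set_bij A B f, {within A, continuous f}
    & exists g : T -> S,
        {within B, continuous g} /\ forall x, A x -> g (f x) = x].

Definition triangulates (V : choiceType) (X : complex V)
    (T : topologicalType) (M : set T) : Prop :=
  exists N (p : V -> 'rV[R]_N), realization X p /\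
    exists f : 'rV[R]_N -> T, homeomorphism (carrier X p) M f.

Definition linear_on N N' (A : set 'rV[R]_N) (f : 'rV[R]_N -> 'rV[R]_N') :=
  forall x y (t : R), A x -> A y -> 0 <= t <= 1 ->
    f (t *: x + (1 - t) *: y) = t *: f x + (1 - t) *: f y.

(* |X| is the polyhedron of a geometric realization of X in some R^N, and
   facewise linear means linear on each face of X'; the image of a face of X'
   is a simplex in |X|, not required to lie in a single face of X. *)
Definition subdivision (V V' : choiceType) (X' : complex V')
    (X : complex V) : Prop :=
  exists N' (p' : V' -> 'rV[R]_N') N (p : V -> 'rV[R]_N),
    [/\ realization X' p', realization X p
      & exists f : 'rV[R]_N' -> 'rV[R]_N,
          homeomorphism (carrier X' p') (carrier X p) f /\
          forall s, s \in faces X' -> linear_on (hull p' s) f].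

Definition sphere n : set 'rV[R]_n.+1 :=
  [set x : 'rV[R]_n.+1 | \sum_i x 0 i ^+ 2 = 1].

Arguments sphere : clear implicits.

Definition sphere2x1 : set ('rV[R]_3 * 'rV[R]_2) :=
  (sphere 2 `*` sphere 1)%classic.

End Geometry.

Arguments subdivision R {V V'}.
Arguments triangulates R {V} X {T}.
Arguments sphere R n : clear implicits.
Arguments sphere2x1 R : clear implicits.

Inductive vertex := Zv of 'Z_7 | Uv of nat & nat | Vv of nat & nat
  | Wv of nat & nat.

Definition vertex_code (x : vertex) : 'Z_7 + nat * nat * nat :=
  match x with
  | Zv i => inl i
  | Uv j n => inr (0, j, n)%N
  | Vv j n => inr (1, j, n)%N
  | Wv j n => inr (2, j, n)%N
  end.

Definition vertex_decode (c : 'Z_7 + nat * nat * nat) : vertex :=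
  match c with
  | inl i => Zv i
  | inr (0, j, n)%N => Uv j n
  | inr (1, j, n)%N => Vv j n
  | inr (_, j, n) => Wv j n
  end.

Lemma vertex_codeK : cancel vertex_code vertex_decode.
Proof. by case. Qed.

HB.instance Definition _ := Countable.copy vertex (can_type vertex_codeK).

Definition digit (k : nat) : vertex := Zv k%:R.
Local Coercion digit : nat >-> vertex.

Local Notation "[< x ; .. ; y >]" :=
  (@cons vertex x .. (@cons vertex y (@nil vertex)) ..)
  (at level 0, only parsing).

Definition torus_facets : seq (seq vertex) :=
  [:: [< 0; 1; 3 >]; [< 1; 2; 4 >]; [< 2; 3; 5 >]; [< 3; 4; 6 >]; [< 0; 4; 5 >];
      [< 1; 5; 6 >]; [< 0; 2; 6 >]; [< 0; 2; 3 >]; [< 1; 3; 4 >]; [< 2; 4; 5 >];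
      [< 3; 5; 6 >]; [< 0; 4; 6 >]; [< 0; 1; 5 >]; [< 1; 2; 6 >]]%N.

Definition torus : complex vertex := of_facets torus_facets.

Definition solid1 : seq (seq vertex) :=
  [:: [< 0; 1; 2; 3 >]; [< 1; 2; 3; 4 >]; [< 2; 3; 4; 5 >]; [< 3; 4; 5; 6 >];
      [< 0; 4; 5; 6 >]; [< 0; 1; 5; 6 >]; [< 0; 1; 2; 6 >]]%N.

Definition solid2 : seq (seq vertex) :=
  [:: [< 0; 2; 4; 6 >]; [< 1; 2; 4; 6 >]; [< 1; 3; 4; 6 >]; [< 1; 3; 5; 6 >];
      [< 0; 1; 3; 5 >]; [< 0; 2; 3; 5 >]; [< 0; 2; 4; 5 >]]%N.

Definition solid3 : seq (seq vertex) :=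
  [:: [< 0; 1; 4; 5 >]; [< 1; 2; 4; 5 >]; [< 1; 2; 5; 6 >]; [< 2; 3; 5; 6 >];
      [< 0; 2; 3; 6 >]; [< 0; 3; 4; 6 >]; [< 0; 1; 3; 4 >]]%N.

(* Only the indices 1, 2, 3 are meaningful. *)
Definition Tj (j : nat) : complex vertex :=
  of_facets (match j with 1 => solid1 | 2 => solid2 | _ => solid3 end)%N.

Local Notation u := (Uv 1 0).
Local Notation v := (Vv 1 0).
Local Notation w := (Wv 1 0).

Definition solid10 : seq (seq vertex) :=
  [:: [< u; 0; 1; 2 >]; [< u; 0; 1; 3 >]; [< u; 0; 2; 3 >]; [< u; 1; 2; 4 >];
      [< u; 1; 3; 4 >]; [< u; 2; 3; 5 >]; [< u; 2; 4; 5 >];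
      [< v; 3; 4; 6 >]; [< v; 3; 5; 6 >]; [< v; 0; 4; 5 >]; [< v; 0; 4; 6 >];
      [< v; 0; 1; 5 >]; [< v; 1; 5; 6 >]; [< v; 0; 1; 2 >]; [< v; 0; 2; 6 >];
      [< v; 1; 2; 6 >];
      [< u; v; 3; 4 >]; [< u; v; 3; 5 >]; [< u; v; 4; 5 >]]%N.

Definition solid10' : seq (seq vertex) :=
  [seq f <- solid10 | f \notin [:: [< u; 0; 1; 2 >]; [< v; 0; 1; 2 >]]%N] ++
  [:: [< u; w; 0; 1 >]; [< u; w; 0; 2 >]; [< u; w; 1; 2 >];
      [< v; w; 0; 1 >]; [< v; w; 0; 2 >]; [< v; w; 1; 2 >]]%N.

Definition relabel (j n : nat) (x : vertex) : vertex :=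
  match x with
  | Zv i => Zv (2 ^+ j.-1 * i + n%:R)
  | Uv _ _ => Uv j n
  | Vv _ _ => Vv j n
  | Wv _ _ => Wv j n
  end.

Definition Tjn (j n : nat) : complex vertex :=
  of_facets [seq map (relabel j n) f
    | f <- if (n <= 6)%N then solid10 else solid10'].

(* Main.v *)
Require Import Defs.
From mathcomp Require Import all_boot all_order all_algebra finmap.
From mathcomp Require Import all_classical all_reals all_analysis.
From mathcomp Require Import lra ring zify.
Import Order.TTheory GRing.Theory Num.Theory.
Import numFieldNormedType.Exports.

(** A point of a polyhedron |X| is taken to be its family of barycentric
coordinates, so that [points X] is a compact set of functions on the vertices
and involves no realization.  A placement of the vertices that is injective on
[points X] realizes X ([embeds_realization]), and a continuous injection of
[points X] with image M shows that X triangulates M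
([parametrizes_triangulates]).  All maps below are defined on coordinates.

The complex T_1 |+| T_3 is the boundary of a cyclic 4-polytope, given here by
seven integer vertices and one supporting functional for each of its fourteen
facets.  Radial projection therefore parametrizes S^3
([polytope_parametrizes_sphere]).  The facets of T_1 are the lower ones, so
that forgetting the last coordinate realizes T_1 in R^3 ([lower_embeds]).

In that realization T_{1,0} arises from T_1 by eight bistellar moves, and
T'_{1,0} from T_{1,0} by a ninth one.  A bistellar move takes place inside a
fixed polyhedron as soon as the points involved satisfy an affine relation with
the right signs ([flip]), and each of the nine relations is given with
integer coefficients.  Hence T_1, T_{1,0} and T'_{1,0} fill the same subset of R^3:
this is the subdivision of (i), whose homeomorphism is the identity.  It also
yields homeomorphisms of |T_j| onto |T_{j,n}| that fix the common boundary
torus, and since the solid tori in (iv) and (v) meet in that torus only,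
(vi) and (vii) are reduced to unrefined solid tori: to T_i |+| T_j for i <> j,
and to two copies of T_j glued along their boundary ([glue_flat]).  Doubling
modulo 7 permutes T_1, T_2, T_3 cyclically, so that each T_i |+| T_j is an image
of T_1 |+| T_3, which settles (vi).

For (vii), the facets of T_1 are the windows {k, k+1, k+2, k+3} modulo 7.  They
unroll to the tetrahedra on four consecutive integers, and these tile the prism
over a triangle when the integer m is put at height m above the corner m mod 3
([unroll_inj], [unroll_surj]).  Passing from m to m + 7 is a screw motion that
turns the triangle by a third.  Two copies of the triangle glued along their
boundary form a bipyramid, that is, a 2-sphere; turning it back in proportion
to the height makes the picture invariant under the screw motion, and the two
solid tori become the two halves of S^2 x S^1 over the closed hemispheres
([chart], [solid_parametrizes]).

The claims (ii), (iii), (iv) and (v) are combinatorial.  Every complex of the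
theorem is the image of one of a few lists of numerical labels under an
injective relabelling ([TjnE], [label_inj]), and n matters only through
n mod 7 and through the names of the three new vertices.  Since different pairs
(j, n) have different new vertices, a common face of T_{i,m} and T_{j,n} has
vertices in Z_7 only; such a face of T_{j,n} lies in the torus or, when n <= 6,
in the image of the triangle 012 ([old_Tjn]). *)

Set Implicit Arguments.
Unset Strict Implicit.
Unset Printing Implicit Defensive.

Local Open Scope classical_set_scope.
Local Open Scope ring_scope.

(** * Polyhedra as sets of barycentric coordinates *)

Section Points.
Variables (R : realType) (V : choiceType).
Implicit Types (X Y : complex V) (a b : V -> R).

Definition supported (T : predType V) (t : T) (a : V -> R) : Prop :=
  forall v, v \notin t -> a v = 0.

(** The sum is finitely supported, so that one expression covers every complex
    on V, whatever its set of vertices. *)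
Definition place (M : lmodType R) (p : V -> M) (a : V -> R) : M :=
  \sum_(v \in [set: V]) a v *: p v.

Definition mass (a : V -> R) : R := place (fun=> 1 : R^o) a.

(** This is |X| without a realization.  The pointwise topology makes it compact,
    also when V is infinite. *)
Definition points X : set {ptws V -> R} :=
  [set a | [/\ forall v, 0 <= a v, mass a = 1 &
               exists2 f : {fset V}, f \in faces X & supported f a] ].

Lemma placeE (M : lmodType R) (p : V -> M) (t : seq V) a : uniq t ->
  supported t a -> place p a = \sum_(v <- t) a v *: p v.
Proof.
move=> ut sa; rewrite fsbig_seq//; apply/esym/fsbig_widen => // v /= [_].
by move=> /negP/sa ->; rewrite scale0r.
Qed.

Lemma massE (t : seq V) a : uniq t -> supported t a ->
  mass a = \sum_(v <- t) a v.
Proof.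
move=> ut sa; rewrite /mass (placeE _ ut sa).
by apply: eq_bigr => v _; rewrite /GRing.scale/= mulr1.
Qed.

Lemma place_eq (M : lmodType R) (p q : V -> M) (t : seq V) a :
  uniq t -> supported t a -> {in t, p =1 q} -> place p a = place q a.
Proof.
move=> ul sa pq; rewrite !(placeE _ ul sa).
by apply: eq_big_seq => v /pq ->.
Qed.

Lemma supportedS (S T : predType V) (s : S) (t : T) a : {subset s <= t} ->
  supported s a -> supported t a.
Proof. by move=> st sa v vt; apply: sa; apply: contra vt => /st. Qed.

Lemma place_comb (M : lmodType R) (p : V -> M) (t : seq V) a b (x y : R) :
  supported t a -> supported t b ->
  place p (fun v => x * a v + y * b v) = x *: place p a + y *: place p b.
Proof.
move=> sa sb.
have u := undup_uniq t.
have sub c : supported t c -> supported (mem (undup t)) c.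
  by apply: supportedS => v; rewrite mem_undup.
rewrite !(@placeE _ _ (undup t))//; [|exact: sub..|]; last first.
  by apply: sub => v vt; rewrite sa// sb// !mulr0 addr0.
rewrite !scaler_sumr -big_split/=; apply: eq_bigr => v _.
by rewrite scalerDl !scalerA.
Qed.

Lemma mass_comb (t : seq V) a b (x y : R) :
  supported t a -> supported t b ->
  mass (fun v => x * a v + y * b v) = x * mass a + y * mass b.
Proof. exact: place_comb. Qed.

Definition embeds X N (p : V -> 'rV[R]_N) := set_inj (points X) (place p).

Lemma hullE X N (p : V -> 'rV[R]_N) f : f \in faces X ->
  hull p f = place p @` (points X `&` [set a | supported f a]).
Proof.
move=> fX; apply/seteqP; split=> [x [a [a0 a1 ->]]|_ [a [[a0 a1 _] fa] <-]].
  pose b v := if v \in f then a v else 0.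
  have sb : supported f b by move=> v vf; rewrite /b ifN.
  have bE (M : lmodType R) (q : V -> M) :
      \sum_(v <- f) b v *: q v = \sum_(v <- f) a v *: q v.
    by apply: eq_big_seq => v vf; rewrite /b vf.
  exists b; last by rewrite (placeE _ (fset_uniq f) sb) bE.
  split=> //; split; last by exists f.
    by move=> v; rewrite /b; case: ifPn => // /a0.
  rewrite (massE (fset_uniq f) sb) -a1.
  by apply: eq_big_seq => v vf; rewrite /b vf.
exists a; split=> //; first by rewrite -(massE (fset_uniq f) fa).
by rewrite (placeE _ (fset_uniq f) fa).
Qed.

Lemma carrierE X N (p : V -> 'rV[R]_N) : carrier X p = place p @` points X.
Proof.
apply/seteqP; split=> [x [f /= fX]|_ [a aX <-]].
  by rewrite (hullE p fX) => -[a [aX _] <-]; exists a.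
have [_ _ [f fX fa]] := aX; exists f => //.
by rewrite (hullE p fX); exists a.
Qed.

(** Injectivity on whole polyhedra contains both requirements on a geometric
    complex: a point of two simplices has one family of coordinates, hence lies
    in the simplex on the common vertices, and an affine dependency would allow
    the barycentre of a simplex to be written in two ways. *)
Lemma embeds_realization X N (p : V -> 'rV[R]_N) :
  embeds X p -> realization X p.
Proof.
move=> inj; split=> [f fX c c0 cp v vf|f g fX gX].
  (* perturb the barycentre of f along the dependency c *)
  pose n : R := #|` f|%:R.
  have n0 : 0 < n by rewrite ltr0n cardfs_gt0; apply/fset0Pn; exists v.
  pose m := \sum_(w <- f) `|c w|.
  have cm w : w \in f -> `|c w| <= m.
    by move=> wf; rewrite /m (big_fsetD1 w)//= lerDl sumr_ge0.
  have m0 : 0 <= m by rewrite /m sumr_ge0.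
  pose e := n^-1 / (1 + m).
  have e0 : 0 < e by rewrite divr_gt0 ?invr_gt0 // ltr_wpDr.
  have me : m * e <= n^-1.
    rewrite /e mulrCA ger_pMr ?invr_gt0// ler_pdivrMr ?mul1r ?lerDr//.
    by rewrite ltr_wpDr.
  pose b (x : R) w := if w \in f then n^-1 + x * c w else 0.
  have sb x : supported f (b x).
    by move=> w wf; rewrite /b ifN.
  have nn : \sum_(w <- f) (n^-1 : R) = 1.
    rewrite big_const_seq count_predT iter_addr_0 -mulr_natl.
    by rewrite mulfV// gt_eqF.
  have pb x : 0 <= x <= e -> points X (b x : {ptws V -> R}).
    move=> /andP[x0 xe]; split; last by exists f.
      move=> w; rewrite /b; case: ifPn => // wf.
      have : `|x * c w| <= n^-1.
        rewrite normrM ger0_norm// mulrC; apply: le_trans me.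
        by apply: ler_pM => //; exact: cm.
      by rewrite ler_norml => /andP[+ _]; lra.
    rewrite (massE (fset_uniq f) (sb x)).
    under eq_big_seq => w wf do rewrite /b wf.
    by rewrite big_split/= -mulr_sumr c0 mulr0 addr0.
  have pl x : place p (b x) = \sum_(w <- f) n^-1 *: p w.
    rewrite (placeE _ (fset_uniq f) (sb x)).
    under eq_big_seq => w wf do rewrite /b wf scalerDl -scalerA.
    by rewrite big_split/= -[X in _ + X]scaler_sumr cp scaler0 addr0.
  have /(congr1 (fun h : V -> R => h v)) : b 0 = b e.
    apply: inj; rewrite ?inE; try apply: pb; rewrite ?lexx ?(ltW e0)//.
    by rewrite !pl.
  rewrite /b vf mul0r addr0 => /eqP; rewrite -subr_eq0 opprD addrA subrr add0r.
  by rewrite oppr_eq0 mulf_eq0 gt_eqF//= => /eqP.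
have fgX : (f `&` g)%fset \in faces X := complexP fX (fsubsetIl _ _).
rewrite (hullE p fX) (hullE p gX) (hullE p fgX); apply/seteqP; split=> x.
  move=> [[a [aX fa] ax] [b [bX gb] bx]].
  have ab : a = b by apply: inj; rewrite ?inE// ax.
  exists a => //; split=> // v.
  by rewrite !inE negb_and => /orP[/fa//|/gb]; rewrite ab.
move=> [a [aX fga] ax]; split; exists a => //; split=> //;
  by apply: supportedS fga => v; rewrite !inE => /andP[].
Qed.

End Points.

(** * Homeomorphisms on compact sets *)

Section Homeomorphisms.
Implicit Types S T U : topologicalType.

Lemma within_comp S T U (A : set S) (B : set T) (f : S -> T) (g : T -> U) :
  set_fun A B f -> {within A, continuous f} -> {within B, continuous g} ->
  {within A, continuous (g \o f)}.
Proof.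
move=> fAB /subspace_continuousP cf /subspace_continuousP cg.
apply/subspace_continuousP => x Ax W Wgfx.
have /(cf _ Ax) h := cg _ (fAB _ Ax) _ Wgfx.
change (nbhs x [set y | A y -> W (g (f y))]).
change (nbhs x [set y | A y -> B (f y) -> W (g (f y))]) in h.
by apply: filterS h => y h Ay; exact: h Ay (fAB _ Ay).
Qed.

Lemma homeomorphism_comp S T U (A : set S) (B : set T) (C : set U) f g :
  homeomorphism A B f -> homeomorphism B C g -> homeomorphism A C (g \o f).
Proof.
move=> [bf cf [f' [cf' ff']]] [bg cg [g' [cg' gg']]]; split.
- exact: set_bij_comp bf bg.
- exact: within_comp (set_bij_homo bf) cf cg.
- exists (f' \o g'); split=> [|x Ax /=].
  + apply: within_comp cg' cf' => z Cz.
    have [y By <-] := set_bij_surj bg Cz; by rewrite gg'.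
  + by rewrite gg' ?ff'//; exact: (set_bij_homo bf).
Qed.

Lemma homeomorphism_inv S T (A : set S) (B : set T) f :
  homeomorphism A B f ->
  exists2 g, homeomorphism B A g & forall x, A x -> g (f x) = x.
Proof.
move=> [bf cf [g [cg gf]]]; exists g => //; split=> //.
- split.
  + by move=> y /(set_bij_surj bf)[x Ax <-]; rewrite gf.
  + move=> y z; rewrite !inE => /(set_bij_surj bf)[x Ax <-].
    by move=> /(set_bij_surj bf)[t At <-]; rewrite !gf// => ->.
  + by move=> x Ax; exists (f x); [exact: (set_bij_homo bf)|exact: gf].
- by exists f; split=> // y /(set_bij_surj bf)[x Ax <-]; rewrite gf.
Qed.

Lemma compact_homeomorphism S T (s0 : S) (A : set S) (f : S -> T) :
  hausdorff_space T -> compact A -> {within A, continuous f} -> set_inj A f ->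
  homeomorphism A (f @` A) f.
Proof.
move=> hT cA cf inj.
pose g y := xget s0 [set x | A x /\ f x = y].
have gf x : A x -> g (f x) = x.
  move=> Ax; rewrite /g; case: xgetP => [z _ [Az zx]|/(_ x)[]//].
  by apply: inj; rewrite ?inE.
split=> //; first by split=> //; exact: imageP.
exists g; split=> //; apply/continuous_closedP => W cW.
apply/closed_subspaceP; exists (f @` (A `&` W)).
  apply: compact_closed => //; apply: continuous_compact.
    exact: continuous_subspaceW cf.
  exact: compact_closedI.
apply/seteqP; split=> y [].
  move=> [x [Ax Wx] <-] _; split; last by exists x.
  by change (W (g (f x))); rewrite gf.
move=> Wy [x Ax fxy]. change (W (g y)) in Wy.
by split; exists x => //; split=> //; rewrite -fxy gf// in Wy.
Qed.

End Homeomorphisms.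

(** * The topology of a polyhedron *)

Section PointTopology.
Variables (R : realType) (V : choiceType).
Implicit Types (X Y : complex V).

Definition vertices X : {fset V} := (\bigcup_(f <- faces X) f)%fset.

Lemma face_vertices X f : f \in faces X -> (f `<=` vertices X)%fset.
Proof. by move=> fX; exact: bigfcup_sup. Qed.

Lemma point_vertices X (a : V -> R) : points X a -> supported (vertices X) a.
Proof.
by case=> _ _ [f /face_vertices/fsubsetP fX]; apply: supportedS.
Qed.

Lemma continuous_coef (v : V) : continuous (fun a : {ptws V -> R} => a v).
Proof. exact: (@proj_continuous V (fun=> R) v). Qed.

Lemma closed_supported (T : predType V) (t : T) :
  closed [set a : {ptws V -> R} | supported t a].
Proof.
rewrite [X in closed X](_ : _ = \bigcap_(v in [set v | v \notin t])
    (fun a : {ptws V -> R} => a v) @^-1` [set 0]).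
  apply: closed_bigI => v _; apply: closed_comp => [a _|].
    exact: continuous_coef.
  exact: closed_eq.
by apply/seteqP; split=> a sa v; exact: sa.
Qed.

Lemma continuous_place X N (p : V -> 'rV[R]_N) :
  {within points X, continuous (place p : {ptws V -> R} -> 'rV[R]_N)}.
Proof.
pose h (a : {ptws V -> R}) := \sum_(v <- vertices X) a v *: p v.
apply: (@subspace_eq_continuous _ _ _ h).
  move=> a; rewrite inE => /point_vertices sa.
  by rewrite /from_subspace (placeE _ (fset_uniq _) sa).
apply: continuous_subspaceT; apply: continuous_big => [|v _].
  exact: add_continuous.
move=> a; apply: (@continuous_comp _ _ _ (fun a : {ptws V -> R} => a v)
  (fun r : R => r *: p v)); first exact: continuous_coef.
exact: scalel_continuous.
Qed.

(** The coordinates live in a product of intervals, by Tychonoff compact; the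
    two remaining conditions are closed because X has finitely many faces. *)
Lemma compact_points X : compact (points X : set {ptws V -> R}).
Proof.
pose box := [set a : {ptws V -> R} | forall v,
  (if v \in vertices X then `[0, 1]%classic else [set 0]) (a v)].
pose total :=
  (fun a : {ptws V -> R} => \sum_(v <- vertices X) a v) @^-1` [set 1].
pose supp := \bigcup_(f in [set f | f \in faces X])
  [set a : {ptws V -> R} | supported f a].
have -> : (points X : set {ptws V -> R}) = box `&` (total `&` supp).
  apply/seteqP; split=> [a pa|a [ba [ta [f fX fa]]]].
    have sa := point_vertices pa; case: pa => a0 a1 [f fX fa].
    have a1' := massE (fset_uniq _) sa.
    split; last by split; [rewrite /total/= -a1'|exists f].
    move=> v; case: ifPn => vX /=; last exact: sa.
    rewrite in_itv/= a0/= -a1 a1' (big_fsetD1 v)//= lerDl.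
    by apply: sumr_ge0.
  split; last by exists f.
    move=> v; have := ba v; case: ifP => /= _; last by move=> ->.
    by rewrite in_itv/= => /andP[].
  rewrite (@massE _ _ (vertices X))//.
  by apply: supportedS fa; apply/fsubsetP; exact: face_vertices.
apply: compact_closedI.
  apply: (@tychonoff _ (fun=> R)
    (fun v => if v \in vertices X then `[0, 1]%classic else [set 0])) => v.
  by case: ifP => _; [exact: segment_compact|exact: compact_set1].
apply: closedI.
  apply: closed_comp => [a _|]; last exact: closed_eq.
  apply: continuous_big => [|v _]; first exact: add_continuous.
  exact: continuous_coef.
apply: closed_bigcup => [|f _]; last exact: closed_supported.
exact: finite_fset.
Qed.

Lemma closed_points X : closed (points X : set {ptws V -> R}).
Proof.
apply: compact_closed; last exact: compact_points.
by apply: hausdorff_product => v; exact: norm_hausdorff.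
Qed.

End PointTopology.

Lemma continuous_ptws (T : topologicalType) (R : realType) (V : choiceType)
  (f : T -> {ptws V -> R}) : (forall v, continuous (fun x => f x v)) ->
  continuous f.
Proof.
move=> cf x; apply/cvg_sup => v; move: x.
apply/(@continuousP _ (initial_topology (@^~ v))) => A [B oB <-].
rewrite (_ : f @^-1` _ = (fun x => f x v) @^-1` B)//.
by apply: open_comp => // x _; exact: cf.
Qed.

(** * Parametrized polyhedra *)

Section Parametrizations.
Variable R : realType.
Implicit Types (V : choiceType) (T : topologicalType).

Lemma embeds_homeomorphism V (X : complex V) N (p : V -> 'rV[R]_N) :
  embeds X p ->
  homeomorphism (points X : set {ptws V -> R}) (carrier X p) (place p).
Proof.
move=> inj; rewrite carrierE.
apply: (@compact_homeomorphism {ptws V -> R} _ (fun=> 0)).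
- exact: (@norm_hausdorff R 'rV[R]_N).
- exact: compact_points.
- exact: continuous_place.
- exact: inj.
Qed.

Definition parametrizes V (X : complex V) T (g : {ptws V -> R} -> T)
    (M : set T) :=
  [/\ {within points X, continuous g}, set_inj (points X) g & g @` points X = M].

(** The standard realization: vertices go to independent unit vectors. *)
Lemma embeds_exists V (X : complex V) :
  exists N (p : V -> 'rV[R]_N), embeds X p.
Proof.
pose N := #|` vertices X|.
exists N, (fun v => \row_(i < N) (v == nth v (vertices X) i)%:R).
move=> a b; rewrite !inE => /point_vertices sa /point_vertices sb eab.
apply/funext => v; have [vX|vX] := boolP (v \in vertices X); last first.
  by rewrite sa ?sb.
have iN : (index v (vertices X) < N)%N by rewrite index_mem.
have coef c : supported (vertices X) c ->
    place (fun v => \row_(i < N) (v == nth v (vertices X) i)%:R) c 0 (Ordinal iN)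
      = c v :> R.
  move=> sc; rewrite (placeE _ (fset_uniq _) sc) summxE (big_fsetD1 v)//=.
  rewrite !mxE nth_index// eqxx mulr1 big_seq big1 ?addr0// => w.
  rewrite in_fsetD1 => /andP[wv wX]; rewrite !mxE (set_nth_default v)//.
  by rewrite nth_index// (negbTE wv) mulr0.
by rewrite -coef// eab coef.
Qed.

Lemma parametrizes_triangulates V (X : complex V) T (g : {ptws V -> R} -> T) M :
  hausdorff_space T -> parametrizes X g M -> triangulates R X M.
Proof.
move=> hT [cg ig <-]; have [N [p ip]] := embeds_exists X.
exists N, p; split; first exact: embeds_realization.
have [q hq _] := homeomorphism_inv (embeds_homeomorphism ip).
exists (g \o q); apply: homeomorphism_comp hq _.
apply: (@compact_homeomorphism {ptws V -> R} _ (fun=> 0)) => //.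
exact: compact_points.
Qed.

(** X and X' are two triangulations of one polyhedron in R^N. *)
Definition flat_equiv V (X X' : complex V) := exists N (p : V -> 'rV[R]_N),
  [/\ embeds X p, embeds X' p & carrier X p = carrier X' p].

(** The homeomorphism between the two sets of coordinates goes through the
    common polyhedron, hence it is the identity on points of both complexes;
    this is what allows to glue refined complexes. *)
Lemma parametrizes_flat V (X X' : complex V) T (g : {ptws V -> R} -> T) M :
  flat_equiv X X' -> parametrizes X g M ->
  exists2 g', parametrizes X' g' M &
    forall a, points X a -> points X' a -> g' a = g a.
Proof.
move=> [N [p [ip ip' pE]]] [cg ig gM].
have [q hq qp] := homeomorphism_inv (embeds_homeomorphism ip).
have hqp : homeomorphism (points X' : set {ptws V -> R})
    (points X : set {ptws V -> R}) (q \o place p).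
  by apply: homeomorphism_comp hq; rewrite pE; exact: embeds_homeomorphism.
exists (g \o (q \o place p)); last by move=> a aX aX' /=; rewrite qp.
have [[hf hi hs] ch _] := hqp; split.
- exact: within_comp cg.
- move=> a b aX bX /= e; apply: hi => //; apply: ig => //.
  + by rewrite inE; apply: hf; rewrite inE in aX.
  + by rewrite inE; apply: hf; rewrite inE in bX.
- rewrite -gM -image_comp; congr (_ @` _); apply/seteqP; split=> //.
  by move=> _ [a aX <-]; exact: hf.
Qed.

Lemma parametrizes_sub V (X Y : complex V) T (g : {ptws V -> R} -> T) M :
  (points X : set {ptws V -> R}) `<=` points Y -> parametrizes Y g M ->
  parametrizes X g (g @` points X).
Proof.
move=> XY [cg ig _]; split=> //; first exact: continuous_subspaceW cg.
by move=> a b; rewrite !inE => /XY aY /XY bY; apply: ig; rewrite inE.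
Qed.

Lemma pointsS V (X Y : complex V) : {subset faces X <= faces Y} ->
  (points X : set {ptws V -> R}) `<=` points Y.
Proof. by move=> XY a [a0 a1 [f /XY fY fa]]; split=> //; exists f. Qed.

Lemma pointsU V (X Y : complex V) :
  points (X |+| Y) = points X `|` points Y :> set {ptws V -> R}.
Proof.
apply/seteqP; split=> [a [a0 a1 [f]]|a].
  by rewrite in_fsetU => /orP[] fX fa; [left|right]; split=> //; exists f.
by case; apply: pointsS => f fX; rewrite in_fsetU fX ?orbT.
Qed.

Lemma pointsI V (X Y : complex V) :
  points (X |*| Y) = points X `&` points Y :> set {ptws V -> R}.
Proof.
apply/seteqP; split=> [a aXY|a [[a0 a1 [f fX fa]] [_ _ [g gY ga]]]].
  by split; apply: pointsS aXY => f; rewrite in_fsetI => /andP[].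
split=> //; exists (f `&` g)%fset.
  rewrite in_fsetI (complexP fX (fsubsetIl _ _)).
  by rewrite (complexP gY (fsubsetIr _ _)).
by move=> v; rewrite in_fsetI negb_and => /orP[/fa|/ga].
Qed.

(** The last hypothesis says that the images meet no more than X and Y do; it
    makes the union of the two injections injective. *)
Lemma parametrizes_glue V (X Y : complex V) T (g h : {ptws V -> R} -> T) M N :
  parametrizes X g M -> parametrizes Y h N ->
  (forall a, points X a -> points Y a -> g a = h a) ->
  M `&` N `<=` g @` (points X `&` points Y) ->
  exists k, parametrizes (X |+| Y) k (M `|` N).
Proof.
move=> [cg ig gM] [ch ih hN] gh MN.
pose k a := if `[< points X a >] then g a else h a.
have kX a : points X a -> k a = g a by move=> aX; rewrite /k asboolT.
have kY a : points Y a -> k a = h a.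
  by move=> aY; rewrite /k; case: asboolP => // aX; exact: gh.
have across a b : points X a -> points Y b -> g a = h b -> a = b.
  move=> aX bY e.
  have [c [cX cY] gc] : (g @` (points X `&` points Y)) (g a).
    apply: MN; split; first by rewrite -gM; exists a.
    by rewrite e -hN; exists b.
  transitivity c; first by apply: ig; rewrite ?inE.
  by apply: ih; rewrite ?inE// -gh// gc.
exists k; split; rewrite pointsU.
- apply: withinU_continuous; [exact: closed_points..| |].
  + by apply: subspace_eq_continuous cg => a; rewrite inE => /kX.
  + by apply: subspace_eq_continuous ch => a; rewrite inE => /kY.
- move=> a b; rewrite !inE => -[aX|aY] [bX|bY].
  + by rewrite !kX// => e; apply: ig; rewrite ?inE.
  + by rewrite (kX a)// (kY b)//; exact: across.
  + by rewrite (kY a)// (kX b)// => e; apply/esym/across.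
  + by rewrite !kY// => e; apply: ih; rewrite ?inE.
- rewrite image_setU -gM -hN; congr (_ `|` _); apply: eq_imagel => a.
  + exact: kX.
  + exact: kY.
Qed.

End Parametrizations.

Section FlatEquivalence.
Variable R : realType.

Lemma flat_equiv_refl (V : choiceType) (X : complex V) : flat_equiv R X X.
Proof. by have [N [p ip]] := embeds_exists R X; exists N, p. Qed.

Lemma flat_equiv_subdivision (V : choiceType) (X Y : complex V) :
  flat_equiv R X Y -> subdivision R Y X.
Proof.
move=> [N [p [iX iY XY]]]; exists N, p, N, p; split; try exact: embeds_realization.
exists idfun; split; last by move=> s _ x y t.
rewrite XY; split.
- by split=> // x y.
- by apply: continuous_subspaceT => x; exact: cvg_id.
- by exists idfun; split=> //; apply: continuous_subspaceT => x; exact: cvg_id.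
Qed.

(** X0 and Y0 may meet outside C, and may even be equal: only the refined
    complexes X and Y are required to meet exactly in C. *)
Lemma glue_flat (V : choiceType) (T : topologicalType) (X0 Y0 X Y C : complex V)
  (g h : {ptws V -> R} -> T) (M N : set T) :
  hausdorff_space T ->
  parametrizes X0 g M -> parametrizes Y0 h N ->
  {subset faces C <= faces X0} -> {subset faces C <= faces Y0} ->
  (forall a, points C a -> g a = h a) -> M `&` N `<=` g @` points C ->
  flat_equiv R X0 X -> flat_equiv R Y0 Y -> X |*| Y = C ->
  triangulates R (X |+| Y) (M `|` N).
Proof.
move=> hT pg ph CX0 CY0 gh MN fX fY XY.
have [g' pg' gg'] := parametrizes_flat fX pg.
have [h' ph' hh'] := parametrizes_flat fY ph.
have CX : {subset faces C <= faces X}.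
  by move=> s; rewrite -XY in_fsetI => /andP[].
have CY : {subset faces C <= faces Y}.
  by move=> s; rewrite -XY in_fsetI => /andP[].
have XYC : points X `&` points Y = points C :> set {ptws V -> R}.
  by rewrite -pointsI XY.
have g'C a : points C a -> g' a = g a.
  by move=> aC; apply: gg'; [exact: pointsS CX0 _ aC|exact: pointsS CX _ aC].
have h'C a : points C a -> h' a = h a.
  by move=> aC; apply: hh'; [exact: pointsS CY0 _ aC|exact: pointsS CY _ aC].
have [|y|k pk] := parametrizes_glue pg' ph'.
- move=> a aX aY; have aC : points C a by rewrite -XYC.
  by rewrite g'C// gh// h'C.
- by move=> /MN[a aC <-]; rewrite XYC; exists a => //; exact: g'C.
exact: parametrizes_triangulates pk.
Qed.

End FlatEquivalence.

(** * Complexes given by lists of facets *)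

Definition sub_seq (T : eqType) (s t : seq T) := all (mem t) s.

Lemma sub_seqP (T : eqType) (s t : seq T) :
  reflect {subset s <= t} (sub_seq s t).
Proof. exact: allP. Qed.

Section OfFacets.
Variable V : choiceType.
Implicit Types (F G : seq (seq V)) (s : {fset V}).

Lemma mem_of_facets F s :
  (s \in faces (of_facets F)) = has (fun f => s `<=` [fset v in f])%fset F.
Proof.
apply/bigfcupP/hasP => [[_ /andP[/mapP[f fF ->] _]]|[f fF sf]].
  by rewrite fpowersetE; exists f.
by exists [fset v in f]%fset; rewrite ?fpowersetE// map_f.
Qed.

Lemma of_facetsP F s :
  s \in faces (of_facets F) <-> exists2 f, f \in F & {subset s <= f}.
Proof.
rewrite mem_of_facets; split=> [/hasP[f fF /fsubsetP sf]|[f fF sf]].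
  by exists f => // v /sf; rewrite inE.
by apply/hasP; exists f => //; apply/fsubsetP => v /sf; rewrite inE.
Qed.

Lemma complex_eq (X Y : complex V) : faces X =i faces Y -> X = Y.
Proof. by move=> XY; apply: val_inj; apply/fsetP. Qed.

Lemma of_facetsS F G : all (fun f => has (sub_seq f) G) F ->
  {subset faces (of_facets F) <= faces (of_facets G)}.
Proof.
move=> /allP FG s /of_facetsP[f /FG/hasP[g gG /sub_seqP fg] sf].
by apply/of_facetsP; exists g => // v /sf/fg.
Qed.

Lemma points_of_facetsP (R : realType) F (a : V -> R) :
  points (of_facets F) a <->
  [/\ forall v, 0 <= a v, mass a = 1 & exists2 f, f \in F & supported f a].
Proof.
split=> [[a0 a1 [s /of_facetsP[f fF sf] sa]]|[a0 a1 [f fF fa]]]; split=> //.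
  by exists f => //; apply: supportedS sa.
exists [fset v in f]%fset.
  by apply/of_facetsP; exists f => // v; rewrite inE.
by apply: supportedS fa => v; rewrite inE.
Qed.

Lemma of_facets_cat F G :
  of_facets (F ++ G) = of_facets F |+| of_facets G.
Proof.
apply: complex_eq => s; rewrite in_fsetU.
by rewrite !mem_of_facets has_cat.
Qed.

End OfFacets.

Definition same_facets (T : eqType) (F G : seq (seq T)) :=
  all (fun f => has (sub_seq f) G) F && all (fun g => has (sub_seq g) F) G.

Lemma same_facets_eq (V : choiceType) (F G : seq (seq V)) :
  same_facets F G -> of_facets F = of_facets G.
Proof.
move=> /andP[/of_facetsS FG /of_facetsS GF]; apply: complex_eq => s.
by apply/idP/idP; [exact: FG|exact: GF].
Qed.

(** * Relabelling the vertices *)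

Definition relabelled (U V : Type) (rho : U -> V) (F : seq (seq U)) :
  seq (seq V) := [seq map rho f | f <- F].

Lemma relabelled_sub (U V : choiceType) (rho : U -> V) (F G : seq (seq U)) :
  all (fun f => has (sub_seq f) G) F ->
  {subset faces (of_facets (relabelled rho F)) <=
          faces (of_facets (relabelled rho G))}.
Proof.
move=> /allP FG; apply: of_facetsS; apply/allP => _ /mapP[f /FG/hasP[g gG fg] ->].
apply/hasP; exists (map rho g); first exact: map_f.
apply/sub_seqP => v /mapP[k kf ->]; apply: map_f; exact: (sub_seqP _ _ fg).
Qed.

Lemma same_facets_relabelled (U V : choiceType) (rho : U -> V)
  (F G : seq (seq U)) : same_facets F G ->
  of_facets (relabelled rho F) = of_facets (relabelled rho G).
Proof.
move=> /andP[FG GF]; apply: complex_eq => s.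
by apply/idP/idP; exact: relabelled_sub.
Qed.

Section Relabelling.
Variables (U V : choiceType) (rho : U -> V) (L : seq U).
Hypotheses (Luniq : uniq L) (rho_inj : {in L &, injective rho}).
Implicit Types (F : seq (seq U)).

Let within F := all (fun f => sub_seq f L) F.

Section Points.
Variable R : realType.
Implicit Types (a : {ptws V -> R}) (b : {ptws U -> R}).

(** The relabelling is injective on the labels of L only, so pull and push
    ignore all other labels. *)
Definition pull (a : {ptws V -> R}) : {ptws U -> R} :=
  fun k => if k \in L then a (rho k) else 0.

Definition push (b : {ptws U -> R}) : {ptws V -> R} :=
  fun v => \sum_(k <- L) b k * (rho k == v)%:R.

Lemma pull_supported a : supported L (pull a).
Proof. by move=> k kL; rewrite /pull ifN. Qed.

Lemma push_supported b : supported (map rho L) (push b).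
Proof.
move=> v vL; rewrite /push big_seq big1// => k kL; case: eqP => [kv|_].
  by rewrite -kv map_f in vL.
by rewrite mulr0.
Qed.

Lemma pushE b k : k \in L -> push b (rho k) = b k.
Proof.
move=> kL; rewrite /push (bigD1_seq k)//= eqxx mulr1 big_seq_cond big1 ?addr0//.
move=> l /andP[lL lk]; case: eqP => [/rho_inj e|]; last by rewrite mulr0.
by rewrite e// eqxx in lk.
Qed.

Lemma pushK b : supported L b -> pull (push b) = b.
Proof.
move=> sb; apply/funext => k; rewrite /pull.
by case: ifPn => [kL|/sb//]; rewrite pushE.
Qed.

Lemma pullK a : supported (map rho L) a -> push (pull a) = a.
Proof.
move=> sa; apply/funext => v.
have [/mapP[k kL ->]|vL] := boolP (v \in map rho L).
  by rewrite pushE// /pull kL.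
by rewrite sa// push_supported.
Qed.

Lemma place_pull (M : lmodType R) (p : V -> M) a :
  supported (map rho L) a -> place p a = place (p \o rho) (pull a).
Proof.
move=> sa; rewrite (placeE _ Luniq (@pull_supported a)).
rewrite (placeE _ _ sa) ?map_inj_in_uniq// big_map.
by apply: eq_big_seq => k kL; rewrite /pull kL.
Qed.

Lemma pull_continuous : continuous pull.
Proof.
apply: continuous_ptws => k; rewrite /pull; case: (k \in L).
  exact: continuous_coef.
exact: (@cst_continuous {ptws V -> R} R 0).
Qed.

Lemma relabelled_supported F a : within F ->
  points (of_facets (relabelled rho F)) a -> supported (map rho L) a.
Proof.
move=> /allP FL /points_of_facetsP[_ _ [_ /mapP[f /FL/sub_seqP fL ->]]].
by apply: supportedS => _ /mapP[k /fL kL ->]; rewrite map_f.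
Qed.

Lemma within_supported F (b : U -> R) : within F ->
  points (of_facets F) b -> supported L b.
Proof.
move=> /allP FL /points_of_facetsP[_ _ [f /FL/sub_seqP fL]].
exact: supportedS.
Qed.

Lemma pull_points F : within F ->
  pull @` points (of_facets (relabelled rho F)) = points (of_facets F).
Proof.
move=> FL; apply/seteqP; split=> [_ [a aF <-]|b bF].
  have sa := relabelled_supported FL aF.
  case/points_of_facetsP: aF => a0 a1 [_ /mapP[f fF ->] fa].
  apply/points_of_facetsP; split.
  - by move=> k; rewrite /pull; case: ifP.
  - by rewrite -a1 /mass (place_pull _ sa).
  - exists f => // k kf; rewrite /pull; case: ifP => // kL; apply: fa.
    apply/mapP => -[l lf /rho_inj e]; rewrite e ?lf// in kf.
    by move/allP/(_ _ fF)/sub_seqP: FL; exact.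
have sb := within_supported FL bF.
exists (push b); last exact: pushK.
case/points_of_facetsP: bF => b0 b1 [f fF fb]; apply/points_of_facetsP; split.
- by move=> v; apply: sumr_ge0 => k _; rewrite mulr_ge0.
- by rewrite /mass place_pull ?pushK//; exact: push_supported.
- exists (map rho f); first exact: map_f.
  move=> v vf; rewrite /push big1// => k _.
  case: eqP => [kv|]; last by rewrite mulr0.
  by rewrite fb ?mul0r//; apply: contra vf => kf; rewrite -kv map_f.
Qed.

Lemma pull_set_inj F : within F ->
  set_inj (points (of_facets (relabelled rho F))) pull.
Proof.
move=> FL a c; rewrite !inE => /(relabelled_supported FL) sa.
by move=> /(relabelled_supported FL) sb /(congr1 push); rewrite !pullK.
Qed.

Lemma parametrizes_relabelled F (T : topologicalType)
  (g : {ptws U -> R} -> T) M :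
  within F -> parametrizes (of_facets F) g M ->
  parametrizes (of_facets (relabelled rho F)) (g \o pull) M.
Proof.
move=> FL [cg ig <-].
have pF a : points (of_facets (relabelled rho F)) a -> points (of_facets F) (pull a).
  by move=> aF; rewrite -(pull_points FL); exists a.
split.
- apply: within_comp cg => //; apply: continuous_subspaceT; exact: pull_continuous.
- move=> a b aF bF /= e; apply: (pull_set_inj FL) => //.
  by rewrite !inE in aF bF *; apply: ig; rewrite ?inE//; exact: pF.
- by rewrite -image_comp pull_points.
Qed.

Lemma carrier_relabelled F N (p : V -> 'rV[R]_N) : within F ->
  carrier (of_facets (relabelled rho F)) p = carrier (of_facets F) (p \o rho).
Proof.
move=> FL; rewrite !carrierE -(pull_points FL) image_comp.
apply: eq_imagel => a aF /=.
exact/place_pull/(relabelled_supported FL).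
Qed.

Lemma embeds_relabelled F N (p : V -> 'rV[R]_N) : within F ->
  embeds (of_facets F) (p \o rho) -> embeds (of_facets (relabelled rho F)) p.
Proof.
move=> FL ip a b aF bF; have := aF; have := bF; rewrite !inE => bF' aF'.
have [sa sb] := (relabelled_supported FL aF', relabelled_supported FL bF').
rewrite !place_pull// => e; apply: (pull_set_inj FL) => //.
by apply: ip; rewrite // inE -(pull_points FL); [exists a|exists b].
Qed.

Lemma flat_relabelled F G : within F -> within G ->
  flat_equiv R (of_facets F) (of_facets G) ->
  flat_equiv R (of_facets (relabelled rho F)) (of_facets (relabelled rho G)).
Proof.
move=> FL GL [N [q [iF iG FG]]].
pose p v : 'rV[R]_N := \sum_(k <- L) (rho k == v)%:R *: q k.
have pE : {in L, p \o rho =1 q}.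
  move=> k kL; rewrite /p /= (bigD1_seq k)//= eqxx scale1r.
  rewrite big_seq_cond big1 ?addr0// => l /andP[lL lk].
  by case: eqP => [/rho_inj e|]; [rewrite e// eqxx in lk|rewrite scale0r].
have pq H b : within H -> points (of_facets H) b -> place (p \o rho) b = place q b.
  by move=> HL /(within_supported HL) sb; apply: place_eq Luniq sb pE.
have inj H : within H -> embeds (of_facets H) q ->
    embeds (of_facets H) (p \o rho).
  move=> HL iH a b aH bH; have := aH; have := bH; rewrite !inE => bH' aH'.
  by rewrite !(pq H)// => e; exact: iH.
have car H : within H ->
    carrier (of_facets H) (p \o rho) = carrier (of_facets H) q.
  by move=> HL; rewrite !carrierE; apply: eq_imagel => a; exact: pq.
exists N, p; split.
- by apply: embeds_relabelled => //; exact: inj.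
- by apply: embeds_relabelled => //; exact: inj.
- by rewrite !carrier_relabelled// !car.
Qed.

End Points.
End Relabelling.

(** * Isomorphism and boundary of relabelled complexes *)

(** The isomorphism sends each vertex back to its label and then to the new
    vertex. *)
Lemma relabelled_isomorphic (U V W : choiceType) (rho : U -> V) (sigma : U -> W)
  (L : seq U) (F : seq (seq U)) (k0 : U) :
  {in L &, injective rho} -> {in L &, injective sigma} ->
  all (fun f => sub_seq f L) F ->
  of_facets (relabelled rho F) ~= of_facets (relabelled sigma F).
Proof.
move=> irho isig /allP FL.
pose f v := sigma (xget k0 [set k | k \in L /\ rho k = v]).
have fE k : k \in L -> f (rho k) = sigma k.
  move=> kL; rewrite /f; case: xgetP => [l _ [lL /irho e]|/(_ k)[]//].
  by rewrite e.
exists f; split.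
  have vert v :
      v \in [pred v | [fset v]%fset \in faces (of_facets (relabelled rho F))] ->
      exists2 k, k \in L & v = rho k.
    rewrite inE => /of_facetsP[_ /mapP[g /FL/sub_seqP gL ->]] /(_ v).
    by rewrite inE eqxx => /(_ isT)/mapP[k /gL kL ->]; exists k.
  by move=> _ _ /vert[k kL ->] /vert[l lL ->]; rewrite !fE// => /isig ->.
apply/fsetP => t; apply/imfsetP/idP.
  move=> [s /= /of_facetsP[_ /mapP[g gF ->] sg] ->].
  apply/of_facetsP; exists (map sigma g); first exact: map_f.
  move=> _ /imfsetP[v /= /sg/mapP[k kg ->] ->].
  by rewrite fE ?map_f//; move/sub_seqP: (FL _ gF); exact.
move=> /of_facetsP[_ /mapP[g gF ->] tg]; have /sub_seqP gL := FL _ gF.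
exists [fset v in [seq rho k | k <- g & sigma k \in t]]%fset.
  apply/of_facetsP; exists (map rho g); first exact: map_f.
  move=> v; rewrite inE => /mapP[k]; rewrite mem_filter => /andP[_ kg] ->.
  exact: map_f.
apply/fsetP => w; apply/idP/imfsetP => [wt|[v /=]].
  have /mapP[k kg wk] := tg _ wt; exists (rho k); last by rewrite fE// gL.
  by rewrite /= inE map_f// mem_filter kg -wk wt.
rewrite inE => /mapP[k]; rewrite mem_filter => /andP[kt /gL kL] -> ->.
by rewrite fE.
Qed.

(** A decidable form of the boundary condition on lists of facets.  The second
    clause says that no facet contains another one; for the third, every
    codimension one face arises by removing a vertex from a facet. *)
Definition bounds (d : nat) (T : eqType) (F B : seq (seq T)) : bool :=
  [&& all (fun f => uniq f && (size f == d.+1)) F,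
      all (fun f => count (sub_seq f) F == 1)%N F,
      all (fun f => all (fun k => let c := count (sub_seq (rem k f)) F in
        (c <= 2)%N && ((c == 1)%N ==> has (sub_seq (rem k f)) B)) f) F &
      all (fun b => [&& uniq b, size b == d & count (sub_seq b) F == 1]%N) B].

Lemma count_sub1 (T : eqType) (a b : pred T) (s : seq T) x :
  subpred a b -> x \in s -> a x -> count b s = 1%N ->
  forall y, y \in s -> b y -> y = x.
Proof.
move=> ab; elim: s => //= z s IH; rewrite !inE => /orP[/eqP<-|xs] ax.
  rewrite (ab _ ax) => -[] /eqP; rewrite -leqn0 leqNgt -has_count => nb y.
  by case/orP=> [/eqP//|ys] by_; case/negP: nb; apply/hasP; exists y.
have b0 : (0 < count b s)%N.
  by rewrite -has_count; apply/hasP; exists x => //; exact: ab.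
case: (boolP (b z)) => bz; last first.
  by rewrite add0n => /(IH xs ax) H y /orP[/eqP->|/H//]; rewrite (negbTE bz).
by rewrite add1n => -[c0]; rewrite c0 in b0.
Qed.

Section Boundary.
Variables (U V : choiceType) (rho : U -> V) (L : seq U).
Hypothesis rho_inj : {in L &, injective rho}.
Implicit Types (F B : seq (seq U)).

Definition label_face (f : seq U) : {fset V} := [fset v in map rho f]%fset.

Lemma label_face_sub f g : sub_seq f L -> sub_seq g L ->
  (label_face f `<=` label_face g)%fset = sub_seq f g.
Proof.
move=> /sub_seqP fL /sub_seqP gL; apply/fsubsetP/sub_seqP => [fg k kf|fg v].
  have : rho k \in label_face g by apply: fg; rewrite inE map_f.
  rewrite inE => /mapP[l lg /rho_inj e].
  by rewrite (e (fL _ kf) (gL _ lg)).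
by rewrite !inE => /mapP[k /fg kg ->]; rewrite map_f.
Qed.

Lemma card_label_face f : sub_seq f L -> uniq f ->
  #|` label_face f| = size f.
Proof.
move=> /sub_seqP fL uf; rewrite /label_face -(size_map rho f).
rewrite card_fseq undup_id// map_inj_in_uniq// => k l /fL kL /fL lL.
exact: rho_inj.
Qed.

Lemma bounds_is_boundary d F B : all (fun f => sub_seq f L) F ->
  all (fun f => sub_seq f L) B -> bounds d F B ->
  is_boundary d (of_facets (relabelled rho F)) (of_facets (relabelled rho B)).
Proof.
set X := of_facets _; move=> /allP FL /allP BL.
move=> /and4P[/allP Fd /allP F1 /allP Ft /allP Bt].
have XP (s : {fset V}) : s \in faces X <-> exists2 f, f \in F & (s `<=` label_face f)%fset.
  split=> [/of_facetsP[_ /mapP[f fF ->] sf]|[f fF /fsubsetP sf]].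
    by exists f => //; apply/fsubsetP => v /sf; rewrite inE.
  apply/of_facetsP; exists (map rho f); first exact: map_f.
  by move=> v /sf; rewrite inE.
have facetP s : s \in facets X <-> exists2 f, f \in F & s = label_face f.
  rewrite !inE /=; split=> [/andP[/XP[f fF sf] /forallP max]|[f fF ->]].
    have fX : label_face f \in faces X by apply/XP; exists f.
    by exists f => //; apply/eqP; move/implyP: (max [` fX]%fset); exact.
  apply/andP; split; first by apply/XP; exists f.
  apply/forallP => -[/= t tX]; apply/implyP => ft.
  have /XP[g gF tg] := tX.
  have fg : sub_seq f g by rewrite -label_face_sub ?FL//; exact: fsubset_trans tg.
  suff gf : g = f by rewrite gf in tg; rewrite eqEfsubset ft.
  apply: (@count_sub1 _ (sub_seq f) (sub_seq f) F f) => //.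
  - by apply/allP => k.
  - exact/eqP/F1.
have uF : {in F &, injective label_face}.
  move=> f g fF gF e; apply: (@count_sub1 _ (sub_seq g) (sub_seq g) F g) => //.
  - by apply/allP => k.
  - exact/eqP/F1.
  - by rewrite -label_face_sub ?FL// e.
have uniqF : uniq F.
  apply: count_mem_uniq => f; case: (boolP (f \in F)) => [fF|/count_memPn->//].
  have /eqP f1 := F1 f fF; apply/eqP; rewrite eqn_leq; apply/andP; split.
    rewrite -[nat_of_bool _]/1%N -f1.
    by apply: sub_count => _ /eqP ->; apply/allP.
  by rewrite -has_count; apply/hasP; exists f => /=.
have degE t : sub_seq t L -> degree X (label_face t) = count (sub_seq t) F.
  move=> tL; rewrite /degree -size_filter -(size_map label_face).
  rewrite (_ : [fset _ in _ | _]%fset =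
    [fset s in map label_face [seq f <- F | sub_seq t f]]%fset).
    rewrite card_fseq undup_id// map_inj_in_uniq ?filter_uniq// => f g.
    by rewrite !mem_filter => /andP[_ fF] /andP[_ gF]; exact: uF.
  apply/fsetP => s; apply/imfsetP/imfsetP.
    move=> [_ /andP[/facetP[f fF ->] tf] ->].
    exists (label_face f) => //; apply: map_f.
    by rewrite mem_filter fF andbT -label_face_sub// FL.
  move=> [_ /= /mapP[f + ->] ->]; rewrite mem_filter => /andP[tf fF].
  exists (label_face f) => //; apply/andP.
  by split; [apply/facetP; exists f|rewrite /= label_face_sub// FL].
have triP s : s \in faces X -> #|` s| = d ->
    exists2 f, f \in F & exists2 k, k \in f & s = label_face (rem k f).
  move=> /XP[f fF sf] sd; exists f => //.
  have /andP[uf /eqP fd] := Fd f fF.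
  have /fset0Pn[v] : (label_face f `\` s)%fset != fset0.
    by rewrite -cardfs_gt0 cardfsDS// card_label_face ?FL// fd sd subSnn.
  rewrite in_fsetD inE => /andP[vs /mapP[k kf vk]]; exists k => //.
  have kL : sub_seq (rem k f) L.
    by apply/sub_seqP => l /mem_rem lf; move/sub_seqP: (FL f fF); exact.
  apply/eqP; rewrite eqEfcard; apply/andP; split.
    apply/fsubsetP => w ws; have /fsubsetP/(_ _ ws) := sf.
    rewrite !inE => /mapP[l lf wl].
    rewrite wl map_f// mem_rem_uniq// inE lf andbT.
    by apply: contraNneq vs => lk; rewrite vk -lk -wl.
  by rewrite card_label_face ?rem_uniq// size_rem// fd sd.
have FtP f k : f \in F -> k \in f -> (count (sub_seq (rem k f)) F <= 2)%N /\
    (count (sub_seq (rem k f)) F = 1%N -> has (sub_seq (rem k f)) B).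
  move=> fF kf; have /allP/(_ k kf)/andP[-> /implyP h] := Ft f fF.
  by split=> // /eqP/h.
have remL f k : f \in F -> sub_seq (rem k f) L.
  move=> fF; apply/sub_seqP => l /mem_rem lf; move/sub_seqP: (FL f fF); exact.
split.
- move=> s /facetP[f fF ->]; have /andP[uf /eqP <-] := Fd f fF.
  by rewrite card_label_face ?FL.
- move=> s sX sd; have [f fF [k kf ->]] := triP s sX sd.
  by rewrite degE ?remL//; case: (FtP f k fF kf).
- apply: complex_eq => s; apply/idP/bigfcupP => [/of_facetsP[_ /mapP[b bB ->] sb]|].
    have /and3P[ub /eqP bd /eqP b1] := Bt b bB.
    exists (label_face b); last first.
      by rewrite fpowersetE; apply/fsubsetP => v /sb; rewrite inE.
    rewrite andbT !inE/= card_label_face ?BL// bd eqxx degE ?BL// b1 eqxx !andbT.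
    have : has (sub_seq b) F by rewrite has_count b1.
    move=> /hasP[f fF bf]; apply/XP; exists f => //.
    by rewrite (label_face_sub (BL _ bB) (FL _ fF)).
  move=> [t]; rewrite andbT !inE/= => /and3P[tX /eqP td /eqP t1].
  have [f fF [k kf tE]] := triP t tX td.
  rewrite tE degE ?remL// in t1; have [_ /(_ t1)/hasP[b bB fb]] := FtP f k fF kf.
  rewrite fpowersetE tE => /fsubsetP sf; apply/of_facetsP.
  exists (map rho b); first exact: map_f.
  move=> v /sf; rewrite inE => /mapP[l lf ->]; apply: map_f.
  by move/sub_seqP: fb; exact.
Qed.

End Boundary.

(** * Bistellar moves inside a fixed polyhedron *)

Lemma seq_argmin (T : eqType) d (D : orderType d) (u : T -> D) (s : seq T) :
  s != [::] -> exists2 k, k \in s & forall l, l \in s -> (u k <= u l)%O.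
Proof.
elim: s => // x s IH _; have [->|/IH[k ks kmin]] := eqVneq s [::].
  by exists x; rewrite ?mem_head// => l; rewrite inE => /eqP ->.
have [xk|kx] := leP (u x) (u k).
  exists x; rewrite ?mem_head// => l; rewrite inE => /orP[/eqP->//|/kmin].
  exact: le_trans.
exists k; first by rewrite inE ks orbT.
by move=> l; rewrite inE => /orP[/eqP->|/kmin//]; exact: ltW.
Qed.

Section Flips.
Variables (R : realType) (V : choiceType) (N : nat) (p : V -> 'rV[R]_N).
Implicit Types (A B f : seq V) (F : seq (seq V)) (a b r : V -> R).

(** An affine relation between points, with positive coefficients on A and
    negative ones on B: the convex hulls of A and B meet. *)
Definition radon A B r := [/\ supported (A ++ B) r, forall k, k \in A -> 0 < r k,
  forall k, k \in B -> r k < 0, mass r = 0 & place p r = 0].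

Lemma radonN A B r : radon A B r -> radon B A (fun v => - r v).
Proof.
move=> [sr rA rB r0 rp].
have E (M : lmodType R) (q : V -> M) :
    place q r = 0 -> place q (fun v => - r v) = 0.
  move=> q0; have := place_comb q (-1) 0 sr sr.
  rewrite q0 !scaler0 addr0 => e; rewrite -[RHS]e; congr place; apply/funext => v.
  by rewrite mulN1r mul0r addr0.
split.
- move=> v; rewrite mem_cat orbC -mem_cat => /sr ->; exact: oppr0.
- by move=> k /rB; rewrite oppr_gt0.
- by move=> k /rA; rewrite oppr_lt0.
- exact: E.
- exact: E.
Qed.

(** Every facet of F is kept in F', or it contains A and each of its faces
    opposite to a vertex of A spans with B a face of F'. *)
Definition slides A B F F' := all (fun f => has (sub_seq f) F' ||
  (sub_seq A f && all (fun k => has (sub_seq ([seq v <- f | v != k] ++ B)) F') A)) F.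

(** Subtract the relation from the coordinates until one of those on A
    vanishes; the support then lies in a facet that has lost a vertex of
    A and gained B. *)
Lemma slide A B F F' r a : radon A B r -> A != [::] -> slides A B F F' ->
  points (of_facets F) a ->
  exists2 t, 0 <= t & points (of_facets F') (fun v => a v - t * r v).
Proof.
move=> [sr rA rB r0 _] A0 /allP FF' /points_of_facetsP[a0 a1 [f fF fa]].
have /orP[/hasP[g gF /sub_seqP fg]|/andP[/sub_seqP Af /allP fA]] := FF' f fF.
  exists 0 => //.
  have -> : (fun v => a v - 0 * r v) = a by apply/funext => v; rewrite mul0r subr0.
  apply/points_of_facetsP.
  by split; [exact: a0|exact: a1|exists g => //; exact: supportedS fa].
have [k kA kmin] := seq_argmin (fun l => a l / r l) A0.
have t0 : 0 <= a k / r k by rewrite divr_ge0// ltW// rA.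
exists (a k / r k) => //; set t := a k / r k; apply/points_of_facetsP; split.
- move=> v; have [vA|vA] := boolP (v \in A).
    by rewrite subr_ge0 -ler_pdivlMr ?rA// kmin.
  rewrite addr_ge0// -mulrN mulr_ge0// oppr_ge0.
  have [vB|vB] := boolP (v \in B); first exact/ltW/rB.
  by rewrite sr// mem_cat (negbTE vA).
- have e := @mass_comb _ _ (f ++ A ++ B) a r 1 (- t).
  have {e} := e _ _; rewrite a1 r0 mulr0 addr0 mulr1 => <-.
  + by congr mass; apply/funext => v; rewrite mul1r mulNr.
  + by apply: supportedS fa => v vf; rewrite mem_cat vf.
  + by apply: supportedS sr => v vf; rewrite mem_cat vf orbT.
- have /hasP[g gF /sub_seqP fg] := fA k kA; exists g => // v vg.
  have [->|vk] := eqVneq v k; first by rewrite /t divfK ?subrr// gt_eqF ?rA.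
  have vfB : v \notin [seq v <- f | v != k] ++ B by apply: contra vg => /fg.
  rewrite mem_cat mem_filter vk/= negb_or in vfB; have /andP[vf vB] := vfB.
  rewrite fa// sr ?mulr0 ?subrr// mem_cat (negbTE vB) orbF.
  by apply: contra vf => /Af.
Qed.

Definition flips A B F F' := [&& A != [::], B != [::], slides A B F F',
  slides B A F' F & all (fun f => ~~ sub_seq A f) F'].

Lemma place_slide A B r a F t : radon A B r -> points (of_facets F) a ->
  place p (fun v => a v - t * r v) = place p a.
Proof.
move=> [sr _ _ _ rp] /points_of_facetsP[_ _ [f _ fa]].
have e := @place_comb _ _ _ p (f ++ A ++ B) a r 1 (- t).
have {e} := e _ _; rewrite rp scaler0 addr0 scale1r => <-.
- by congr place; apply/funext => v; rewrite mul1r mulNr.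
- by apply: supportedS fa => v vf; rewrite mem_cat vf.
- by apply: supportedS sr => v vf; rewrite mem_cat vf orbT.
Qed.

(** A point is not moved when a multiple of the relation is added to its
    coordinates, so both complexes fill the same set.  A simplex of F' never
    contains A, so that its points are the last admissible ones on their lines
    along the relation, and injectivity passes from F to F'. *)
Lemma flip A B F F' r : radon A B r -> flips A B F F' ->
  embeds (of_facets F) p ->
  embeds (of_facets F') p /\ carrier (of_facets F) p = carrier (of_facets F') p.
Proof.
move=> rad /and5P[A0 B0 FF' F'F /allP noA] inj; have radN := radonN rad.
have back a : points (of_facets F') a ->
    exists2 t, 0 <= t & points (of_facets F) (fun v => a v + t * r v).
  move=> aF'; have [t t0] := slide radN B0 F'F aF'; exists t => //.
  rewrite (_ : (fun v => a v + t * r v) = (fun v => a v - t * - r v))//.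
  by apply/funext => v; rewrite mulrN opprK.
have placeD a t : points (of_facets F') a ->
    place p (fun v => a v + t * r v) = place p a.
  move=> aF'; rewrite -(place_slide (- t) rad aF'); congr place.
  by apply/funext => v; rewrite mulNr opprK.
split; last first.
  rewrite !carrierE; apply/seteqP; split=> _ [a aF <-].
    have [t _ aF'] := slide rad A0 FF' aF.
    by eexists; [exact: aF'|rewrite (place_slide t rad aF)].
  have [t _ aF'] := back _ aF.
  by eexists; [exact: aF'|exact: placeD].
(* two points of F' over one point of F lie on one line along r; if they were
   distinct, the one further along r would be positive on all of A *)
have key a b t t' : points (of_facets F') a -> points (of_facets F') b ->
    (forall v, a v + t * r v = b v + t' * r v) -> t <= t'.
  move=> aF' bF' ab; rewrite leNgt; apply/negP => tt.
  case/points_of_facetsP: bF' => b0 b1 [f fF fb].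
  have /negP := noA _ fF; apply; apply/sub_seqP => k kA.
  apply: contraT => /fb bk; have := ab k; rewrite bk add0r => e.
  have : 0 <= a k by case: aF'.
  have -> : a k = (t' - t) * r k by rewrite mulrBl -e addrK.
  case: rad => _ rA _ _ _.
  by rewrite leNgt nmulr_rlt0 ?rA// subr_lt0.
move=> a b; rewrite !inE => aF' bF' ab.
have [t _ aF] := back _ aF'; have [t' _ bF] := back _ bF'.
have e : (fun v => a v + t * r v) = (fun v => b v + t' * r v).
  by apply: inj; rewrite ?inE// !placeD.
have e' v : a v + t * r v = b v + t' * r v by move/(congr1 (@^~ v)): e.
have tt' : t = t' by apply/le_anti; rewrite (key a b)// (key b a).
by apply/funext => v; apply: (addIr (t * r v)); rewrite e' tt'.
Qed.

End Flips.

(** * Boundaries of convex polytopes *)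

Definition pairing (R : realType) N (y : 'rV[R]_N) (phi : 'cV[R]_N) : R :=
  (y *m phi) 0 0.

Lemma pairing0 (R : realType) N (phi : 'cV[R]_N) : pairing 0 phi = 0.
Proof. by rewrite /pairing mul0mx mxE. Qed.

(** A list of facets, each with a linear functional that takes the value 1 on
    its vertices and smaller values on the other vertices: these are the facets
    of a polytope with the origin inside.  The last clause, that every ridge is
    shared with a second facet, says that the list is complete. *)
Record polytope_boundary (R : realType) (V : choiceType) N (x : V -> 'rV[R]_N)
    (L : seq V) (Phi : seq (seq V * 'cV[R]_N)) : Prop := PolytopeBoundary {
  vertices_uniq : uniq L;
  facet_vertices : forall f phi, (f, phi) \in Phi -> {subset f <= L};
  facet_supporting : forall f phi k, (f, phi) \in Phi -> k \in L ->
    if k \in f then pairing (x k) phi = 1 else pairing (x k) phi < 1;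
  facet_adjacent : forall f phi k, (f, phi) \in Phi -> k \in f ->
    exists g psi, [/\ (g, psi) \in Phi, k \notin g &
      forall l, l \in f -> l != k -> l \in g] }.

Section Polytope.
Variables (R : realType) (V : choiceType) (N : nat) (x : V -> 'rV[R]_N).
Variables (L : seq V) (Phi : seq (seq V * 'cV[R]_N)).
Hypothesis polytopeP : polytope_boundary x L Phi.
Implicit Types (a b : V -> R) (f : seq V) (phi : 'cV[R]_N) (y : 'rV[R]_N).

Lemma pairing_place phi (t : seq V) a : uniq t -> supported t a ->
  pairing (place x a) phi = \sum_(v <- t) a v * pairing (x v) phi.
Proof.
move=> ut sa; rewrite (placeE _ ut sa) /pairing mulmx_suml summxE.
by apply: eq_bigr => v _; rewrite -scalemxAl mxE.
Qed.

Let Luniq := vertices_uniq polytopeP.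
Let within := facet_vertices polytopeP.
Let supporting := facet_supporting polytopeP.
Let adjacent := facet_adjacent polytopeP.
Let polytope := of_facets (unzip1 Phi).

Lemma pairing_facet f phi a : (f, phi) \in Phi -> supported f a ->
  pairing (place x a) phi = mass a.
Proof.
move=> fP fa; have sa : supported L a by apply: supportedS fa; exact: within fP.
rewrite (pairing_place _ Luniq sa) (massE Luniq sa); apply: eq_big_seq => v vL.
have := supporting fP vL; case: ifPn => [_ ->|/fa -> _]; first by rewrite mulr1.
by rewrite mul0r.
Qed.

Lemma pairing_le f phi a : (f, phi) \in Phi -> supported L a ->
  (forall v, 0 <= a v) -> pairing (place x a) phi <= mass a.
Proof.
move=> fP sa a0; rewrite (pairing_place _ Luniq sa) (massE Luniq sa) !big_seq.
apply: ler_sum => v vL; rewrite ler_piMr//.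
by have := supporting fP vL; case: ifP => _ => [->|/ltW].
Qed.

Lemma pairing_max f phi a : (f, phi) \in Phi -> supported L a ->
  (forall v, 0 <= a v) -> pairing (place x a) phi = mass a -> supported f a.
Proof.
move=> fP sa a0; rewrite (pairing_place _ Luniq sa) (massE Luniq sa) => /eqP.
rewrite eq_sym -subr_eq0 -sumrB => /eqP e v vf.
have [vL|/sa//] := boolP (v \in L).
have ge w : w \in L -> 0 <= a w - a w * pairing (x w) phi.
  move=> wL; rewrite subr_ge0 ler_piMr//.
  by have := supporting fP wL; case: ifP => _ => [->|/ltW].
have : a v - a v * pairing (x v) phi = 0.
  apply/le_anti; rewrite ge// andbT -e (bigD1_seq v)//= lerDl.
  by rewrite big_seq_cond sumr_ge0// => w /andP[/ge].
have := supporting fP vL; rewrite (negbTE vf) => lt.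
rewrite -{1}[a v]mulr1 -mulrBr => /eqP; rewrite mulf_eq0 subr_eq0.
by rewrite [1 == _]eq_sym (lt_eqF lt) orbF => /eqP.
Qed.

(** The functionals of f and of its neighbour opposite to k agree on the other
    vertices of f, so their difference reads off the coordinate at k. *)
Lemma facet_coef f phi k a : (f, phi) \in Phi -> k \in f -> supported f a ->
  exists g psi, [/\ (g, psi) \in Phi, 0 < 1 - pairing (x k) psi &
    a k * (1 - pairing (x k) psi)
      = pairing (place x a) phi - pairing (place x a) psi].
Proof.
move=> fP kf fa; have [g [psi [gP kg fg]]] := adjacent fP kf.
have kL := within fP kf.
have sa : supported L a by apply: supportedS fa; exact: within fP.
exists g, psi; split=> //.
  by have := supporting gP kL; rewrite (negbTE kg) subr_gt0.
rewrite (pairing_facet fP fa) (massE Luniq sa) (pairing_place _ Luniq sa) -sumrB.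
rewrite (bigD1_seq k)//= mulrBr mulr1 big_seq_cond big1 ?addr0// => l /andP[lL lk].
have [lf|/fa ->] := boolP (l \in f); last by rewrite mul0r subrr.
by have := supporting gP lL; rewrite fg// => ->; rewrite mulr1 subrr.
Qed.

Lemma facet_inj f phi a b :
  (f, phi) \in Phi -> supported f a -> supported f b ->
  place x a = place x b -> a = b.
Proof.
move=> fP fa fb ab.
pose c v := 1 * a v + (-1) * b v.
have sc : supported f c by move=> v vf; rewrite /c fa// fb// !mulr0 addr0.
have c0 : place x c = 0.
  by rewrite (place_comb _ _ _ fa fb) ab scale1r scaleN1r subrr.
apply/funext => v; apply/eqP; rewrite -subr_eq0; apply/eqP.
have -> : a v - b v = c v by rewrite /c mul1r mulN1r.
have [vf|/sc//] := boolP (v \in f).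
have [g [psi [gP gt]]] := facet_coef fP vf sc.
rewrite c0 !pairing0 subrr => /eqP.
by rewrite mulf_eq0 (gt_eqF gt) orbF => /eqP.
Qed.

Lemma polytope_supported a : points polytope a -> supported L a.
Proof.
move=> /points_of_facetsP[_ _ [f /mapP[[g phi] gP ->]]].
by apply: supportedS; exact: within gP.
Qed.

(** The functional of the facet of a attains its maximum 1 on the polytope
    exactly on that facet; comparing both ways gives t = 1 and a common facet,
    on which the coordinates are unique. *)
Lemma polytope_ray_inj a b t :
  points polytope a -> points polytope b -> 0 < t ->
  place x a = t *: place x b -> a = b.
Proof.
have half a' b' t' : points polytope a' -> points polytope b' ->
    place x a' = t' *: place x b' -> 0 < t' ->
    exists2 f, f \in Phi & supported f.1 a' /\ (1 <= t' /\ (t' = 1 -> supported f.1 b')).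
  move=> aP bP ab t0; have sb := polytope_supported bP.
  case/points_of_facetsP: bP => b0 b1 _.
  case/points_of_facetsP: aP => a0 a1 [_ /mapP[[f phi] fP ->]] fa.
  exists (f, phi) => //; split=> //=.
  have e : 1 = t' * pairing (place x b') phi.
    by rewrite -a1 -(pairing_facet fP fa) ab /pairing -scalemxAl mxE.
  split; first by rewrite e ger_pMr// -b1; exact: pairing_le fP sb b0.
  move=> t1; apply: (pairing_max fP sb b0).
  by rewrite b1 e t1 mul1r.
move=> aP bP t0 ab.
have [f fP [fa [t1 fb]]] := half _ _ _ aP bP ab t0.
have ba : place x b = t^-1 *: place x a.
  by rewrite ab scalerA mulVf ?scale1r// gt_eqF.
have ti : 0 < t^-1 by rewrite invr_gt0.
have [_ _ [_ [+ _]]] := half _ _ _ bP aP ba ti.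
rewrite invf_ge1// => t1'; have te : t = 1 by apply/le_anti; rewrite t1 t1'.
rewrite te scale1r in ab.
case: f fP fa fb => f phi fP /= fa /(_ te) fb.
exact: facet_inj fP fa fb ab.
Qed.

Hypothesis simplicial : forall f phi, (f, phi) \in Phi -> uniq f /\ size f = N.
Hypothesis nonempty : Phi != [::].

(** The vertices of a facet are independent by the uniqueness of coordinates,
    and there are as many of them as dimensions. *)
Lemma facet_span f phi y : (f, phi) \in Phi ->
  exists2 a, supported f a & place x a = y.
Proof.
move=> fP; have [uf fN] := simplicial fP.
pose M : 'M[R]_N := \matrix_(i < N) x (tnth (in_tuple f) (cast_ord (esym fN) i)).
pose vec (c : 'rV[R]_N) v : R := \sum_(i < N) c 0 i *
  (tnth (in_tuple f) (cast_ord (esym fN) i) == v)%:R.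
have sup c : supported f (vec c).
  move=> v vf; rewrite /vec big1// => i _; case: eqP => [iv|]; last by rewrite mulr0.
  by rewrite -iv mem_tnth in vf.
have inj i j : tnth (in_tuple f) (cast_ord (esym fN) i)
    = tnth (in_tuple f) (cast_ord (esym fN) j) -> i = j.
  by have /tuple_uniqP tinj : uniq (in_tuple f) by []; move=> /tinj/cast_ord_inj.
have vecE c i : vec c (tnth (in_tuple f) (cast_ord (esym fN) i)) = c 0 i.
  rewrite /vec (bigD1 i)//= eqxx mulr1 big1 ?addr0// => j ji.
  case: eqP => [/inj e|]; last by rewrite mulr0.
  by rewrite e eqxx in ji.
have pl c : place x (vec c) = c *m M.
  rewrite (placeE _ uf (sup c)) mulmx_sum_row.
  rewrite -[f in LHS]/(val (in_tuple f)) big_tuple.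
  rewrite (reindex (cast_ord (esym fN)))/=; last first.
    by exists (cast_ord fN) => i _; rewrite ?cast_ordK ?cast_ordKV.
  by apply: eq_bigr => i _; rewrite vecE rowK.
have Mu : M \in unitmx.
  rewrite -row_free_unit; apply: inj_row_free => c cM.
  have : vec c = vec 0 by apply: (facet_inj fP) => //; rewrite !pl cM mul0mx.
  by move=> e; apply/rowP => i; rewrite -!vecE e.
exists (vec (y *m invmx M)) => //.
by rewrite pl -mulmxA mulVmx// mulmx1.
Qed.

(** The ray through y leaves the polytope through a facet whose functional is
    largest at y: if y had a negative coordinate at a vertex k of that facet,
    the neighbour opposite to k would give a larger value. *)
Lemma polytope_ray_surj y : y != 0 ->
  exists2 a, points polytope a & exists2 t, 0 < t & place x a = t *: y.
Proof.
move=> y0.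
have [[f phi] fP] := seq_argmin (fun F => - pairing y F.2) nonempty.
move=> max; have [a fa ay] := facet_span y fP.
have sa : supported L a by apply: supportedS fa; exact: within fP.
have a0 v : 0 <= a v.
  have [vf|/fa ->//] := boolP (v \in f).
  have [g [psi [gP gt]]] := facet_coef fP vf fa.
  rewrite ay => e; have := max _ gP; rewrite lerN2 /= -subr_ge0 -e.
  by rewrite pmulr_lge0.
have m0 : 0 < mass a.
  rewrite lt_def (massE Luniq sa) sumr_ge0 ?andbT//; apply: contra y0.
  rewrite psumr_eq0// => /allP z; rewrite -ay (placeE _ Luniq sa).
  by apply/eqP/big1_seq => v /andP[_ /z/eqP ->]; rewrite scale0r.
exists (fun v => (mass a)^-1 * a v + 0 * a v); last first.
  exists (mass a)^-1; first by rewrite invr_gt0.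
  by rewrite (place_comb _ _ _ sa sa) ay scale0r addr0.
apply/points_of_facetsP; split.
- by move=> v; rewrite mul0r addr0 mulr_ge0// invr_ge0 ltW.
- by rewrite (mass_comb _ _ sa sa) mul0r addr0 mulVf// gt_eqF.
- exists f; first by apply/mapP; exists (f, phi).
  by move=> v vf; rewrite fa// !mulr0 addr0.
Qed.

End Polytope.

Section Lower.
Variables (R : realType) (V : choiceType) (N : nat) (x : V -> 'rV[R]_N.+1).
Variables (L : seq V) (Phi : seq (seq V * 'cV[R]_N.+1)).
Hypothesis polytopeP : polytope_boundary x L Phi.

Definition shadow (y : 'rV[R]_N.+1) : 'rV[R]_N :=
  \row_i y 0 (widen_ord (leqnSn N) i).

Lemma place_shadow (a : V -> R) : supported L a ->
  place (shadow \o x) a = shadow (place x a).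
Proof.
move=> sa; rewrite !(placeE _ (vertices_uniq polytopeP) sa); apply/rowP => i.
by rewrite mxE !summxE; apply: eq_bigr => v _; rewrite !mxE.
Qed.

Lemma pairing_shadow (y z : 'rV[R]_N.+1) phi : shadow y = shadow z ->
  pairing y phi - pairing z phi = (y 0 ord_max - z 0 ord_max) * phi ord_max 0.
Proof.
move=> /rowP yz; rewrite /pairing !mxE !big_ord_recr /= opprD addrACA -sumrB.
rewrite big1 ?add0r ?mulrBl// => i _.
by have := yz i; rewrite !mxE => ->; rewrite subrr.
Qed.

(** Over a point of the projection, a lower facet lies below all points of the
    polytope; two points of lower facets with one projection coincide. *)
Lemma lower_embeds (Phi' : seq (seq V * 'cV[R]_N.+1)) :
  {subset Phi' <= Phi} ->
  (forall f phi, (f, phi) \in Phi' -> phi ord_max 0 < 0) ->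
  embeds (of_facets (unzip1 Phi')) (shadow \o x).
Proof.
move=> sub low.
have sP (a : {ptws V -> R}) :
    points (of_facets (unzip1 Phi')) a -> points (of_facets (unzip1 Phi)) a.
  move=> /points_of_facetsP[a0 a1 [_ /mapP[F /sub FP ->] fa]].
  by apply/points_of_facetsP; split=> //; exists F.1 => //; exact: map_f.
have le a b :
    points (of_facets (unzip1 Phi')) a -> points (of_facets (unzip1 Phi')) b ->
    shadow (place x a) = shadow (place x b) ->
    place x a 0 ord_max <= place x b 0 ord_max.
  move=> aP /sP bP e; have sb := polytope_supported polytopeP bP.
  case/points_of_facetsP: aP => a0 a1 [_ /mapP[[f phi] fP ->] fa].
  case/points_of_facetsP: bP => b0 b1 _.
  have := pairing_le polytopeP (sub _ fP) sb b0.
  rewrite b1 -a1 -(pairing_facet polytopeP (sub _ fP) fa) -subr_ge0.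
  by rewrite (pairing_shadow _ e) nmulr_lge0 ?(low _ _ fP)// subr_le0.
move=> a b; rewrite !inE => aP bP; have [aP' bP'] := (sP _ aP, sP _ bP).
have [sa sb] := (polytope_supported polytopeP aP', polytope_supported polytopeP bP').
rewrite !place_shadow//.
move=> e; apply: (polytope_ray_inj polytopeP aP' bP' ltr01).
rewrite scale1r; apply/rowP => i; have [->|im] := eqVneq i ord_max.
  by apply/le_anti; rewrite le// le.
have iN : (i < N)%N by rewrite -ltnS ltn_neqAle im ltn_ord.
move/rowP/(_ (Ordinal iN)): e; rewrite !mxE.
by have -> : widen_ord (leqnSn N) (Ordinal iN) = i by apply: val_inj.
Qed.

End Lower.

(** * Radial projection to the sphere *)

Section Normalize.
Variables (R : realType) (n : nat).
Implicit Types y z : 'rV[R]_n.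

Definition sqnorm y : R := \sum_i y 0 i ^+ 2.
Definition normalize y := (Num.sqrt (sqnorm y))^-1 *: y.

Lemma sqnorm_ge0 y : 0 <= sqnorm y.
Proof. by apply: sumr_ge0 => i _; exact: sqr_ge0. Qed.

Lemma sqnorm_gt0 y : (0 < sqnorm y) = (y != 0).
Proof.
rewrite lt_def sqnorm_ge0 andbT; congr (~~ _); apply/eqP/eqP => [/eqP|->].
  rewrite psumr_eq0; last by move=> i _; exact: sqr_ge0.
  move=> /allP y0; apply/rowP => i; rewrite mxE.
  by have := y0 i (mem_index_enum i); rewrite /= sqrf_eq0 => /eqP.
by rewrite /sqnorm big1// => i _; rewrite mxE expr0n.
Qed.

Lemma sqnormZ c y : sqnorm (c *: y) = c ^+ 2 * sqnorm y.
Proof.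
by rewrite /sqnorm mulr_sumr; apply: eq_bigr => i _; rewrite mxE exprMn.
Qed.

Lemma sqnorm_normalize y : y != 0 -> sqnorm (normalize y) = 1.
Proof.
rewrite -sqnorm_gt0 => y0; rewrite sqnormZ exprVn sqr_sqrtr ?ltW//.
by rewrite mulVf// gt_eqF.
Qed.

Lemma normalize_id y : sqnorm y = 1 -> normalize y = y.
Proof. by rewrite /normalize => ->; rewrite sqrtr1 invr1 scale1r. Qed.

Lemma normalizeZ c y : 0 < c -> normalize (c *: y) = normalize y.
Proof.
move=> c0; rewrite /normalize sqnormZ sqrtrM ?sqr_ge0// sqrtr_sqr gtr0_norm//.
by rewrite scalerA invfM mulrAC mulVf ?mul1r// gt_eqF.
Qed.

Lemma normalize_inj y z : y != 0 -> z != 0 -> normalize y = normalize z ->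
  exists2 t, 0 < t & y = t *: z.
Proof.
rewrite -!sqnorm_gt0 => y0 z0 yz.
exists (Num.sqrt (sqnorm y) / Num.sqrt (sqnorm z)).
  by rewrite divr_gt0// sqrtr_gt0.
rewrite -scalerA -/(normalize z) -yz scalerA divff ?scale1r// gt_eqF//.
by rewrite sqrtr_gt0.
Qed.

Lemma continuous_sqnorm : continuous sqnorm.
Proof.
apply: continuous_big => [|i _]; first exact: add_continuous.
move=> y.
apply: (@continuous_comp _ _ _ (fun y : 'rV[R]_n => y 0 i) (fun t => t ^+ 2)).
  exact: coord_continuous.
exact: exprn_continuous.
Qed.

Lemma continuous_normalize y : y != 0 -> {for y, continuous normalize}.
Proof.
rewrite -sqnorm_gt0 => y0.
have cs : {for y, continuous (fun z : 'rV[R]_n => Num.sqrt (sqnorm z))}.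
  apply: (@continuous_comp _ _ _ (@sqnorm) Num.sqrt).
    exact: continuous_sqnorm.
  exact: sqrt_continuous.
have ci : {for y, continuous (fun z : 'rV[R]_n => (Num.sqrt (sqnorm z))^-1)}.
  apply: (@continuous_comp _ _ _ (fun z => Num.sqrt (sqnorm z)) GRing.inv) => //.
  by apply: inv_continuous; rewrite gt_eqF// sqrtr_gt0.
exact: (cvgZ ci cvg_id).
Qed.

End Normalize.

Section PolytopeSphere.
Variables (R : realType) (V : choiceType) (N : nat) (x : V -> 'rV[R]_N.+1).
Variables (L : seq V) (Phi : seq (seq V * 'cV[R]_N.+1)).
Hypothesis polytopeP : polytope_boundary x L Phi.
Hypothesis simplicial : forall f phi, (f, phi) \in Phi ->
  uniq f /\ size f = N.+1.
Hypothesis nonempty : Phi != [::].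

Lemma polytope_parametrizes_sphere :
  parametrizes (of_facets (unzip1 Phi)) (@normalize R _ \o place x)
    (sphere R N).
Proof.
have nz (a : {ptws V -> R}) :
    points (of_facets (unzip1 Phi)) a -> place x a != 0.
  move=> /points_of_facetsP[_ a1 [_ /mapP[[f phi] fP ->] fa]].
  apply/eqP => a0; have := pairing_facet polytopeP fP fa.
  by rewrite a0 pairing0 a1 => /eqP; rewrite eq_sym oner_eq0.
split.
- apply: within_continuous_comp; last exact: continuous_place.
  by move=> y; rewrite inE => -[a /nz a0 <-]; exact: continuous_normalize.
- move=> a b; rewrite !inE => aP bP /= /(normalize_inj (nz _ aP) (nz _ bP))[t t0].
  exact: (polytope_ray_inj polytopeP aP bP t0).
- apply/seteqP; split=> [_ [a /nz a0 <-]|y y1]; first exact: sqnorm_normalize.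
  have y0 : y != 0 by rewrite -sqnorm_gt0 /sqnorm y1.
  have [a aP [t t0 ay]] := polytope_ray_surj polytopeP simplicial nonempty y0.
  by exists a => //=; rewrite ay (normalizeZ _ t0) (normalize_id y1).
Qed.

End PolytopeSphere.

(** * The polytope with boundary T_1 |+| T_3 and the moves on T_1 *)

(** The labels 0 to 6 stand for the elements of Z_7, and 7, 8, 9 for the
    vertices u, v, w; numbers make all finite verifications computations. *)
Definition labels1 : seq (seq nat) :=
  [:: [:: 0; 1; 2; 3]; [:: 1; 2; 3; 4]; [:: 2; 3; 4; 5]; [:: 3; 4; 5; 6];
      [:: 0; 4; 5; 6]; [:: 0; 1; 5; 6]; [:: 0; 1; 2; 6]]%N.

Definition labels3 : seq (seq nat) :=
  [:: [:: 0; 1; 4; 5]; [:: 1; 2; 4; 5]; [:: 1; 2; 5; 6]; [:: 2; 3; 5; 6];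
      [:: 0; 2; 3; 6]; [:: 0; 3; 4; 6]; [:: 0; 1; 3; 4]]%N.

Definition labels10 : seq (seq nat) :=
  [:: [:: 7; 0; 1; 2]; [:: 7; 0; 1; 3]; [:: 7; 0; 2; 3]; [:: 7; 1; 2; 4];
      [:: 7; 1; 3; 4]; [:: 7; 2; 3; 5]; [:: 7; 2; 4; 5];
      [:: 8; 3; 4; 6]; [:: 8; 3; 5; 6]; [:: 8; 0; 4; 5]; [:: 8; 0; 4; 6];
      [:: 8; 0; 1; 5]; [:: 8; 1; 5; 6]; [:: 8; 0; 1; 2]; [:: 8; 0; 2; 6];
      [:: 8; 1; 2; 6];
      [:: 7; 8; 3; 4]; [:: 7; 8; 3; 5]; [:: 7; 8; 4; 5]]%N.

Definition labels10' : seq (seq nat) :=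
  [seq f <- labels10 | f \notin [:: [:: 7; 0; 1; 2]; [:: 8; 0; 1; 2]]%N] ++
  [:: [:: 7; 9; 0; 1]; [:: 7; 9; 0; 2]; [:: 7; 9; 1; 2];
      [:: 8; 9; 0; 1]; [:: 8; 9; 0; 2]; [:: 8; 9; 1; 2]]%N.

(** The first seven rows are the vertices of the polytope, and without their last
    coordinate they realize T_1 in R^3.  The rows 7, 8, 9 place u, v, w in R^3.
    The values are one of many solutions of the inequalities in
    [supports_check], of the sign condition in [labels1_embeds], and of those on
    the affine relations of [moves] and [star012]. *)
Definition coordinates : seq (seq int) :=
  [:: [:: 3; 4; 4; -3]; [:: 2; 2; 2; -4]; [:: 4; -1; -1; 1]; [:: 0; -4; 3; 2];
      [:: 0; 0; 2; -3]; [:: 0; 1; 0; -3]; [:: -4; 3; -3; 4];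
      [:: 1; -3; 2; 0]; [:: -1; 3; 0; 0]; [:: 3; 1; 1; 0] ]%Z.

Definition coordinate (k i : nat) : int := nth 0%Z (nth [::] coordinates k) i.

(** A pair (l, d) attached to a facet stands for the functional l / d. *)
Definition functionals : seq (seq nat * (seq int * int)) := zip (labels1 ++ labels3)
  [:: ([:: 91; -71; 50; -49], 336); ([:: 25; -42; 2; -34], 106);
      ([:: 3; -40; -20; -28], 44); ([:: -27; -20; -10; -14], 22);
      ([:: -70; 42; 21; -43], 171); ([:: -3; 7; -3; -5], 22);
      ([:: 78; 119; -137; -42], 288);
      ([:: -10; 6; 3; -8], 30); ([:: 11; -24; -12; -26], 54);
      ([:: 41; 62; -88; -32], 158); ([:: -81; -212; -220; -80], 28);
      ([:: 175; 154; 193; 390], 743); ([:: -214; 56; 209; 3], 409);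
      ([:: 8; -17; 22; -18], 98) ]%Z.

Definition int_sum (s : seq int) : int := foldr +%R 0 s.

Definition dot (l : seq int) (k : nat) : int :=
  int_sum [seq nth 0 l i * coordinate k i | i <- iota 0 4].

Lemma supports_check : all (fun F => let: (f, (l, d)) := F in (0 < d) &&
    all (fun k => if k \in f then dot l k == d else dot l k < d) (iota 0 7))
  functionals.
Proof. by vm_compute. Qed.

Lemma adjacent_check : all (fun F => all (fun k => has (fun G =>
    (k \notin G.1) && sub_seq [seq l <- F.1 | l != k] G.1) functionals) F.1)
  functionals.
Proof. by vm_compute. Qed.

(** Facets containing A may contain vertices of B already, and undup removes
    the repetitions within a list; repeated facets are harmless. *)
Definition bistellar (A B : seq nat) (F : seq (seq nat)) : seq (seq nat) :=
  [seq f <- F | ~~ sub_seq A f] ++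
  [seq undup ([seq v <- f | v != k] ++ B)
    | f <- [seq f <- F | sub_seq A f], k <- A].

(** The integers of c are the coefficients of an affine relation in R^3, in the
    order of A ++ B. *)
Definition radonb (A B : seq nat) (c : seq int) : bool :=
  let coef k := nth 0%Z c (index k (A ++ B)) in
  [&& uniq (A ++ B), all (fun k => 0 < coef k) A, all (fun k => coef k < 0) B,
      int_sum [seq coef k | k <- A ++ B] == 0 &
      all (fun i => int_sum [seq coef k * coordinate k i | k <- A ++ B] == 0)
        (iota 0 3)].

(** Starring u in the tetrahedron 1234 and then absorbing 0123 and 2345 by two
    moves replaces B_1 with the cone from u over its boundary; the next four
    moves do the same with v, from 0456, for B_2; the last one is 345 to uv. *)
Definition moves : seq (seq nat * seq nat * seq int) :=
  [:: ([:: 1; 2; 3; 4], [:: 7], [:: 1; 8; 24; 1; -34]%Z);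
      ([:: 1; 2; 3], [:: 0; 7], [:: 4; 11; 35; -1; -49]%Z);
      ([:: 2; 3; 4], [:: 5; 7], [:: 7; 19; 3; -1; -28]%Z);
      ([:: 0; 4; 5; 6], [:: 8], [:: 15; 3; 3; 22; -43]%Z);
      ([:: 4; 5; 6], [:: 3; 8], [:: 33; 3; 7; -15; -28]%Z);
      ([:: 0; 5; 6], [:: 1; 8], [:: 3; 3; 2; -3; -5]%Z);
      ([:: 0; 1; 6], [:: 2; 8], [:: 2; 6; 7; -1; -14]%Z);
      ([:: 3; 4; 5], [:: 7; 8], [:: 2; 4; 8; -7; -7]%Z)]%N.

(** Starring w in the triangle 012 is a bistellar move whose set B is a single
    vertex inside the triangle. *)
Definition star012 : seq (seq nat * seq nat * seq int) :=
  [:: ([:: 0; 1; 2], [:: 9], [:: 1; 3; 3; -7]%Z)]%N.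

Fixpoint legal (F : seq (seq nat)) (ms : seq (seq nat * seq nat * seq int)) :=
  if ms is (A, B, c) :: ms' then
    [&& radonb A B c, flips A B F (bistellar A B F) & legal (bistellar A B F) ms']
  else true.

Definition perform F (ms : seq (seq nat * seq nat * seq int)) :=
  foldl (fun F m => bistellar m.1.1 m.1.2 F) F ms.

Lemma moves_check :
  legal labels1 moves && same_facets (perform labels1 moves) labels10.
Proof. by vm_compute. Qed.

Lemma star_check :
  legal labels10 star012 && same_facets (perform labels10 star012) labels10'.
Proof. by vm_compute. Qed.

Section Geometry.
Variable R : realType.

(** For N = 4 these are the vertices of the polytope, for N = 3 their shadows. *)
Definition position (N : nat) (k : nat) : 'rV[R]_N :=
  \row_(i < N) (coordinate k i)%:~R.

Definition functional (ld : seq int * int) : 'cV[R]_4 :=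
  \col_(i < 4) ((nth 0%Z ld.1 i)%:~R / ld.2%:~R).

Definition functionals_real := [seq (F.1, functional F.2) | F <- functionals].

Lemma int_sumE (T : Type) (s : seq T) (u : T -> int) :
  (int_sum [seq u k | k <- s])%:~R = \sum_(k <- s) (u k)%:~R :> R.
Proof. by rewrite /int_sum foldrE big_map rmorph_sum. Qed.

Lemma pairing_dot (l : seq int) (d : int) k :
  pairing (position 4 k) (functional (l, d)) = (dot l k)%:~R / d%:~R.
Proof.
rewrite /pairing mxE /dot int_sumE mulr_suml -[iota 0 4]/(index_iota 0 4) big_mkord.
by apply: eq_bigr => i _; rewrite !mxE intrM mulrCA mulrA.
Qed.

Lemma functionalsP f phi : (f, phi) \in functionals_real ->
  exists l d, (f, (l, d)) \in functionals /\ phi = functional (l, d).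
Proof. by move=> /mapP[[g [l d]] gP [-> ->]]; exists l, d. Qed.

Lemma functionals_within f phi :
  (f, phi) \in functionals_real -> {subset f <= iota 0 7}.
Proof.
move=> /functionalsP[l [d [fP _]]]; apply/sub_seqP.
have /allP/(_ _ fP)// : all (fun F => sub_seq F.1 (iota 0 7)) functionals.
by vm_compute.
Qed.

Lemma functionals_simplicial f phi :
  (f, phi) \in functionals_real -> uniq f /\ size f = 4.
Proof.
move=> /functionalsP[l [d [fP _]]].
suff /allP/(_ _ fP)/andP[-> /eqP ->] :
  all (fun F => uniq F.1 && (size F.1 == 4)) functionals by [].
by vm_compute.
Qed.

Lemma functionals_supporting f phi k :
  (f, phi) \in functionals_real -> k \in iota 0 7 ->
  if k \in f then pairing (position 4 k) phi = 1
  else pairing (position 4 k) phi < 1.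
Proof.
move=> /functionalsP[l [d [fP ->]]] k7; rewrite pairing_dot.
have /allP/(_ _ fP)/andP[d0 /allP/(_ _ k7)] := supports_check.
have d0' : 0 < d%:~R :> R by rewrite ltr0z.
case: (k \in f); first by move=> /eqP ->; rewrite divff// gt_eqF.
by move=> lt; rewrite ltr_pdivrMr// mul1r ltr_int.
Qed.

Lemma functionals_adjacent f phi k :
  (f, phi) \in functionals_real -> k \in f ->
  exists g psi, [/\ (g, psi) \in functionals_real, k \notin g &
    forall l, l \in f -> l != k -> l \in g].
Proof.
move=> /functionalsP[l [d [fP _]]] kf.
have /allP/(_ _ fP)/allP/(_ _ kf)/hasP[[g ld] gP /= /andP[kg /sub_seqP fg]] :=
  adjacent_check.
exists g, (functional ld); split=> //; first by apply/mapP; exists (g, ld).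
by move=> m mf mk; apply: fg; rewrite mem_filter mk.
Qed.

Lemma unzip_functionals : unzip1 functionals_real = labels1 ++ labels3.
Proof. by rewrite /unzip1 /functionals_real -map_comp. Qed.

Lemma functionals_polytope :
  polytope_boundary (position 4) (iota 0 7) functionals_real.
Proof.
split; [exact: iota_uniq|exact: functionals_within|..].
  exact: functionals_supporting.
exact: functionals_adjacent.
Qed.

Lemma sphere_parametrized : exists g : {ptws nat -> R} -> 'rV[R]_4,
  parametrizes (of_facets (labels1 ++ labels3)) g (sphere R 3).
Proof.
rewrite -unzip_functionals; eexists.
exact: (polytope_parametrizes_sphere functionals_polytope
  functionals_simplicial).
Qed.

Lemma labels1_embeds : embeds (of_facets labels1) (position 3).
Proof.
have -> : position 3 = @shadow R 3 \o position 4.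
  by apply/funext => k; apply/rowP => i; rewrite !mxE.
have -> : labels1 = unzip1 (take 7 functionals_real).
  by rewrite /unzip1 map_take -/(unzip1 _) unzip_functionals.
apply: (lower_embeds functionals_polytope) => [F|f phi].
  exact: mem_take.
rewrite -map_take => /mapP[[g [l d]] gP [_ ->]]; rewrite mxE /=.
have d0 : 0 < d.
  by have /allP/(_ _ (mem_take gP))/andP[] := supports_check.
rewrite ltr_pdivrMr ?ltr0z// mul0r ltrz0.
have /allP/(_ _ gP)// : all (fun F => nth 0%Z F.2.1 3 < 0) (take 7 functionals).
by vm_compute.
Qed.

Lemma radon_int A B c : radonb A B c ->
  exists r, @radon R _ 3 (position 3) A B r.
Proof.
move=> /and5P[uAB /allP cA /allP cB /eqP c0 /allP cp].
pose coef k := nth 0%Z c (index k (A ++ B)).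
pose r k : R := if k \in A ++ B then (coef k)%:~R else 0.
have sr : supported (A ++ B) r by move=> k kAB; rewrite /r ifN.
have rE k : k \in A ++ B -> r k = (coef k)%:~R by move=> kAB; rewrite /r kAB.
exists r; split=> //.
- by move=> k kA; rewrite rE ?mem_cat ?kA// ltr0z cA.
- by move=> k kB; rewrite rE ?mem_cat ?kB ?orbT// ltrz0 cB.
- rewrite (massE uAB sr) -[RHS]/((0 : int)%:~R) -c0 int_sumE.
  by apply: eq_big_seq => k /rE.
- rewrite (placeE _ uAB sr); apply/rowP => i; rewrite summxE mxE.
  have i3 : (i : nat) \in iota 0 3 by rewrite mem_iota ltn_ord.
  rewrite -[RHS]/((0 : int)%:~R) -(eqP (cp _ i3)) int_sumE.
  by apply: eq_big_seq => k /rE kE; rewrite !mxE kE intrM.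
Qed.

Lemma legal_flat F ms : embeds (of_facets F) (position 3) -> legal F ms ->
  embeds (of_facets (perform F ms)) (position 3) /\
  carrier (of_facets F) (position 3) =
    carrier (of_facets (perform F ms)) (position 3).
Proof.
elim: ms F => [//|[[A B] c] ms IH] F eF /= /and3P[/radon_int[r rad] fl leg].
have [eF' ->] := flip rad fl eF.
exact: IH.
Qed.

Lemma labels10_embeds : embeds (of_facets labels10) (position 3) /\
  carrier (of_facets labels1) (position 3) =
    carrier (of_facets labels10) (position 3).
Proof.
have /andP[leg /same_facets_eq <-] := moves_check.
exact: legal_flat labels1_embeds leg.
Qed.

Lemma labels10'_embeds : embeds (of_facets labels10') (position 3) /\
  carrier (of_facets labels1) (position 3) =
    carrier (of_facets labels10') (position 3).
Proof.
have /andP[leg /same_facets_eq <-] := star_check; have [e ->] := labels10_embeds.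
exact: legal_flat e leg.
Qed.

End Geometry.

(** * The circle *)

Lemma continuous_row (R : realType) (T : topologicalType) (n : nat)
  (f : T -> 'rV[R]_n) : (forall i, continuous (fun x => f x 0 i)) -> continuous f.
Proof.
move=> cf x P [B nB BP].
have : \forall y \near x, forall i : 'I_n, B 0 i (f y 0 i).
  by apply: filter_forall => i; exact: cf (nB 0 i).
by apply: filterS => y By; apply: BP => i j; rewrite ord1.
Qed.

Section Circle.
Variable R : realType.
Implicit Types h x : R.

(** The speed of rotation that makes a third of a turn over the height 7. *)
Definition tau : R := 2 * pi / 21.

Lemma tau_gt0 : 0 < tau.
Proof. by rewrite /tau divr_gt0// mulr_gt0// pi_gt0. Qed.

Lemma tau21 : tau * 21 = pi *+ 2.
Proof. by rewrite /tau divfK ?mulr_natl// pnatr_eq0. Qed.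

Lemma sin_tau7_gt0 : 0 < sin (tau * 7).
Proof.
apply: sin_gt0_pi; have := @pi_gt0 R; have := tau21; rewrite -mulr_natl => e p0.
by apply/andP; split; lra.
Qed.

(** The angle is a third of a turn: its cosine equals that of its double, and
    its sine is not zero. *)
Lemma cos_tau7 : cos (tau * 7) = - 2^-1.
Proof.
have e : cos (tau * 7 + tau * 7) = cos (tau * 7).
  have -> : tau * 7 + tau * 7 = - (tau * 7) + pi *+ 2 by rewrite -tau21; ring.
  by rewrite cosD2pi cosN.
have s0 := sin_tau7_gt0; have := cos2Dsin2 (tau * 7).
move: e; rewrite cosD; move: (cos _) (sin _) s0 => c s s0 e1 e2.
have : (c - 1) * (2 * c + 1) = 0 by nra.
move/eqP; rewrite mulf_eq0 => /orP[/eqP c1|/eqP]; last by lra.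
have ce : c = 1 by lra.
have : s * s = 0 by move: e2; rewrite ce expr1n expr2; lra.
by move/eqP; rewrite mulf_eq0 orbb gt_eqF.
Qed.

Definition sin60 : R := sin (tau * 7).

Lemma sin60_sqr : sin60 * sin60 = 3 / 4.
Proof.
have := cos2Dsin2 (tau * 7); rewrite cos_tau7 -/sin60 !expr2 => e; lra.
Qed.

Lemma cosD7 h :
  cos (tau * (h + 7)) = - 2^-1 * cos (tau * h) - sin60 * sin (tau * h).
Proof. by rewrite mulrDr cosD cos_tau7 -/sin60; ring. Qed.

Lemma sinD7 h :
  sin (tau * (h + 7)) = - 2^-1 * sin (tau * h) + sin60 * cos (tau * h).
Proof. by rewrite mulrDr sinD cos_tau7 -/sin60; ring. Qed.

Lemma sin_eq0_small x : - (2 * pi) < x < 2 * pi -> sin x = 0 ->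
  [\/ x = - pi, x = 0 | x = pi].
Proof.
have pos y : 0 < y < 2 * pi -> sin y = 0 -> y = pi.
  move=> /andP[y0 y2] s0; have [yp|yp|//] := ltgtP y pi.
    by have := sin_gt0_pi (x := y); rewrite y0 yp s0 ltxx => /(_ isT).
  have : 0 < sin (y - pi) by apply: sin_gt0_pi; apply/andP; split; lra.
  by rewrite sinB s0 sinpi mul0r mulr0 subrr ltxx.
move=> /andP[x1 x2] s0; have [xn|xp|->] := ltgtP x 0.
- apply: Or31; apply/eqP; rewrite -eqr_oppLR; apply/eqP; apply: pos.
    by apply/andP; split; lra.
  by rewrite sinN s0 oppr0.
- by apply: Or33; apply: pos => //; rewrite xp.
- exact: Or32.
Qed.

(** The height 7 makes one full turn: tau * 3 is 2 pi / 7. *)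
Definition circle h : 'rV[R]_2 :=
  \row_i (if i == 0 then cos (tau * 3 * h) else sin (tau * 3 * h)).

Lemma circle_sphere h : sphere R 1 (circle h).
Proof.
by rewrite /sphere /= !big_ord_recl big_ord0 addr0 !mxE /= cos2Dsin2.
Qed.

Lemma circleD7 h : circle (h + 7) = circle h.
Proof.
have e : tau * 3 * (h + 7) = tau * 3 * h + pi *+ 2 by rewrite -tau21; ring.
by apply/rowP => i; rewrite !mxE e cosD2pi sinD2pi.
Qed.

Lemma circle_inj h h' : `|h - h'| < 14 -> circle h = circle h' ->
  [\/ h = h', h = h' + 7 | h' = h + 7].
Proof.
move=> small /rowP e; have := e 0; have := e 1; rewrite !mxE /= => es ec.
(* half the difference of the angles: its sine vanishes *)
set x := tau * 3 * (h - h') / 2.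
have p0 := @pi_gt0 R; have t0 := tau_gt0.
have t21 : tau * 21 = 2 * pi by rewrite tau21 mulr_natl.
have sx : sin x = 0.
  have c1 : cos (x + x) = 1.
    rewrite -mulr2n -mulr_natr /x divfK// mulrBr cosB es ec -!expr2.
    exact: cos2Dsin2.
  move: c1; rewrite cosD; have := cos2Dsin2 x.
  move: (cos x) (sin x) => c s e1 e2.
  have : s * s = 0 by rewrite !expr2 in e1; lra.
  by move/eqP; rewrite mulf_eq0 orbb => /eqP.
have xs : - (2 * pi) < x < 2 * pi.
  move: small; rewrite ltr_norml => /andP[s1 s2].
  by rewrite /x -t21; apply/andP; split; nra.
have xE : x = tau * (3 / 2) * (h - h') by rewrite /x; field.
have tN : tau != 0 by rewrite gt_eqF.
have pE : pi = tau * (21 / 2) :> R by lra.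
have canc u v : tau * u = tau * v -> u = v by exact: mulfI.
case: (sin_eq0_small xs sx) => xv.
- have : tau * ((3 / 2) * (h - h')) = tau * (- (21 / 2)).
    by rewrite mulrA -xE xv pE; ring.
  by move/canc => ?; apply: Or33; lra.
- have : tau * ((3 / 2) * (h - h')) = tau * 0 by rewrite mulrA -xE xv mulr0.
  by move/canc => ?; apply: Or31; lra.
- have : tau * ((3 / 2) * (h - h')) = tau * (21 / 2) by rewrite mulrA -xE xv pE.
  by move/canc => ?; apply: Or32; lra.
Qed.

Lemma circle_surj c : sphere R 1 c -> exists2 h, 2 <= h < 9 & circle h = c.
Proof.
rewrite /sphere /= !big_ord_recl big_ord0 addr0 => c1.
set c0 := c 0 0 in c1; set s0 := c 0 (lift ord0 ord0) in c1.
have p0 := @pi_gt0 R; have t0 := tau_gt0.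
have t21 : tau * 21 = 2 * pi by rewrite tau21 mulr_natl.
have cb : -1 <= c0 <= 1 by rewrite !expr2 in c1; apply/andP; split; nra.
have [x xb [xc xs]] : exists2 x, - pi <= x <= pi & cos x = c0 /\ sin x = s0.
  have a0 := acos_ge0 cb; have ap := acos_lepi cb.
  have ac : cos (acos c0) = c0 by apply: acosK; rewrite in_itv.
  have as0 : sin (acos c0) ^+ 2 = s0 ^+ 2 by rewrite sin2cos2 ac; lra.
  have sa : 0 <= sin (acos c0) by apply: sin_ge0_pi; rewrite a0.
  have [sp|sn] := leP 0 s0.
    exists (acos c0); first by apply/andP; split; lra.
    by split=> //; apply/eqP; rewrite -(eqrXn2 (n := 2))// as0.
  exists (- acos c0); first by apply/andP; split; lra.
  split; first by rewrite cosN.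
  rewrite sinN; apply/eqP; rewrite eqr_oppLR -(eqrXn2 (n := 2))// ?oppr_ge0 ?ltW//.
  by rewrite sqrrN as0.
have cE (h : R) : cos (tau * 3 * h) = c0 -> sin (tau * 3 * h) = s0 -> circle h = c.
  move=> hc hs; apply/rowP => i; rewrite mxE hc hs.
  case: ifPn => [/eqP ->//|i0]; congr (c 0 _); apply: val_inj => /=.
  by case: i i0 => [[|[|i]]].
pose h := x / (tau * 3).
have hx : tau * 3 * h = x by rewrite /h mulrC divfK// mulf_neq0// gt_eqF.
have hb : - (7 / 2) <= h <= 7 / 2.
  move: xb; rewrite /h ler_pdivlMr ?ler_pdivrMr ?mulr_gt0// => /andP[xa xb].
  by apply/andP; split; lra.
have [h2|h2] := leP 2 h.
  by exists h; [apply/andP; split; lra|apply: cE; rewrite hx].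
exists (h + 7); first by apply/andP; split; lra.
by rewrite circleD7; apply: cE; rewrite hx.
Qed.

Lemma continuous_circle : continuous circle.
Proof.
have lin (c : R) : continuous (fun h : R => c * h) by move=> h; exact: mulrl_continuous.
apply: continuous_row => i.
under eq_fun do rewrite mxE.
move=> h; case: (i == 0); apply: (@continuous_comp _ _ _ (fun h : R => tau * 3 * h)).
- exact: lin.
- exact: continuous_cos.
- exact: lin.
- exact: continuous_sin.
Qed.

End Circle.

(** * A chart of the product of the sphere and the circle on a prism *)

Section Chart.
Variable R : realType.
Implicit Types (z : 'rV[R]_4) (sg : R).

(** Points of the prism over a triangle: three barycentric coordinates and a
    height. *)
Definition screw z : 'rV[R]_4 :=
  \row_i nth 0 [:: z 0 2; z 0 0; z 0 1; z 0 3 + 7] i.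

(** Cartesian coordinates in the plane of the equilateral triangle whose corners
    are the cube roots of unity. *)
Definition alongside z : R := z 0 0 - (z 0 1 + z 0 2) / 2.
Definition across z : R := sin60 R * (z 0 1 - z 0 2).
(** Up to a factor, the distance to the boundary of the triangle. *)
Definition level z : R := Num.min (z 0 0) (Num.min (z 0 1) (z 0 2)).

(** The roof, or the floor, of the bipyramid over the triangle, turned by the
    angle - tau h at height h to undo the screw motion. *)
Definition bipyramid sg z : 'rV[R]_3 :=
  let c := cos (tau R * z 0 3) in let s := sin (tau R * z 0 3) in
  \row_i nth 0 [:: alongside z * c + across z * s;
                   across z * c - alongside z * s; sg * level z] i.

Definition chart sg z : 'rV[R]_3 * 'rV[R]_2 :=
  (normalize (bipyramid sg z), circle (z 0 3)).

Definition barycentric z :=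
  [/\ 0 <= z 0 0, 0 <= z 0 1, 0 <= z 0 2 & z 0 0 + z 0 1 + z 0 2 = 1].

Lemma screwE z : [/\ screw z 0 0 = z 0 2, screw z 0 1 = z 0 0,
  screw z 0 2 = z 0 1 & screw z 0 3 = z 0 3 + 7].
Proof. by split; rewrite mxE. Qed.

Lemma bipyramidE sg z :
  let c := cos (tau R * z 0 3) in let s := sin (tau R * z 0 3) in
  [/\ bipyramid sg z 0 0 = alongside z * c + across z * s,
      bipyramid sg z 0 1 = across z * c - alongside z * s
    & bipyramid sg z 0 2 = sg * level z].
Proof. by split; rewrite mxE. Qed.

Lemma barycentric_screw z : barycentric z -> barycentric (screw z).
Proof.
move=> [z0 z1 z2 zs]; rewrite /barycentric; have [-> -> -> _] := screwE z.
split=> //.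
by rewrite -zs; ring.
Qed.

Lemma row3P (y y' : 'rV[R]_3) : y 0 0 = y' 0 0 -> y 0 1 = y' 0 1 ->
  y 0 2 = y' 0 2 -> y = y'.
Proof.
move=> e0 e1 e2; apply/rowP => -[[|[|[|//]]] i3].
- by have -> : Ordinal i3 = 0 by apply: val_inj.
- by have -> : Ordinal i3 = 1 by apply: val_inj.
- by have -> : Ordinal i3 = 2 by apply: val_inj.
Qed.

Lemma row4P (y y' : 'rV[R]_4) : y 0 0 = y' 0 0 -> y 0 1 = y' 0 1 ->
  y 0 2 = y' 0 2 -> y 0 3 = y' 0 3 -> y = y'.
Proof.
move=> e0 e1 e2 e3; apply/rowP => -[[|[|[|[|//]]]] i4].
- by have -> : Ordinal i4 = 0 by apply: val_inj.
- by have -> : Ordinal i4 = 1 by apply: val_inj.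
- by have -> : Ordinal i4 = 2 by apply: val_inj.
- by have -> : Ordinal i4 = 3 by apply: val_inj.
Qed.

Lemma chart_screw sg z : chart sg (screw z) = chart sg z.
Proof.
have [s0 s1 s2 s3] := screwE z; rewrite /chart s3 circleD7; congr (normalize _, _).
have [a0 a1 a2] := bipyramidE sg (screw z); have [b0 b1 b2] := bipyramidE sg z.
have q := sin60_sqr R.
apply: row3P.
- rewrite a0 b0 /alongside /across s0 s1 s2 s3 cosD7 sinD7.
  move: (sin60 R) (cos _) (sin _) (z 0 0) (z 0 1) (z 0 2) q => r c s x0 x1 x2 q.
  transitivity ((x2 - (x0 + x1) / 2) * (- 2^-1 * c - r * s)
    - r * (x0 - x1) * s / 2 + r * r * ((x0 - x1) * c)); first by field.
  by rewrite q; field.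
- rewrite a1 b1 /alongside /across s0 s1 s2 s3 cosD7 sinD7.
  move: (sin60 R) (cos _) (sin _) (z 0 0) (z 0 1) (z 0 2) q => r c s x0 x1 x2 q.
  transitivity (- (x2 - (x0 + x1) / 2) * (- 2^-1 * s + r * c)
    - r * (x0 - x1) * c / 2 - r * r * ((x0 - x1) * s)); first by field.
  by rewrite q; field.
- by rewrite a2 b2 /level s0 s1 s2 minC -minA.
Qed.

Lemma barycentricE z : barycentric z ->
  [/\ z 0 0 = 1 / 3 + 2 / 3 * alongside z,
      z 0 1 = 1 / 3 - alongside z / 3 + 2 / 3 * (sin60 R * across z)
    & z 0 2 = 1 / 3 - alongside z / 3 - 2 / 3 * (sin60 R * across z)].
Proof.
move=> [_ _ _ zs]; have q := sin60_sqr R.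
have -> : sin60 R * across z = 3 / 4 * (z 0 1 - z 0 2).
  by rewrite /across mulrA q.
by rewrite /alongside; split; lra.
Qed.

Lemma level_le z : [/\ level z <= z 0 0, level z <= z 0 1 & level z <= z 0 2].
Proof. by rewrite /level !ge_min !lexx !orbT. Qed.

Lemma level_attained z : [\/ level z = z 0 0, level z = z 0 1 | level z = z 0 2].
Proof.
rewrite /level; have [_|_] := leP (z 0 0) (Num.min (z 0 1) (z 0 2)).
  exact: Or31.
by have [_|_] := leP (z 0 1) (z 0 2); [exact: Or32|exact: Or33].
Qed.

Lemma level_ge0 z : barycentric z -> 0 <= level z.
Proof. by move=> [z0 z1 z2 _]; rewrite /level !le_min z0 z1 z2. Qed.

Lemma bipyramid_scale sg t z z' : z 0 3 = z' 0 3 -> sg * sg = 1 ->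
  bipyramid sg z = t *: bipyramid sg z' ->
  [/\ alongside z = t * alongside z', across z = t * across z'
    & level z = t * level z'].
Proof.
move=> h sg1 /rowP e.
have e0 := e 0; have e1 := e 1; have e2 := e 2.
rewrite [RHS]mxE in e0; rewrite [RHS]mxE in e1; rewrite [RHS]mxE in e2.
have [b0 b1 b2] := bipyramidE sg z; have [b0' b1' b2'] := bipyramidE sg z'.
rewrite b0 b0' h in e0; rewrite b1 b1' h in e1; rewrite b2 b2' in e2.
have := cos2Dsin2 (tau R * z' 0 3); rewrite !expr2.
move: (cos _) (sin _) e0 e1 => c s e0 e1 cs.
split.
- rewrite -[LHS]mulr1 -cs -[RHS]mulr1 -cs.
  transitivity (c * (alongside z * c + across z * s)
    - s * (across z * c - alongside z * s)); first by ring.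
  by rewrite e0 e1; ring.
- rewrite -[LHS]mulr1 -cs -[RHS]mulr1 -cs.
  transitivity (s * (alongside z * c + across z * s)
    + c * (across z * c - alongside z * s)); first by ring.
  by rewrite e0 e1; ring.
- by rewrite -[LHS]mul1r -sg1 -mulrA e2 mulrCA [sg * (sg * _)]mulrA sg1 mul1r.
Qed.

Lemma bipyramid_neq0 sg z : sg * sg = 1 -> barycentric z -> bipyramid sg z != 0.
Proof.
move=> sg1 zb; apply/eqP => z0.
have [|a b c] := @bipyramid_scale sg 0 z z erefl sg1.
  by rewrite z0 scaler0.
rewrite !mul0r in a b c.
have [e0 e1 e2] := barycentricE zb; rewrite a b in e0 e1 e2.
by case: (level_attained z) => l; lra.
Qed.

(** The bipyramid is star-shaped: if one of its points is t times another one,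
    compare the level with the smallest barycentric coordinate to get t <= 1,
    and then exchange the points. *)
Lemma chart_inj_height sg z z' : sg * sg = 1 -> barycentric z -> barycentric z' ->
  z 0 3 = z' 0 3 -> chart sg z = chart sg z' -> z = z'.
Proof.
move=> sg1 zb zb' h /(congr1 fst) /= e.
have le u u' t : barycentric u -> barycentric u' ->
    [/\ alongside u = t * alongside u', across u = t * across u'
      & level u = t * level u'] ->
    t <= 1.
  move=> ub ub' [a b l]; have [l0 l1 l2] := level_le u.
  have [e0 e1 e2] := barycentricE ub; have [e0' e1' e2'] := barycentricE ub'.
  rewrite a b in e0 e1 e2.
  case: (level_attained u') => v.
  - have : u 0 0 = 1 / 3 + t * (u' 0 0 - 1 / 3) by rewrite e0 e0'; ring.
    by nra.
  - have : u 0 1 = 1 / 3 + t * (u' 0 1 - 1 / 3) by rewrite e1 e1'; ring.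
    by nra.
  - have : u 0 2 = 1 / 3 + t * (u' 0 2 - 1 / 3) by rewrite e2 e2'; ring.
    by nra.
have [t t0 zt] := normalize_inj (bipyramid_neq0 sg1 zb) (bipyramid_neq0 sg1 zb') e.
have zt' : bipyramid sg z' = t^-1 *: bipyramid sg z.
  by rewrite zt scalerA mulVf ?scale1r// gt_eqF.
have c1 := bipyramid_scale h sg1 zt; have c2 := bipyramid_scale (esym h) sg1 zt'.
have t1 : t = 1.
  apply/le_anti; rewrite (le _ _ _ zb zb' c1) -(invf_le1 t0).
  exact: le zb' zb c2.
case: c1; rewrite t1 !mul1r => a b _.
have [e0 e1 e2] := barycentricE zb; have [e0' e1' e2'] := barycentricE zb'.
by apply: row4P => //; rewrite ?e0 ?e1 ?e2 ?e0' ?e1' ?e2' ?a ?b.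
Qed.

(** Heights with the same image on the circle differ by 0 or 7, and the screw
    motion, which preserves the chart, brings them together. *)
Lemma chart_inj sg z z' : sg * sg = 1 -> barycentric z -> barycentric z' ->
  `|z 0 3 - z' 0 3| < 14 -> chart sg z = chart sg z' ->
  [\/ z = z', z = screw z' | z' = screw z].
Proof.
move=> sg1 zb zb' small e.
have [_ _ _ s3] := screwE z; have [_ _ _ s3'] := screwE z'.
case: (circle_inj small (congr1 snd e)) => h.
- by apply: Or31; apply: (chart_inj_height sg1).
- apply: Or32; apply: (chart_inj_height sg1 zb (barycentric_screw zb')).
    by rewrite s3'.
  by rewrite chart_screw.
- apply: Or33; apply: (chart_inj_height sg1 zb' (barycentric_screw zb)).
    by rewrite s3.
  by rewrite chart_screw.
Qed.

Lemma chart_sphere2x1 sg z : sg * sg = 1 -> barycentric z ->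
  sphere2x1 R (chart sg z).
Proof.
move=> sg1 zb; split; last exact: circle_sphere.
exact/sqnorm_normalize/bipyramid_neq0.
Qed.

Lemma chart_level sg z : sg * sg = 1 -> barycentric z ->
  exists2 t, 0 < t & (chart sg z).1 0 2 = t * (sg * level z).
Proof.
move=> sg1 zb; exists (Num.sqrt (sqnorm (bipyramid sg z)))^-1.
  by rewrite invr_gt0 sqrtr_gt0 sqnorm_gt0 bipyramid_neq0.
by rewrite /= /normalize mxE; have [_ _ ->] := bipyramidE sg z.
Qed.

(** Turn y back by the angle of its height.  The ray through it meets the
    bipyramid where the distance to the plane of the triangle equals the smallest
    barycentric coordinate, a linear equation with one positive solution. *)
Lemma chart_surj sg y c : sg * sg = 1 -> sphere2x1 R (y, c) -> 0 <= sg * y 0 2 ->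
  exists2 z, barycentric z & 2 <= z 0 3 < 9 /\ chart sg z = (y, c).
Proof.
move=> sg1 [/= y1 c1] yl; have [h hb hc] := circle_surj c1.
have cs := cos2Dsin2 (tau R * h); rewrite !expr2 in cs.
set ch := cos _ in cs; set sh := sin _ in cs.
have q := sin60_sqr R; set r := sin60 R in q.
(* the direction of y in the frame of the triangle at height h *)
pose a := y 0 0 * ch - y 0 1 * sh; pose b := y 0 0 * sh + y 0 1 * ch.
pose w := sg * y 0 2; rewrite -/w in yl.
have ab : a * a + b * b + w * w = 1.
  have : y 0 0 * y 0 0 + y 0 1 * y 0 1 + y 0 2 * y 0 2 = 1.
    move: y1; rewrite /sphere /= !big_ord_recl big_ord0 addr0 !expr2.
    have -> : lift ord0 ord0 = 1 :> 'I_3 by apply: val_inj.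
    have -> : lift ord0 (lift ord0 ord0) = 2 :> 'I_3 by apply: val_inj.
    by rewrite addrA.
  move=> <-; rewrite /w mulrACA sg1 mul1r; congr (_ + _).
  transitivity ((y 0 0 * y 0 0 + y 0 1 * y 0 1) * (ch * ch + sh * sh)).
    by rewrite /a /b; ring.
  by rewrite cs mulr1.
(* the variation of the barycentric coordinates in that direction *)
pose u0 := 2 / 3 * a; pose u1 := - (a / 3) + 2 / 3 * (r * b).
pose u2 := - (a / 3) - 2 / 3 * (r * b).
pose m := Num.min u0 (Num.min u1 u2).
have us : u0 + u1 + u2 = 0 by rewrite /u0 /u1 /u2; field.
have [m0 m1 m2] : [/\ m <= u0, m <= u1 & m <= u2].
  by rewrite /m !ge_min !lexx !orbT.
have ma : [\/ m = u0, m = u1 | m = u2].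
  rewrite /m; have [_|_] := leP u0 (Num.min u1 u2); first exact: Or31.
  by have [_|_] := leP u1 u2; [exact: Or32|exact: Or33].
have d0 : 0 < w - m.
  rewrite lt_def subr_ge0; apply/andP; split; last by apply: le_trans yl; lra.
  apply/eqP => wm.
  have w0 : w = 0 by lra.
  have [v0 v1 v2] : [/\ u0 = 0, u1 = 0 & u2 = 0] by split; lra.
  have a0 : a = 0 by rewrite /u0 in v0; lra.
  have rb : r * b = 0 by rewrite /u1 in v1; lra.
  have b0 : b = 0.
    by apply: (mulfI (x := r * r)); [rewrite q; lra|rewrite -mulrA rb !mulr0].
  by move: ab; rewrite a0 b0 w0; lra.
(* solves t w = 1 / 3 + t m: the height of the roof is the smallest coordinate *)
pose t := (3 * (w - m))^-1.
have t0 : 0 < t by rewrite invr_gt0 mulr_gt0.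
have tE : t * (w - m) = 1 / 3.
  by rewrite /t invfM -mulrA mulVf ?gt_eqF// mulr1 mul1r.
pose z : 'rV[R]_4 :=
  \row_i nth 0 [:: 1 / 3 + t * u0; 1 / 3 + t * u1; 1 / 3 + t * u2; h] i.
have [z0 z1 z2 z3] : [/\ z 0 0 = 1 / 3 + t * u0, z 0 1 = 1 / 3 + t * u1,
    z 0 2 = 1 / 3 + t * u2 & z 0 3 = h] by split; rewrite mxE.
have tw : 0 <= t * w by rewrite mulr_ge0// ltW.
have ge v : m <= v -> 0 <= 1 / 3 + t * v.
  move=> mv; have : t * m <= t * v by rewrite ler_pM2l.
  by move: tE tw; rewrite mulrBr; lra.
have zb : barycentric z.
  split; rewrite ?z0 ?z1 ?z2 ?ge//.
  have tu : t * u0 + t * u1 + t * u2 = 0 by rewrite -!mulrDr us mulr0.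
  by lra.
exists z => //; rewrite z3; split=> //.
have za : alongside z = t * a by rewrite /alongside z0 z1 z2 /u0 /u1 /u2; field.
have zc : across z = t * b.
  have -> : across z = t * (4 / 3 * (r * r)) * b.
    by rewrite /across z1 z2 /u1 /u2 -/r; field.
  by rewrite q; field.
have zl : level z = t * w.
  have lv : level z = 1 / 3 + t * m.
    have [l0 l1 l2] := level_le z.
    have up : level z <= 1 / 3 + t * m by case: ma => ->; rewrite -?z0 -?z1 -?z2.
    apply/le_anti; rewrite up /=.
    have lo v : m <= v -> 1 / 3 + t * m <= 1 / 3 + t * v.
      by move=> mv; rewrite lerD2l ler_pM2l.
    by case: (level_attained z) => ->; rewrite ?z0 ?z1 ?z2 lo.
  by rewrite lv -tE mulrBr; ring.
rewrite /chart z3 hc; congr (_, _).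
have -> : bipyramid sg z = t *: y.
  have [b0 b1 b2] := bipyramidE sg z; rewrite z3 -/ch -/sh in b0 b1 b2.
  apply: row3P; rewrite ?b0 ?b1 ?b2 [RHS]mxE ?za ?zc ?zl.
  - transitivity (t * (y 0 0 * (ch * ch + sh * sh))); last by rewrite cs mulr1.
    by rewrite /a /b; ring.
  - transitivity (t * (y 0 1 * (ch * ch + sh * sh))); last by rewrite cs mulr1.
    by rewrite /a /b; ring.
  - by rewrite /w mulrCA [sg * (sg * _)]mulrA sg1 mul1r.
by rewrite normalizeZ// normalize_id.
Qed.

Lemma chart_glue z : barycentric z -> level z = 0 -> chart 1 z = chart (-1) z.
Proof.
move=> zb l0; rewrite /chart; congr (normalize _, _); apply/rowP => i.
by rewrite !mxE l0 !mulr0.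
Qed.

Lemma continuous_bipyramid sg : continuous (bipyramid sg).
Proof.
have mulc (f g : 'rV[R]_4 -> R) : continuous f -> continuous g ->
    continuous (fun z => f z * g z).
  by move=> cf cg z; exact: (cvgM (cf z) (cg z)).
have addc (f g : 'rV[R]_4 -> R) : continuous f -> continuous g ->
    continuous (fun z => f z + g z).
  by move=> cf cg z; exact: (cvgD (cf z) (cg z)).
have subc (f g : 'rV[R]_4 -> R) : continuous f -> continuous g ->
    continuous (fun z => f z - g z).
  by move=> cf cg z; exact: (cvgB (cf z) (cg z)).
have cstc (c : R) : continuous (fun _ : 'rV[R]_4 => c) by exact: cst_continuous.
have cz i : continuous (fun z : 'rV[R]_4 => z 0 i) by exact: coord_continuous.
have cth : continuous (fun z : 'rV[R]_4 => tau R * z 0 3) by apply: mulc.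
have cc : continuous (fun z : 'rV[R]_4 => cos (tau R * z 0 3)).
  move=> z; apply: (@continuous_comp _ _ _ (fun z : 'rV[R]_4 => tau R * z 0 3) cos).
    exact: cth.
  exact: continuous_cos.
have cs : continuous (fun z : 'rV[R]_4 => sin (tau R * z 0 3)).
  move=> z; apply: (@continuous_comp _ _ _ (fun z : 'rV[R]_4 => tau R * z 0 3) sin).
    exact: cth.
  exact: continuous_sin.
have ca : continuous alongside.
  by apply: subc => //; apply: mulc => //; exact: addc.
have cr : continuous across by apply: mulc => //; exact: subc.
have cl : continuous level.
  move=> z; apply: (@continuous_min _ _ (fun z : 'rV[R]_4 => z 0 0)); first exact: cz.
  by apply: continuous_min; exact: cz.
apply: continuous_row => i; case: i => -[|[|[|//]]] i3; under eq_fun do rewrite mxE /=.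
- by apply: addc; exact: mulc.
- by apply: subc; exact: mulc.
- exact: mulc.
Qed.

Lemma continuous_chart sg z : sg * sg = 1 -> barycentric z ->
  {for z, continuous (chart sg)}.
Proof.
move=> sg1 zb.
have cb : {for z, continuous (fun y => normalize (bipyramid sg y))}.
  apply: (@continuous_comp _ _ _ (bipyramid sg) (@normalize R 3)).
    exact: continuous_bipyramid.
  exact/continuous_normalize/bipyramid_neq0.
have cc : {for z, continuous (fun y : 'rV[R]_4 => circle (y 0 3))}.
  apply: (@continuous_comp _ _ _ (fun z : 'rV[R]_4 => z 0 3) (@circle R)).
    exact: coord_continuous.
  exact: continuous_circle.
exact: (cvg_pair cb cc).
Qed.

End Chart.

(** * Unrolling the solid torus T_1 *)

Definition window (k : nat) : seq nat :=
  [seq (k + j) %% 7 | j <- iota 0 4]%N.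

(** The representative of v modulo 7 among k, ..., k + 6. *)
Definition lift_label (k v : nat) : nat := (k + (v + 6 * k) %% 7)%N.

Lemma lift_labelE k d j : (d <= 3)%N -> (d <= j)%N -> (j <= d + 3)%N ->
  lift_label (k + d) ((k + j) %% 7) = (k + j)%N.
Proof.
move=> d3 dj jd; rewrite /lift_label modnDml.
have -> : (k + j + 6 * (k + d) = (k + d) * 7 + (j - d))%N by lia.
rewrite modnMDl modn_small; lia.
Qed.

Lemma notin_window k d j :
  (d <= 3)%N -> (j < 7)%N -> ~~ ((d <= j) && (j <= d + 3))%N ->
  ((k + j) %% 7)%N \notin window (k + d).
Proof.
move=> d3 j7 jd; apply/mapP => -[i]; rewrite mem_iota add0n => /andP[_ i4] /eqP.
rewrite -addnA eqn_modDl; apply/negP.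
case: d d3 jd => [|[|[|[|//]]]] _; case: j j7 => [|[|[|[|[|[|[|//]]]]]]] _ //;
  by case: i i4 => [|[|[|[|//]]]].
Qed.

Lemma windowD7 k : window (k + 7) = window k.
Proof. by apply: eq_map => j; rewrite addnAC modnDr. Qed.

Lemma lift_labelD7 k v : lift_label (k + 7) v = (lift_label k v + 7)%N.
Proof.
rewrite /lift_label (_ : v + 6 * (k + 7) = 6 * 7 + (v + 6 * k))%N; last by lia.
by rewrite modnMDl; lia.
Qed.

(** Two windows lift their common labels alike, or one lift is the other moved by
    7: this is what makes the unrolling well defined up to the screw motion. *)
Lemma lifts_compatible : all (fun k => all (fun l =>
    let common := [seq v <- window k | v \in window l] in
    [|| all (fun v => lift_label k v == lift_label l v) common,
        all (fun v => lift_label l v == lift_label k v + 7)%N common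
      | all (fun v => lift_label k v == lift_label l v + 7)%N common])
  (iota 0 7)) (iota 0 7).
Proof. by vm_compute. Qed.

Section Helix.
Variable R : realType.
Implicit Types (a b : {ptws nat -> R}) (sg : R).

(** Consecutive integers climb around the prism, one unit of height at a time. *)
Definition helix (m : nat) : 'rV[R]_4 :=
  \row_i nth 0 [:: (m %% 3 == 0)%:R; (m %% 3 == 1)%:R; (m %% 3 == 2)%:R; m%:R]%N i.

Definition unroll k (a : nat -> R) : 'rV[R]_4 := place (helix \o lift_label k) a.

Lemma window_uniq k : uniq (window k).
Proof.
rewrite map_inj_in_uniq ?iota_uniq// => i j.
rewrite !mem_iota !add0n => /andP[_ i4] /andP[_ j4] /eqP.
by rewrite eqn_modDl !modn_small ?(ltn_trans i4, ltn_trans j4)// => /eqP.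
Qed.

Lemma cyclic_uniq k : uniq [seq (k + j) %% 7 | j <- iota 0 7]%N.
Proof.
rewrite map_inj_in_uniq ?iota_uniq// => i j.
rewrite !mem_iota !add0n => /andP[_ i7] /andP[_ j7] /eqP.
by rewrite eqn_modDl !modn_small// => /eqP.
Qed.

(** Any two windows that can meet are within seven consecutive integers, where
    both unrollings are given by the same formula. *)
Lemma unrollE k d a : (d <= 3)%N -> supported (window (k + d)) a ->
  unroll (k + d) a = \sum_(j < 7) a ((k + j) %% 7)%N *: helix (k + j).
Proof.
move=> d3 sa; pose t := [seq (k + j) %% 7 | j <- iota 0 7]%N.
have ut : uniq t by exact: cyclic_uniq.
have st : supported t a.
  apply: supportedS sa => v /mapP[i]; rewrite mem_iota => /andP[_ i4] ->.
  apply/mapP; exists ((d + i) %% 7)%N; first by rewrite mem_iota ltn_mod.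
  by rewrite -addnA modnDmr.
rewrite /unroll (placeE _ ut st) big_map -[iota 0 7]/(index_iota 0 7) big_mkord.
apply: eq_bigr => j _; case: (boolP ((d <= j) && (j <= d + 3))%N) => [/andP[dj jd]|jd].
  by rewrite /= lift_labelE.
by rewrite sa ?scale0r// notin_window.
Qed.

Lemma helixE m : [/\ helix m 0 0 = (m %% 3 == 0)%N%:R,
  helix m 0 1 = (m %% 3 == 1)%N%:R, helix m 0 2 = (m %% 3 == 2)%N%:R
  & helix m 0 3 = m%:R].
Proof. by split; rewrite mxE. Qed.

Lemma helix_height m : helix m 0 3 = m%:R.
Proof. by rewrite mxE. Qed.

(** The residue class modulo 3 and the height are coordinates on the helix, so
    that an affine relation preserves the weight of each class and the height. *)
Lemma helix_residues k (c c' : 'I_7 -> R) :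
  \sum_(j < 7) c j *: helix (k + j) = \sum_(j < 7) c' j *: helix (k + j) ->
  [/\ forall r, (r < 3)%N -> \sum_(j < 7 | (j %% 3 == r)%N) c j =
                             \sum_(j < 7 | (j %% 3 == r)%N) c' j
    & \sum_(j < 7) c j * j%:R = \sum_(j < 7) c' j * j%:R].
Proof.
move=> /rowP e.
have coord (d : 'I_7 -> R) i : (\sum_(j < 7) d j *: helix (k + j)) 0 i
    = \sum_(j < 7) d j * helix (k + j) 0 i.
  by rewrite summxE; apply: eq_bigr => j _; rewrite mxE.
have res (r : nat) : (r < 3)%N ->
    \sum_(j < 7 | (j %% 3 == r)%N) c j = \sum_(j < 7 | (j %% 3 == r)%N) c' j.
  move=> r3; pose i : 'I_4 := inord ((k + r) %% 3).
  have iE : i = ((k + r) %% 3)%N :> nat by rewrite inordK// ltnS ltnW// ltn_mod.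
  have rE (d : 'I_7 -> R) : \sum_(j < 7 | (j %% 3 == r)%N) d j
      = (\sum_(j < 7) d j *: helix (k + j)) 0 i.
    rewrite coord big_mkcond; apply: eq_bigr => j _.
    have -> : helix (k + j) 0 i = (j %% 3 == r)%N%:R.
      rewrite mxE iE; transitivity (((k + j) %% 3 == (k + r) %% 3)%N%:R : R).
        by case: (_ %% _)%N (ltn_pmod (k + r) (isT : 0 < 3)%N) => [|[|[|//]]].
      by rewrite eqn_modDl (modn_small r3).
    by case: eqP => _; rewrite ?mulr1 ?mulr0.
  by rewrite !rE e.
split=> //.
(* the total weights agree, so that the height k of the bottom cancels *)
have tot (d : 'I_7 -> R) : \sum_(j < 7) d j = \sum_(j < 7 | (j %% 3 == 0)%N) d j
    + \sum_(j < 7 | (j %% 3 == 1)%N) d j + \sum_(j < 7 | (j %% 3 == 2)%N) d j.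
  by rewrite !(big_mkcond (fun j : 'I_7 => _ == _)) !big_ord_recl !big_ord0 /=; ring.
have hE (d : 'I_7 -> R) : (\sum_(j < 7) d j *: helix (k + j)) 0 3
    = k%:R * \sum_(j < 7) d j + \sum_(j < 7) d j * j%:R.
  rewrite coord mulr_sumr -big_split; apply: eq_bigr => j _ /=.
  by rewrite helix_height natrD mulrDr mulrC.
have := e 3; rewrite !hE !tot !res// => /addrI; exact.
Qed.

Lemma mass_cyclic k a : supported (window k) a ->
  mass a = \sum_(j < 7) a ((k + j) %% 7)%N.
Proof.
move=> sa; rewrite (massE (cyclic_uniq k)) ?big_map -?[iota 0 7]/(index_iota 0 7) ?big_mkord//.
apply: supportedS sa => v /mapP[i]; rewrite mem_iota => /andP[_ i4] ->.
by apply/mapP; exists i => //; rewrite mem_iota (leq_trans i4).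
Qed.

Lemma unroll_height k a : (forall v, 0 <= a v) -> mass a = 1 ->
  supported (window k) a -> k%:R <= unroll k a 0 3 <= k%:R + 3.
Proof.
move=> a0 a1 sa; rewrite -[k in unroll k]addn0 unrollE ?addn0//.
have m1 : \sum_(j < 7) a ((k + j) %% 7)%N = 1 by rewrite -mass_cyclic.
rewrite summxE; under eq_bigr do rewrite mxE helix_height.
have cst (c : R) : c = \sum_(j < 7) c * a ((k + j) %% 7)%N.
  by rewrite -mulr_sumr m1 mulr1.
rewrite [X in _ <= X + 3]cst [X in X <= _]cst [X in _ + X]cst -big_split /=.
apply/andP; split; apply: ler_sum => j _; rewrite natrD mulrDr [_ * k%:R]mulrC.
  by rewrite lerDl mulr_ge0.
rewrite lerD2l mulrC.
case: (leqP j 3) => j3; first by rewrite ler_wpM2r// ler_nat.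
have /notin_window : ~~ ((0 <= j) && (j <= 0 + 3))%N by rewrite leq0n add0n -ltnNge.
by move=> /(_ k isT (ltn_ord j)); rewrite addn0 => /sa ->; rewrite !mulr0.
Qed.

(** Windows at distance more than 3 unroll to disjoint heights.  For the others,
    the four linear equations of [helix_residues] and the signs of the
    coordinates force equality: the tetrahedra of the helix meet in common
    faces. *)
Lemma unroll_inj_le k l a b : (k <= l)%N ->
  (forall v, 0 <= a v) -> mass a = 1 -> supported (window k) a ->
  (forall v, 0 <= b v) -> mass b = 1 -> supported (window l) b ->
  unroll k a = unroll l b -> a = b.
Proof.
move=> kl a0 a1 sa b0 b1 sb e.
have d3 : (l - k <= 3)%N.
  have /andP[_ h1] := unroll_height a0 a1 sa.
  have /andP[h2 _] := unroll_height b0 b1 sb.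
  by rewrite leq_subLR -(ler_nat R) natrD (le_trans h2)// -e.
rewrite -(subnKC kl) in sb e.
(* both points in terms of the labels k, ..., k + 6 *)
move: (l - k)%N d3 sb e => d d3 sb; rewrite -{1}[k]addn0 unrollE ?addn0// unrollE//.
move=> /helix_residues[res hgt].
have za j : (3 < j < 7)%N -> a ((k + j) %% 7)%N = 0.
  move=> /andP[j3 j7]; apply: sa; rewrite -[k in window k]addn0.
  by rewrite notin_window// leq0n add0n -ltnNge.
have zb j : (j < 7)%N -> ~~ ((d <= j) && (j <= d + 3))%N ->
    b ((k + j) %% 7)%N = 0.
  by move=> j7 jd; apply: sb; exact: notin_window.
have := (res 0%N isT, res 1%N isT, res 2%N isT).
move: hgt; rewrite !(big_mkcond (fun j : 'I_7 => _ == _)) !big_ord_recl !big_ord0 /=.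
rewrite /bump /= !add1n !addn0 => hgt [[r0 r1] r2].
have a4 := za 4%N isT; have a5 := za 5%N isT; have a6 := za 6%N isT.
suff ab j : (j < 7)%N -> a ((k + j) %% 7)%N = b ((k + j) %% 7)%N.
  apply/funext => v; case: (ltnP v 7) => [v7|v7].
    have <- : ((k + (v + 6 * k) %% 7) %% 7 = v)%N.
      rewrite modnDmr (_ : k + (v + 6 * k) = k * 7 + v)%N; last by lia.
      by rewrite modnMDl modn_small.
    by apply: ab; rewrite ltn_mod.
  have out m : v \notin window m.
    by apply/mapP => -[i _ vi]; move: v7; rewrite vi leqNgt ltn_mod.
  by rewrite sa ?sb.
have pos (c : nat -> R) : (forall v, 0 <= c v) -> [/\ 0 <= c (k %% 7)%N,
    0 <= c ((k + 1) %% 7)%N, 0 <= c ((k + 2) %% 7)%N & 0 <= c ((k + 3) %% 7)%N].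
  by move=> c0; split.
have [p0 p1 p2 p3] := pos a a0; have [q0 q1 q2 q3] := pos b b0.
have q4 := b0 ((k + 4) %% 7)%N; have q5 := b0 ((k + 5) %% 7)%N.
have q6 := b0 ((k + 6) %% 7)%N.
case: d d3 {sb} zb => [|[|[|[|//]]]] _ zb.
- have b4 := zb 4%N isT isT; have b5 := zb 5%N isT isT; have b6 := zb 6%N isT isT.
  by case: j => [|[|[|[|[|[|[|//]]]]]]] _; rewrite ?addn0; lra.
- have b0' := zb 0%N isT isT; have b5 := zb 5%N isT isT; have b6 := zb 6%N isT isT.
  rewrite addn0 in b0'.
  by case: j => [|[|[|[|[|[|[|//]]]]]]] _; rewrite ?addn0; lra.
- have b0' := zb 0%N isT isT; have b1' := zb 1%N isT isT; have b6 := zb 6%N isT isT.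
  rewrite addn0 in b0'.
  by case: j => [|[|[|[|[|[|[|//]]]]]]] _; rewrite ?addn0; lra.
- have b0' := zb 0%N isT isT; have b1' := zb 1%N isT isT; have b2 := zb 2%N isT isT.
  rewrite addn0 in b0'.
  by case: j => [|[|[|[|[|[|[|//]]]]]]] _; rewrite ?addn0; lra.
Qed.

Lemma unroll_inj k l a b :
  (forall v, 0 <= a v) -> mass a = 1 -> supported (window k) a ->
  (forall v, 0 <= b v) -> mass b = 1 -> supported (window l) b ->
  unroll k a = unroll l b -> a = b.
Proof.
move=> a0 a1 sa b0 b1 sb e; have [kl|/ltnW lk] := leqP k l.
  exact: (unroll_inj_le kl).
exact/esym/(unroll_inj_le lk).
Qed.

Lemma unroll_comb (t : seq nat) k a i : uniq t -> supported t a ->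
  unroll k a 0 i = \sum_(v <- t) a v * helix (lift_label k v) 0 i.
Proof.
move=> ut sa; rewrite /unroll (placeE _ ut sa) summxE.
by apply: eq_bigr => v _; rewrite mxE.
Qed.

Lemma helix_screw m : helix (m + 7) = screw (helix m).
Proof.
have e : ((m + 7) %% 3 = (m %% 3 + 1) %% 3)%N.
  by rewrite modnDml (_ : m + 7 = 2 * 3 + (m + 1))%N ?modnMDl//; lia.
apply: row4P; rewrite !mxE /= ?natrD// e;
  by case: (m %% 3)%N (ltn_pmod m (isT : 0 < 3)%N) => [|[|[|]]].
Qed.

Lemma screw_place (t : seq nat) (q : nat -> nat) a :
  uniq t -> supported t a -> mass a = 1 ->
  screw (place (helix \o q) a) = place (fun v => helix (q v + 7)) a.
Proof.
move=> ut sa; rewrite (massE ut sa) !(placeE _ ut sa) => a1.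
have [s0 s1 s2 s3] := screwE (\sum_(v <- t) a v *: (helix \o q) v).
have coord i : (\sum_(v <- t) a v *: (helix \o q) v) 0 i
    = \sum_(v <- t) a v * helix (q v) 0 i.
  by rewrite summxE; apply: eq_bigr => v _; rewrite mxE.
apply: row4P; rewrite ?s0 ?s1 ?s2 ?s3 coord summxE.
- apply: eq_bigr => v _; rewrite [RHS]mxE helix_screw.
  by have [-> _ _ _] := screwE (helix (q v)).
- apply: eq_bigr => v _; rewrite [RHS]mxE helix_screw.
  by have [_ -> _ _] := screwE (helix (q v)).
- apply: eq_bigr => v _; rewrite [RHS]mxE helix_screw.
  by have [_ _ -> _] := screwE (helix (q v)).
- have {1}-> : 7 = \sum_(v <- t) a v * 7 by rewrite -mulr_suml a1 mul1r.
  rewrite -big_split; apply: eq_bigr => v _ /=.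
  rewrite [RHS]mxE helix_screw; have [_ _ _ ->] := screwE (helix (q v)).
  by ring.
Qed.

Lemma unroll_barycentric k a : (forall v, 0 <= a v) -> mass a = 1 ->
  supported (window k) a -> barycentric (unroll k a).
Proof.
move=> a0 a1 sa; have uw := window_uniq k.
rewrite /barycentric !(unroll_comb _ _ uw sa).
split; try by apply: sumr_ge0 => v _; rewrite mulr_ge0// mxE /= ler0n.
rewrite -a1 (massE uw sa) -!big_split; apply: eq_bigr => v _ /=.
have [-> -> -> _] := helixE (lift_label k v).
rewrite -!mulrDr; move: (lift_label k v) => m.
by case: (m %% 3)%N (ltn_pmod m (isT : 0 < 3)%N) => [|[|[|]]]//= _;
  rewrite ?addr0 ?add0r mulr1.
Qed.

(** The tetrahedra of the helix fill the prism.  The vertical line over x enters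
    the window k through the triangle k, k+1, k+2 and leaves it through
    k+1, k+2, k+3.  The heights from 2 on lie above the bottom triangle 0, 1, 2,
    and an interval of length 7 is all that the circle needs. *)
Lemma unroll_surj z : barycentric z -> 2 <= z 0 3 < 9 ->
  exists k a, [/\ forall v, 0 <= a v, mass a = 1, supported (window k) a
    & unroll k a = z].
Proof.
move=> [z0 z1 z2 zs] /andP[h2 h9].
pose x (m : nat) : R := nth 0 [:: z 0 0; z 0 1; z 0 2] (m %% 3).
have x3 m : x (m + 3)%N = x m by rewrite /x modnDr.
have x_ge0 m : 0 <= x m.
  by rewrite /x; case: (m %% 3)%N (ltn_pmod m (isT : 0 < 3)%N) => [|[|[|]]].
(* the height at which the line over x enters the window k *)
pose bot (k : nat) := x k * k%:R + x k.+1 * k.+1%:R + x k.+2 * k.+2%:R.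
have botS k : bot k.+1 = bot k + 3 * x k.
  by rewrite /bot -[k.+3]addn3 x3 natrD; ring.
have [k [lo hi]] : exists k, bot k <= z 0 3 /\ z 0 3 <= bot k.+1.
  have b0 : bot 0%N <= z 0 3 by rewrite /bot /x /=; lra.
  have b9 : z 0 3 <= bot 9%N.
    rewrite /bot -[9%N]/(0 + 3 + 3 + 3)%N !x3 -[10%N]/(1 + 3 + 3 + 3)%N !x3.
    by rewrite -[11%N]/(2 + 3 + 3 + 3)%N !x3 /x /=; lra.
  have : forall n, z 0 3 <= bot n -> exists k, bot k <= z 0 3 /\ z 0 3 <= bot k.+1.
    elim=> [|n IH] bn.
      by exists 0%N; split=> //; rewrite botS; have := x_ge0 0%N; lra.
    by have [le|/ltW ge] := leP (bot n) (z 0 3); [exists n|exact: IH].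
  by move=> /(_ _ b9).
(* moving the weight t from k to k + 3 raises the point by 3 t *)
pose t := (z 0 3 - bot k) / 3.
have t0 : 0 <= t by rewrite divr_ge0// subr_ge0.
have tx : t <= x k by rewrite botS in hi; rewrite /t ler_pdivrMr//; lra.
pose c (j : nat) := nth 0 [:: x k - t; x k.+1; x k.+2; t] j.
pose a (v : nat) := \sum_(j < 7) c j * (v == (k + j) %% 7)%N%:R.
have aE (j : 'I_7) : a ((k + j) %% 7)%N = c j.
  rewrite /a (bigD1 j)//= eqxx mulr1 big1 ?addr0// => i ij.
  rewrite eqn_modDl !modn_small// [_ == _]eq_sym.
  by rewrite (inj_eq val_inj) (negbTE ij) mulr0.
have sa : supported (window k) a.
  move=> v vk; rewrite /a big1// => j _; case: eqP => [vj|]; last by rewrite mulr0.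
  have [j4|j4] := ltnP j 4; last by rewrite /c nth_default ?mul0r.
  by case/negP: vk; rewrite vj; apply/mapP; exists (j : nat); rewrite ?mem_iota.
have sum7 (d : 'I_7 -> R) : \sum_(j < 7) c j * d j
    = (x k - t) * d 0 + x k.+1 * d 1 + x k.+2 * d 2 + t * d 3.
  rewrite !big_ord_recl big_ord0 /c /= !mul0r !addr0 !addrA.
  by congr (_ * d _ + _ * d _ + _ * d _ + _ * d _); apply: val_inj.
have xsum : x k + x k.+1 + x k.+2 = 1.
  rewrite -zs /x -[k.+2]addn2 -[k.+1]addn1 -modnDml -[((k + 2) %% 3)%N]modnDml.
  by case: (k %% 3)%N (ltn_pmod k (isT : 0 < 3)%N) => [|[|[|]]]//= _; ring.
exists k, a; split=> //.
- move=> v; apply: sumr_ge0 => j _; rewrite mulr_ge0// /c.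
  by case: j => -[|[|[|[|j]]]] j7 //=; rewrite ?subr_ge0// nth_nil.
- rewrite (mass_cyclic sa); under eq_bigr do rewrite aE -[c _]mulr1.
  by rewrite (sum7 (fun=> 1)) !mulr1; lra.
- rewrite -[k in unroll k]addn0 unrollE ?addn0//; under eq_bigr do rewrite aE.
  have coord i : (\sum_(j < 7) c j *: helix (k + j)) 0 i
      = (x k - t) * helix k 0 i + x k.+1 * helix (k + 1) 0 i
        + x k.+2 * helix (k + 2) 0 i + t * helix (k + 3) 0 i.
    rewrite summxE -[k in helix k]addn0 -(sum7 (fun j => helix (k + j) 0 i)).
    by apply: eq_bigr => j _; rewrite mxE.
  apply: row4P; rewrite coord !mxE /=; last first.
    rewrite !natrD; have : 3 * t = z 0 3 - bot k by rewrite /t mulrC divfK.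
    have : x k * k%:R + x k.+1 * k%:R + x k.+2 * k%:R = k%:R.
      by rewrite -!mulrDl xsum mul1r.
    by rewrite /bot -[k.+2]addn2 -[k.+1]addn1 !natrD; lra.
  all: rewrite /x -[k.+2]addn2 -[k.+1]addn1 modnDr -[((k + 1) %% 3)%N]modnDml
    -[((k + 2) %% 3)%N]modnDml.
  all: by case: (k %% 3)%N (ltn_pmod k (isT : 0 < 3)%N) => [|[|[|]]]//= _; ring.
Qed.

End Helix.

(** * The solid torus as half of the product *)

Definition torus_labels : seq (seq nat) :=
  [:: [:: 0; 1; 3]; [:: 1; 2; 4]; [:: 2; 3; 5]; [:: 3; 4; 6]; [:: 0; 4; 5];
      [:: 1; 5; 6]; [:: 0; 2; 6]; [:: 0; 2; 3]; [:: 1; 3; 4]; [:: 2; 4; 5];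
      [:: 3; 5; 6]; [:: 0; 4; 6]; [:: 0; 1; 5]; [:: 1; 2; 6]]%N.

Lemma labels1_windows : same_facets labels1 [seq window k | k <- iota 0 7].
Proof. by vm_compute. Qed.

(** In each window, the faces of the torus are those whose lift misses a
    residue modulo 3, that is, those on a side of the prism. *)
Lemma torus_windows :
  all (fun k => all (fun f => has (fun r =>
    all (fun v => lift_label k v %% 3 != r)%N [seq v <- window k | v \in f])
    (iota 0 3)) torus_labels) (iota 0 7)
  && all (fun k => all (fun r =>
    has (sub_seq [seq v <- window k | lift_label k v %% 3 != r]%N) torus_labels)
    (iota 0 3)) (iota 0 7).
Proof. by vm_compute. Qed.

Lemma withinU_seq (T U : topologicalType) (I : choiceType) (s : seq I)
  (C : I -> set T) (f : T -> U) : (forall i, closed (C i)) ->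
  (forall i, i \in s -> {within C i, continuous f}) ->
  {within [set x | exists2 i, i \in s & C i x], continuous f}.
Proof.
move=> cC; elim: s => [|i s IH] cf.
  rewrite (_ : [set x | _] = set0); first exact: continuous_subspace0.
  by apply/seteqP; split=> // x [].
have cl : closed [set x | exists2 j, j \in s & C j x].
  rewrite (_ : [set x | _] = \bigcup_(j in [set` s]) C j); last first.
    by apply/seteqP; split=> x [j js Cj]; exists j.
  by apply: closed_bigcup => [|j _]; [exact: finite_seq|exact: cC].
rewrite (_ : [set x | _] = C i `|` [set x | exists2 j, j \in s & C j x]); last first.
  apply/seteqP; split=> [x [j + Cj]|x [Ci|[j js Cj]]].
  - by rewrite inE => /orP[/eqP <-|js]; [left|right; exists j].
  - by exists i => //; rewrite mem_head.
  - by exists j => //; rewrite inE js orbT.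
apply: withinU_continuous => //; first by apply: cf; rewrite mem_head.
by apply: IH => j js; apply: cf; rewrite inE js orbT.
Qed.

Section Solid.
Variable R : realType.
Implicit Types (a b : {ptws nat -> R}) (sg : R).

Lemma points_labels1P a : points (of_facets labels1) a <->
  [/\ forall v, 0 <= a v, mass a = 1
    & exists2 k, (k < 7)%N & supported (window k) a].
Proof.
rewrite (same_facets_eq labels1_windows).
split=> [/points_of_facetsP[a0 a1 [_ /mapP[k k7 ->] sa]]|[a0 a1 [k k7 sa]]].
  by split=> //; exists k => //; rewrite mem_iota in k7.
apply/points_of_facetsP; split=> //; exists (window k) => //.
by rewrite map_f// mem_iota.
Qed.

Definition window_of (a : nat -> R) : nat :=
  find (fun k => `[< supported (window k) a >]) (iota 0 7).

(** Any facet containing a serves to unroll it; by [solidE] the choice does not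
    matter. *)
Definition solid sg a := chart sg (unroll (window_of a) a).

Lemma window_ofP a : points (of_facets labels1) a ->
  (window_of a < 7)%N /\ supported (window (window_of a)) a.
Proof.
move=> /points_labels1P[_ _ [k k7 sa]].
have h : has (fun k => `[< supported (window k) a >]) (iota 0 7).
  by apply/hasP; exists k; [rewrite mem_iota|exact/asboolP].
have w7 : (window_of a < 7)%N by move: h; rewrite has_find size_iota.
split=> //; have := nth_find 0%N h; rewrite -/(window_of a) nth_iota// => /asboolP.
by rewrite add0n.
Qed.

Lemma unroll_screw (t : seq nat) k l a : uniq t -> supported t a -> mass a = 1 ->
  (forall v, v \in t -> lift_label l v = lift_label k v + 7)%N ->
  unroll l a = screw (unroll k a).
Proof.
move=> ut st a1 lk; rewrite (screw_place _ ut st a1).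
by apply: place_eq ut st _ => v vt; rewrite /= lk.
Qed.

Lemma solidE sg k a : points (of_facets labels1) a -> supported (window k) a ->
  solid sg a = chart sg (unroll k a).
Proof.
move=> aP; have [w7 sw] := window_ofP aP.
have [a0 a1 _] := (points_labels1P a).1 aP.
elim/ltn_ind: k => k IH sk; have [k7|k7] := ltnP k 7; last first.
  have e : (k - 7 + 7 = k)%N by rewrite subnK.
  have sk' : supported (window (k - 7)) a by rewrite -windowD7 e.
  rewrite (IH (k - 7)%N)//; last by rewrite ltn_subrL (leq_trans _ k7).
  rewrite -chart_screw -(unroll_screw (l := k) (window_uniq _) sk' a1)// => v _.
  by rewrite -lift_labelD7 e.
rewrite /solid; move: (window_of a) w7 sw => l l7 sl.
pose t := [seq v <- window k | v \in window l].
have ut : uniq t by rewrite filter_uniq// window_uniq.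
have st : supported t a.
  by move=> v; rewrite mem_filter negb_and => /orP[/sl|/sk].
have /allP/(_ k) := lifts_compatible; rewrite mem_iota k7 => /(_ isT)/allP/(_ l).
rewrite mem_iota l7 => /(_ isT)/or3P[] /allP h.
- congr chart; apply: place_eq ut st _ => v /h /eqP /= ->.
  by [].
- by rewrite (unroll_screw (k := k) (l := l) ut st a1) ?chart_screw// => v /h/eqP.
- rewrite (unroll_screw (k := l) (l := k) ut st a1) ?chart_screw// => v vt.
  by apply/eqP/h; move: vt; rewrite !mem_filter andbC.
Qed.

Lemma solid_barycentric k a : points (of_facets labels1) a ->
  supported (window k) a -> barycentric (unroll k a).
Proof. by move=> /points_labels1P[a0 a1 _]; exact: unroll_barycentric. Qed.

(** By [torus_windows], lying on the torus means that the coordinates vanish on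
    all vertices of the window above one corner of the triangle. *)
Lemma torus_level k a : points (of_facets labels1) a ->
  supported (window k) a -> (k < 7)%N ->
  points (of_facets torus_labels) a <-> level (unroll k a) = 0.
Proof.
move=> aP sa k7; have [a0 a1 _] := (points_labels1P a).1 aP.
have [/allP tw /allP wt] := andP torus_windows.
have k7' : k \in iota 0 7 by rewrite mem_iota.
pose q r := \sum_(v <- window k) a v * (lift_label k v %% 3 == r)%N%:R.
have [e0 e1 e2] : [/\ unroll k a 0 0 = q 0%N, unroll k a 0 1 = q 1%N
    & unroll k a 0 2 = q 2%N].
  by split; rewrite (unroll_comb _ _ (window_uniq k) sa);
    apply: eq_bigr => v _; rewrite mxE.
have lv : level (unroll k a) = 0 <-> exists2 r, (r < 3)%N & q r = 0.
  have zb := solid_barycentric aP sa; have l0 := level_ge0 zb.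
  have [u0 u1 u2] := level_le (unroll k a).
  split=> [l|[[|[|[|//]]] _ qr]].
  - by have [] := level_attained (unroll k a); rewrite l ?e0 ?e1 ?e2 => qr;
      [exists 0%N|exists 1%N|exists 2%N].
  - by apply/le_anti; rewrite l0 andbT -qr -e0.
  - by apply/le_anti; rewrite l0 andbT -qr -e1.
  - by apply/le_anti; rewrite l0 andbT -qr -e2.
rewrite lv; split=> [/points_of_facetsP[_ _ [f fT fa]]|[r r3 qr]].
  have /allP/(_ f fT)/hasP[r r3 /allP fr] := tw k k7'.
  exists r; first by rewrite mem_iota in r3.
  rewrite /q big_seq big1// => v vk.
  have [vf|/fa ->] := boolP (v \in f); last by rewrite mul0r.
  have : (lift_label k v %% 3 != r)%N by apply: fr; rewrite mem_filter vf.
  by move=> /negbTE ->; rewrite mulr0.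
have /allP/(_ r) := wt k k7'.
rewrite mem_iota => /(_ r3)/hasP[f fT /sub_seqP vf].
apply/points_of_facetsP; split=> //; exists f => // v vnf.
have [vk|/sa//] := boolP (v \in window k).
have vr : (lift_label k v %% 3 == r)%N.
  by apply: contraNT vnf => vr; apply: vf; rewrite mem_filter vr.
move/eqP: qr; rewrite /q psumr_eq0; last by move=> w _; rewrite mulr_ge0.
by move=> /allP/(_ _ vk) /=; rewrite vr mulr1 => /eqP.
Qed.

(** The part of S^2 x S^1 over the closed hemisphere on the side of sg. *)
Definition half_product sg : set ('rV[R]_3 * 'rV[R]_2) :=
  [set y | sphere2x1 R y /\ 0 <= sg * y.1 0 2].

(** Continuity holds on each of the seven tetrahedra, where the unrolling is
    affine.  A coincidence in the product comes from points of the prism that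
    differ by a screw motion, and moving a window by 7 is a screw motion. *)
Lemma solid_parametrizes sg : sg * sg = 1 ->
  parametrizes (of_facets labels1) (solid sg) (half_product sg).
Proof.
move=> sg1; split.
- have -> : points (of_facets labels1) = [set a | exists2 k, k \in iota 0 7 &
      ([set a | supported (window k) a] `&` points (of_facets labels1)) a]
      :> set {ptws nat -> R}.
    apply/seteqP; split=> [a aP|a [k _ []]//].
    have [w7 sw] := window_ofP aP.
    by exists (window_of a) => //; rewrite mem_iota.
  apply: withinU_seq => [k|k _].
    by apply: closedI; [exact: closed_supported|exact: closed_points].
  pose W := [set a : {ptws nat -> R} | supported (window k) a] `&`
    points (of_facets labels1).
  apply: (@subspace_eq_continuous _ W _ (chart sg \o unroll k)).
    by move=> a; rewrite inE => -[sa aP]; rewrite /from_subspace (solidE _ aP sa).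
  apply: within_continuous_comp.
    move=> z; rewrite inE => -[a [sa aP] <-]; apply: continuous_chart => //.
    exact: solid_barycentric.
  apply: (@continuous_subspaceW _ _ W (points (of_facets labels1))).
    by move=> a [].
  exact: continuous_place.
- move=> a b; rewrite !inE => aP bP.
  have [k7 sa] := window_ofP aP; have [l7 sb] := window_ofP bP.
  move: (window_of a) (window_of b) k7 l7 sa sb => k l k7 l7 sa sb.
  rewrite (solidE _ aP sa) (solidE _ bP sb) => e.
  have [a0 a1 _] := (points_labels1P a).1 aP; have [b0 b1 _] := (points_labels1P b).1 bP.
  have za := solid_barycentric aP sa; have zb := solid_barycentric bP sb.
  have up (c : {ptws nat -> R}) m : mass c = 1 -> supported (window m) c ->
      screw (unroll m c) = unroll (m + 7) c.
    move=> c1 sc.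
    rewrite (unroll_screw (k := m) (l := m + 7) (window_uniq m) sc c1)//.
    by move=> v _; exact: lift_labelD7.
  have small : `|unroll k a 0 3 - unroll l b 0 3| < 14.
    have := unroll_height a0 a1 sa; have := unroll_height b0 b1 sb.
    have : (k%:R : R) < 7 by rewrite ltr_nat.
    have : (l%:R : R) < 7 by rewrite ltr_nat.
    have := ler0n R k; have := ler0n R l.
    by move=> ? ? ? ? /andP[? ?] /andP[? ?]; rewrite ltr_norml; apply/andP; split; lra.
  have [] := chart_inj sg1 za zb small e.
  + exact: unroll_inj.
  + by rewrite up//; apply: unroll_inj => //; rewrite windowD7.
  + by rewrite up// => /esym; apply: unroll_inj => //; rewrite windowD7.
- apply/seteqP; split=> [_ [a aP <-]|[y c] [yc y2]].
    have [k7 sa] := window_ofP aP; have za := solid_barycentric aP sa.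
    split; first by rewrite /solid; exact: chart_sphere2x1.
    have [t t0 ->] := chart_level sg1 za.
    by rewrite mulrCA [sg * (sg * _)]mulrA sg1 mul1r mulr_ge0 ?level_ge0 ?ltW.
  have [z zb [hz <-]] := chart_surj sg1 yc y2.
  have [k [a [a0 a1 sa az]]] := unroll_surj zb hz.
  have aP : points (of_facets labels1) a.
    apply/points_labels1P; split=> //; exists (k %% 7)%N; first by rewrite ltn_mod.
    rewrite (_ : window (k %% 7) = window k)//.
    by apply: eq_map => j; rewrite modnDml.
  by exists a => //; rewrite (solidE _ aP sa) az.
Qed.

Lemma solid_torus a :
  points (of_facets labels1) a -> points (of_facets torus_labels) a ->
  solid 1 a = solid (-1) a.
Proof.
move=> aP aT; have [k7 sa] := window_ofP aP.
by apply: chart_glue; [exact: solid_barycentric|exact/torus_level].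
Qed.

Lemma half_torus : half_product 1 `&` half_product (-1) `<=`
  solid 1 @` (points (of_facets labels1) `&` points (of_facets torus_labels)).
Proof.
have [_ _ e] := solid_parametrizes (mulr1 1).
move=> y [y1]; have [a aP ay] : (solid 1 @` points (of_facets labels1)) y by rewrite e.
move=> [_ yN]; exists a => //; split=> //.
have [k7 sa] := window_ofP aP; have za := solid_barycentric aP sa.
apply/(torus_level aP sa k7); apply/le_anti; rewrite level_ge0// andbT.
have [t t0 te] := chart_level (mulr1 1) za.
move: yN; rewrite -ay /= -/(solid 1 a).
by rewrite te mul1r mulN1r oppr_ge0 pmulr_rle0.
Qed.

Lemma half_cover : half_product 1 `|` half_product (-1) = sphere2x1 R.
Proof.
apply/seteqP; split=> [y [[]|[]]//|y yS].
have [le|/ltW le] := leP 0 (y.1 0 2); [left|right];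
  by split=> //; rewrite ?mul1r ?mulN1r ?oppr_ge0.
Qed.

End Solid.

(** * Labels of the vertices *)

Definition base_vertex (k : nat) : vertex :=
  if (k < 7)%N then digit k else nth (Wv 1 0) [:: Uv 1 0; Vv 1 0] (k - 7).

Definition label (j n k : nat) : vertex := relabel j n (base_vertex k).

Definition facet_labels (n : nat) := if (n <= 6)%N then labels10 else labels10'.

Definition solid_labels (j : nat) : seq (seq nat) :=
  match j with
  | 1 => labels1
  | 2 => [:: [:: 0; 2; 4; 6]; [:: 1; 2; 4; 6]; [:: 1; 3; 4; 6]; [:: 1; 3; 5; 6];
             [:: 0; 1; 3; 5]; [:: 0; 2; 3; 5]; [:: 0; 2; 4; 5]]
  | _ => labels3
  end%N.

Lemma solid10_labels : solid10 = relabelled base_vertex labels10.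
Proof. by []. Qed.

Lemma solid10'_labels : solid10' = relabelled base_vertex labels10'.
Proof. by vm_compute. Qed.

Lemma TjnE j n : Tjn j n = of_facets (relabelled (label j n) (facet_labels n)).
Proof.
rewrite /Tjn /facet_labels; congr of_facets; case: ifP => _.
  by rewrite solid10_labels -map_comp; apply: eq_map => f /=; rewrite -map_comp.
by rewrite solid10'_labels -map_comp; apply: eq_map => f /=; rewrite -map_comp.
Qed.

Lemma TjE j : (1 <= j <= 3)%N -> Tj j = of_facets (relabelled digit (solid_labels j)).
Proof. by case: j => [|[|[|[|]]]]. Qed.

Lemma torusE : torus = of_facets (relabelled digit torus_labels).
Proof. by []. Qed.

Lemma digit_mod m : digit (m %% 7) = digit m.
Proof.
congr Zv; apply: val_inj => /=.
by rewrite !val_Zp_nat// modn_mod.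
Qed.

Lemma digit_inj : {in iota 0 7 &, injective digit}.
Proof.
move=> k l; rewrite !mem_iota => /andP[_ k7] /andP[_ l7] [] /(congr1 val) /=.
by rewrite !val_Zp_nat// !modn_small.
Qed.

Definition rotate (j r k : nat) : nat := ((2 ^ j.-1 * k + r) %% 7)%N.

Lemma label_rotate j n k : (k < 7)%N -> label j n k = digit (rotate j (n %% 7) k).
Proof.
move=> k7; rewrite /label /base_vertex k7 /= /rotate digit_mod; congr Zv.
rewrite natrD natrM natrX; congr (_ + _); apply: val_inj.
by rewrite /= !val_Zp_nat// modn_mod.
Qed.

(** Multiplication by 2 is invertible modulo 7, as 8 = 1. *)
Lemma label_inj j n : (1 <= j <= 3)%N -> {in iota 0 10 &, injective (label j n)}.
Proof.
move=> /andP[j1 j3] k l; rewrite !mem_iota => /andP[_ k10] /andP[_ l10].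
have inj : injective (fun x : 'Z_7 => 2 ^+ j.-1 * x + n%:R).
  move=> x y /addIr /(congr1 (fun z => 2 ^+ (4 - j) * z)).
  have e : 2 ^+ (4 - j) * 2 ^+ j.-1 = 1 :> 'Z_7.
    rewrite -exprD (_ : 4 - j + j.-1 = 3)%N; first exact: val_inj.
    by case: j j1 j3 => [|[|[|[|]]]].
  by rewrite !mulrA e !mul1r.
rewrite /label /base_vertex; case: (ltnP k 7) => k7; case: (ltnP l 7) => l7 /=.
- move=> e; have kl := inj k%:R l%:R (congr1 (fun v => if v is Zv i then i else 0) e).
  by apply: digit_inj; rewrite ?mem_iota// /digit kl.
- case: l l7 l10 => [|[|[|[|[|[|[|[|[|[|//]]]]]]]]]] //.
- case: k k7 k10 => [|[|[|[|[|[|[|[|[|[|//]]]]]]]]]] //.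
- case: k k7 k10 => [|[|[|[|[|[|[|[|[|[|//]]]]]]]]]] // _ _;
  by case: l l7 l10 => [|[|[|[|[|[|[|[|[|[|//]]]]]]]]]] //.
Qed.

Definition is_old (v : vertex) : bool := if v is Zv _ then true else false.

Definition triangle (j r : nat) : seq nat := [seq rotate j r k | k <- [:: 0; 1; 2]]%N.

Definition rotated (j r : nat) (F : seq (seq nat)) :=
  [seq [seq rotate j r k | k <- f] | f <- F].

Lemma rotation_check : all (fun j => all (fun r =>
    same_facets (rotated j r torus_labels) torus_labels &&
    same_facets (rotated j r labels1) (solid_labels j)) (iota 0 7)) (iota 1 3).
Proof. by vm_compute. Qed.

(** The doubling map is a symmetry of order 3 that acts transitively on the pairs
    of different solid tori. *)
Lemma polytope_check : all (fun i => all (fun j => (i == j) ||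
    has (fun k => same_facets (rotated k 0 (labels1 ++ labels3))
                              (solid_labels i ++ solid_labels j))
      (iota 1 3)) (iota 1 3)) (iota 1 3).
Proof. by vm_compute. Qed.

Lemma within_check :
  let within n := all (fun f => sub_seq f (iota 0 n)) in
  [&& within 7 torus_labels, within 7 labels1, within 7 (labels1 ++ labels3),
      within 10 labels10 & within 10 labels10'].
Proof. by vm_compute. Qed.

Lemma torus_check :
  let contains G := all (fun f => has (sub_seq f) G) torus_labels in
  [&& contains labels1, contains labels10 & contains labels10'].
Proof. by vm_compute. Qed.

(** The triangle 012 separates u from v in T_{1,0}.  It is the only face on old
    vertices outside the torus, and starring w in it removes it. *)
Lemma trace_check :
  let traces F G :=
    all (fun f => has (sub_seq [seq k <- f | (k < 7)%N]) G) F in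
  traces labels10 (torus_labels ++ [:: [:: 0; 1; 2]%N]) &&
  traces labels10' torus_labels.
Proof. by vm_compute. Qed.

Lemma solid_triangle_check :
  all (fun i => all (fun j => all (fun r => (i == j) || all (fun f =>
      has (sub_seq [seq k <- f | k \in triangle j r]) torus_labels)
    (solid_labels i)) (iota 0 7)) (iota 1 3)) (iota 1 3).
Proof. by vm_compute. Qed.

Lemma triangles_check :
  all (fun i => all (fun q => all (fun j => all (fun r =>
      (i == j) && (q == r) ||
      has (sub_seq [seq k <- triangle i q | k \in triangle j r]) torus_labels)
    (iota 0 7)) (iota 1 3)) (iota 0 7)) (iota 1 3).
Proof. by vm_compute. Qed.

Lemma solids_check :
  all (fun i => all (fun j => (i == j) || all (fun f => all (fun g =>
      has (sub_seq [seq k <- f | k \in g]) torus_labels)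
    (solid_labels j)) (solid_labels i)) (iota 1 3)) (iota 1 3).
Proof. by vm_compute. Qed.

Lemma bounds_check :
  bounds 3 labels10 torus_labels && bounds 3 labels10' torus_labels.
Proof. by vm_compute. Qed.

(** * Intersections and unions of the solid tori *)

Section Labelled.
Implicit Types (i j m n r : nat).

Lemma mem_index3 j : (1 <= j <= 3)%N -> j \in iota 1 3.
Proof. by rewrite mem_iota. Qed.

Lemma mem_residue n : (n %% 7)%N \in iota 0 7.
Proof. by rewrite mem_iota ltn_mod. Qed.

Lemma rotated_labels j n F : all (fun f => sub_seq f (iota 0 7)) F ->
  relabelled (label j n) F = relabelled digit (rotated j (n %% 7) F).
Proof.
move=> /allP F7; rewrite /relabelled /rotated -map_comp.
apply/eq_in_map => f /F7/sub_seqP f7; rewrite /= -map_comp.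
apply/eq_in_map => k /f7; rewrite mem_iota => /andP[_ k7].
exact: label_rotate.
Qed.

Lemma torus_label j n : (1 <= j <= 3)%N ->
  torus = of_facets (relabelled (label j n) torus_labels).
Proof.
move=> /mem_index3 j3; have /and5P[w _ _ _ _] := within_check.
rewrite rotated_labels// torusE; apply/esym/same_facets_relabelled.
by have /allP/(_ _ j3)/allP/(_ _ (mem_residue n))/andP[] := rotation_check.
Qed.

Lemma Tj_label j n : (1 <= j <= 3)%N ->
  Tj j = of_facets (relabelled (label j n) labels1).
Proof.
move=> j3; have /and5P[_ w _ _ _] := within_check.
rewrite rotated_labels// TjE//; apply/esym/same_facets_relabelled.
by have /allP/(_ _ (mem_index3 j3))/allP/(_ _ (mem_residue n))/andP[] := rotation_check.
Qed.

Lemma labels_within n : all (fun f => sub_seq f (iota 0 10)) (facet_labels n).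
Proof. by rewrite /facet_labels; case: ifP; have /and5P[] := within_check. Qed.

Lemma labels1_within : all (fun f => sub_seq f (iota 0 10)) labels1.
Proof. by vm_compute. Qed.

Lemma torus_within : all (fun f => sub_seq f (iota 0 10)) torus_labels.
Proof. by vm_compute. Qed.

(** All refinements fill the polyhedron of T_1 in R^3. *)
Lemma Tj_flat (R : realType) j n : (1 <= j <= 3)%N ->
  flat_equiv R (Tj j) (Tjn j n).
Proof.
move=> j3; rewrite (Tj_label n j3) TjnE.
apply: (flat_relabelled (iota_uniq 0 10) (label_inj j3) labels1_within
  (labels_within n)).
exists 3%N, (position R 3); rewrite /facet_labels; split; first exact: labels1_embeds.
  by case: ifP => _; [case: (labels10_embeds R)|case: (labels10'_embeds R)].
by case: ifP => _; [case: (labels10_embeds R)|case: (labels10'_embeds R)].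
Qed.

Lemma Tjn_boundary j n : (1 <= j <= 3)%N -> is_boundary 3 (Tjn j n) torus.
Proof.
move=> j3; rewrite (torus_label n j3) TjnE.
apply: (bounds_is_boundary (label_inj j3) (labels_within n) torus_within).
by rewrite /facet_labels; case: ifP; have /andP[] := bounds_check.
Qed.

Lemma torus_sub_Tjn j n : (1 <= j <= 3)%N -> {subset faces torus <= faces (Tjn j n)}.
Proof.
move=> j3; rewrite (torus_label n j3) TjnE; apply: relabelled_sub; rewrite /facet_labels.
by have /and3P[_ t t'] := torus_check; case: ifP.
Qed.

Lemma torus_sub_Tj j : (1 <= j <= 3)%N -> {subset faces torus <= faces (Tj j)}.
Proof.
move=> j3; rewrite (torus_label 0 j3) (Tj_label 0 j3); apply: relabelled_sub.
by have /and3P[] := torus_check.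
Qed.

Definition old_face (s : {fset vertex}) := forall v, v \in s -> is_old v.

Lemma old_digit F (s : {fset vertex}) :
  s \in faces (of_facets (relabelled digit F)) -> old_face s.
Proof. by move=> /of_facetsP[_ /mapP[f _ ->] sf] v /sf/mapP[k _ ->]. Qed.

(** The old vertices of a facet have labels below 7, and [trace_check] locates
    them. *)
Lemma old_Tjn j n s : (1 <= j <= 3)%N -> s \in faces (Tjn j n) -> old_face s ->
  s \in faces torus \/
  (n <= 6)%N /\ {subset s <= map digit (triangle j (n %% 7))}.
Proof.
move=> j3; rewrite TjnE => /of_facetsP[_ /mapP[f fF ->] sf] os.
have sf7 v : v \in s -> v \in map (label j n) [seq k <- f | (k < 7)%N].
  move=> vs; have /mapP[k kf vk] := sf v vs; rewrite vk; apply: map_f.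
  rewrite mem_filter kf andbT; have := os v vs; rewrite vk /label /base_vertex.
  by case: ltnP => //; case: (k - 7)%N => [|[|[|]]].
have in_torus g : g \in torus_labels ->
    sub_seq [seq k <- f | (k < 7)%N] g -> s \in faces torus.
  move=> gT /sub_seqP fg; rewrite (torus_label n j3); apply/of_facetsP.
  exists (map (label j n) g); first exact: map_f.
  by move=> v /sf7/mapP[k /fg kg ->]; rewrite map_f.
have /andP[/allP t10 /allP t10'] := trace_check.
move: fF; rewrite /facet_labels; case: ifP => [n6|_] /=; last first.
  by move=> /t10'/hasP[g gT fg]; left; exact: in_torus fg.
move=> /t10/hasP[g]; rewrite mem_cat => /orP[gT|] fg; first by left; exact: in_torus fg.
move: fg; rewrite inE => /eqP -> /sub_seqP fg.
right; split=> // v /sf7/mapP[k /fg k012 ->].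
rewrite label_rotate; last by move: k012; rewrite !inE => /or3P[] /eqP ->.
by move: k012; rewrite !inE => /or3P[] /eqP ->; rewrite eqxx ?orbT.
Qed.

Lemma map_digit_inter (f g : seq nat) v :
  sub_seq f (iota 0 7) -> sub_seq g (iota 0 7) -> v \in map digit f ->
  v \in map digit g -> v \in map digit [seq k <- f | k \in g].
Proof.
move=> /sub_seqP f7 /sub_seqP g7 /mapP[k kf ->] /mapP[l lg].
move=> /(digit_inj (f7 _ kf) (g7 _ lg)) kl; apply: map_f.
by rewrite mem_filter kf kl lg.
Qed.

Lemma triangle_within j r : sub_seq (triangle j r) (iota 0 7).
Proof. by apply/sub_seqP => v /mapP[k _ ->]; rewrite mem_iota ltn_mod. Qed.

Lemma solid_within j : (1 <= j <= 3)%N ->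
  all (fun f => sub_seq f (iota 0 7)) (solid_labels j).
Proof. by case: j => [|[|[|[|]]]]. Qed.

Lemma sub_torus (s : {fset vertex}) f : has (sub_seq f) torus_labels ->
  {subset s <= map digit f} -> s \in faces torus.
Proof.
move=> /hasP[g gT /sub_seqP fg] sf; rewrite torusE; apply/of_facetsP.
by exists (map digit g); [exact: map_f|move=> v /sf/mapP[k /fg kg ->]; rewrite map_f].
Qed.

Lemma inter_torus (X Y : complex vertex) :
  {subset faces torus <= faces X} -> {subset faces torus <= faces Y} ->
  (forall s, s \in faces X -> s \in faces Y -> s \in faces torus) -> X |*| Y = torus.
Proof.
move=> TX TY XY; apply: complex_eq => s; rewrite in_fsetI.
by apply/andP/idP => [[]|sT]; [exact: XY|split; [exact: TX|exact: TY]].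
Qed.

Lemma Tj_I_Tj i j : (1 <= i <= 3)%N -> (1 <= j <= 3)%N -> i <> j ->
  Tj i |*| Tj j = torus.
Proof.
move=> i3 j3 ij; apply: inter_torus => [||s]; try exact: torus_sub_Tj.
rewrite !TjE// => /of_facetsP[_ /mapP[f fi ->] sf].
move=> /of_facetsP[_ /mapP[g gj ->] sg].
have /allP/(_ _ (mem_index3 i3))/allP/(_ _ (mem_index3 j3)) := solids_check.
move=> /orP[/eqP//|/allP/(_ _ fi)/allP/(_ _ gj) fg]; apply: (sub_torus fg) => v vs.
apply: map_digit_inter (sf _ vs) (sg _ vs).
  by have /allP := solid_within i3; exact.
by have /allP := solid_within j3; exact.
Qed.

Lemma Tj_I_Tjn i j n : (1 <= i <= 3)%N -> (1 <= j <= 3)%N ->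
  i <> j \/ (7 <= n)%N -> Tj i |*| Tjn j n = torus.
Proof.
move=> i3 j3 ij; apply: inter_torus => [||s]; [exact: torus_sub_Tj|exact: torus_sub_Tjn|].
rewrite (TjE i3) => si /(old_Tjn j3)/(_ (old_digit si)) [//|[n6 st]].
case/of_facetsP: si => _ /mapP[f fi ->] sf.
case: ij => [ij|]; last by rewrite leqNgt ltnS n6.
have /allP/(_ _ (mem_index3 i3))/allP/(_ _ (mem_index3 j3))/allP :=
  solid_triangle_check.
move=> /(_ _ (mem_residue n)).
move=> /orP[/eqP//|/allP/(_ _ fi) ft]; apply: (sub_torus ft) => v vs.
apply: map_digit_inter (sf _ vs) (st _ vs); last exact: triangle_within.
by have /allP := solid_within i3; exact.
Qed.

Lemma Tjn_I_Tjn i j m n : (1 <= i <= 3)%N -> (1 <= j <= 3)%N ->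
  (i, m) != (j, n) -> Tjn i m |*| Tjn j n = torus.
Proof.
move=> i3 j3 ij; apply: inter_torus => [||s si sj]; try exact: torus_sub_Tjn.
have os : old_face s.
  move=> v vs; move: si sj; rewrite !TjnE.
  move=> /of_facetsP[_ /mapP[f _ ->] /(_ _ vs)/mapP[k _ vk]].
  move=> /of_facetsP[_ /mapP[g _ ->] /(_ _ vs)/mapP[l _ vl]].
  move: vk vl; rewrite /label; case: (base_vertex k) => [x|? ?|? ?|? ?] ->;
    by case: (base_vertex l) => [y|? ?|? ?|? ?] // [im jn]; move: ij; rewrite im jn eqxx.
have [//|[m6 st]] := old_Tjn i3 si os.
have [//|[n6 st']] := old_Tjn j3 sj os.
have /allP/(_ _ (mem_index3 i3))/allP/(_ _ (mem_residue m)) := triangles_check.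
move=> /allP/(_ _ (mem_index3 j3))/allP/(_ _ (mem_residue n)).
move=> /orP[|tt].
  by rewrite !modn_small ?ltnS// => /andP[/eqP ie /eqP me]; rewrite ie me eqxx in ij.
apply: (sub_torus tt) => v vs.
by apply: map_digit_inter (st _ vs) (st' _ vs); exact: triangle_within.
Qed.

Section Manifolds.
Variable R : realType.

Lemma sphere_pair i j : (1 <= i <= 3)%N -> (1 <= j <= 3)%N -> i <> j ->
  exists g : {ptws vertex -> R} -> 'rV[R]_4,
    parametrizes (Tj i |+| Tj j) g (sphere R 3).
Proof.
move=> i3 j3 ij; rewrite !TjE// -of_facets_cat /relabelled -map_cat -/(relabelled _ _).
have /allP/(_ _ (mem_index3 i3))/allP/(_ _ (mem_index3 j3)) := polytope_check.
move=> /orP[/eqP//|/hasP[k k3 same]]; rewrite -(same_facets_relabelled digit same).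
have /and5P[_ _ w _ _] := within_check.
have <- : relabelled (label k 0) (labels1 ++ labels3) =
    relabelled digit (rotated k 0 (labels1 ++ labels3)) by rewrite rotated_labels.
have [g pg] := sphere_parametrized R.
have k3' : (1 <= k <= 3)%N by move: k3; rewrite mem_iota.
exists (g \o @pull _ _ (label k 0) (iota 0 10) R).
apply: (parametrizes_relabelled (iota_uniq 0 10) (label_inj k3') _ pg).
by vm_compute.
Qed.

(** T_i |+| T_j is already a sphere, and X, Y refine its two halves. *)
Lemma sphere_triangulated i j (X Y : complex vertex) :
  (1 <= i <= 3)%N -> (1 <= j <= 3)%N -> i <> j ->
  flat_equiv R (Tj i) X -> flat_equiv R (Tj j) Y -> X |*| Y = torus ->
  triangulates R (X |+| Y) (sphere R 3).
Proof.
move=> i3 j3 ij fX fY XY; have [g pg] := sphere_pair i3 j3 ij.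
have U : points (Tj i) `|` points (Tj j) = points (Tj i |+| Tj j)
    :> set {ptws vertex -> R}.
  by rewrite pointsU.
have pX : parametrizes (Tj i) g (g @` points (Tj i)).
  by apply: parametrizes_sub pg; rewrite -U; exact: subsetUl.
have pY : parametrizes (Tj j) g (g @` points (Tj j)).
  by apply: parametrizes_sub pg; rewrite -U; exact: subsetUr.
have -> : sphere R 3 = g @` points (Tj i) `|` g @` points (Tj j).
  by case: pg => _ _ <-; rewrite -U image_setU.
apply: (glue_flat (@norm_hausdorff R 'rV[R]_4) pX pY (torus_sub_Tj i3)
  (torus_sub_Tj j3) _ _ fX fY XY) => //.
move=> _ [[a aX <-] [b bY ba]]; case: pg => _ ig _.
have ab : b = a by apply: ig; rewrite // inE -U; [right|left].
by exists a => //; rewrite -(Tj_I_Tj i3 j3 ij) pointsI; split=> //; rewrite -ab.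
Qed.

(** X and Y are refinements of one and the same T_j, sent to opposite halves of
    the product. *)
Lemma product_triangulated j (X Y : complex vertex) : (1 <= j <= 3)%N ->
  flat_equiv R (Tj j) X -> flat_equiv R (Tj j) Y -> X |*| Y = torus ->
  triangulates R (X |+| Y) (sphere2x1 R).
Proof.
move=> j3 fX fY XY.
have s1 : (1 : R) * 1 = 1 by rewrite mulr1.
have sN : (-1 : R) * -1 = 1 by rewrite mulrNN mulr1.
pose P := @pull _ _ (label j 0) (iota 0 10) R.
have par sg (sg1 : sg * sg = 1) :
    parametrizes (Tj j) (solid sg \o P) (half_product sg).
  rewrite (Tj_label 0 j3).
  exact: (parametrizes_relabelled (iota_uniq 0 10) (label_inj j3) labels1_within
    (solid_parametrizes sg1)).
have PT : P @` points torus = points (of_facets torus_labels).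
  rewrite (torus_label 0 j3).
  apply: (pull_points (iota_uniq 0 10) (label_inj j3)).
  exact: torus_within.
have P1 : P @` points (Tj j) = points (of_facets labels1).
  rewrite (Tj_label 0 j3).
  apply: (pull_points (iota_uniq 0 10) (label_inj j3)).
  exact: labels1_within.
have TT : points torus `<=` (points (Tj j) : set {ptws vertex -> R}).
  exact: pointsS (torus_sub_Tj j3).
rewrite -half_cover.
apply: (glue_flat (@norm_hausdorff R ('rV[R]_3 * 'rV[R]_2)%type) (par _ s1)
  (par _ sN) (torus_sub_Tj j3) (torus_sub_Tj j3) _ _ fX fY XY).
- move=> a aT; apply: solid_torus; first by rewrite -P1; exists a => //; exact: TT.
  by rewrite -PT; exists a.
- move=> y /half_torus[b [_ bT] <-]; move: bT; rewrite -PT => -[a aT <-].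
  by exists a.
Qed.

End Manifolds.
End Labelled.

Theorem lemma3p4 (R : realType) :
  (* (i) *)
  (forall j n : nat, (1 <= j <= 3)%N -> subdivision R (Tjn j n) (Tj j)) /\
  (* (ii) *)
  (forall i j k l m n : nat, (1 <= i <= 3)%N -> (1 <= j <= 3)%N ->
     (k <= 6)%N -> (l <= 6)%N -> (7 <= m)%N -> (7 <= n)%N ->
     (Tjn i k ~= Tjn j l) /\ (Tjn i m ~= Tjn j n)) /\
  (* (iii) *)
  (forall j n : nat, (1 <= j <= 3)%N -> is_boundary 3 (Tjn j n) torus) /\
  (* (iv) *)
  (forall i j m n : nat, (1 <= i <= 3)%N -> (1 <= j <= 3)%N -> i <> j ->
     Tj i |*| Tjn j n = torus /\ Tjn i m |*| Tjn j n = torus) /\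
  (* (v) *)
  (forall j m n l : nat, (1 <= j <= 3)%N -> m <> n -> (7 <= l)%N ->
     Tjn j m |*| Tjn j n = torus /\ Tj j |*| Tjn j l = torus) /\
  (* (vi) *)
  (forall i j m n : nat, (1 <= i <= 3)%N -> (1 <= j <= 3)%N -> i <> j ->
     triangulates R (Tj i |+| Tjn j n) (sphere R 3) /\
     triangulates R (Tjn i m |+| Tjn j n) (sphere R 3)) /\
  (* (vii) *)
  (forall j m n l : nat, (1 <= j <= 3)%N -> m <> n -> (7 <= l)%N ->
     triangulates R (Tjn j m |+| Tjn j n) (sphere2x1 R) /\
     triangulates R (Tj j |+| Tjn j l) (sphere2x1 R)).
Proof.
have iv i j m n : (1 <= i <= 3)%N -> (1 <= j <= 3)%N -> i <> j ->
    Tj i |*| Tjn j n = torus /\ Tjn i m |*| Tjn j n = torus.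
  move=> i3 j3 ij; split; first by apply: Tj_I_Tjn => //; left.
  by apply: Tjn_I_Tjn => //; apply/eqP => -[].
have v j m n l : (1 <= j <= 3)%N -> m <> n -> (7 <= l)%N ->
    Tjn j m |*| Tjn j n = torus /\ Tj j |*| Tjn j l = torus.
  move=> j3 mn l7; split; last by apply: Tj_I_Tjn => //; right.
  by apply: Tjn_I_Tjn => //; apply/eqP => -[].
have iso F i j k l : (1 <= i <= 3)%N -> (1 <= j <= 3)%N ->
    all (fun f => sub_seq f (iota 0 10)) F ->
    of_facets (relabelled (label i k) F) ~= of_facets (relabelled (label j l) F).
  by move=> i3 j3 wF; apply: (relabelled_isomorphic 0%N (label_inj i3) (label_inj j3)).
split; first by move=> j n j3; exact/flat_equiv_subdivision/Tj_flat.
split.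
  move=> i j k l m n i3 j3 k6 l6 m7 n7; have /and5P[_ _ _ w10 w10'] := within_check.
  have small q : (q <= 6)%N -> facet_labels q = labels10 by rewrite /facet_labels => ->.
  have large q : (7 <= q)%N -> facet_labels q = labels10'.
    by rewrite /facet_labels leqNgt => /negbTE; rewrite ltnS => ->.
  by split; rewrite !TjnE; [rewrite !small|rewrite !large]; rewrite //; exact: iso.
split; first by move=> j n; exact: Tjn_boundary.
split; first exact: iv.
split; first exact: v.
split=> [i j m n i3 j3 ij|j m n l j3 mn l7].
  have [I1 I2] := iv i j m n i3 j3 ij.
  split; apply: (sphere_triangulated i3 j3 ij) => //; try exact: Tj_flat.
  exact: flat_equiv_refl.
have [I1 I2] := v j m n l j3 mn l7.
split; apply: (product_triangulated j3) => //; try exact: Tj_flat.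
exact: flat_equiv_refl.
Qed.
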